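(* Let $g_0(t) = 2^{1/4}e^{-\pi t^2}$ be the standard Gaussian and let $\Lambda_h \subset \mathbb{R}^2$ be a hexagonal lattice of redundancy $2$. Let $A_{g_0,2}(\Lambda_h)$ and $B_{g_0,2}(\Lambda_h)$ denote the sharp lower and upper frame bounds of the Gabor frame $\mathcal{G}(g_0,\Lambda_h)$. Then $$\frac{B_{g_0,2}(\Lambda_h)}{A_{g_0,2}(\Lambda_h)} = \sqrt[3]{2}.$$
   Context: For $\lambda = (x,\omega) \in \mathbb{R}^2$, the time-frequency shift is $\pi(\lambda) g(t) = e^{2\pi i \omega t} g(t-x)$. For $g \in L^2(\mathbb{R})$ and a lattice $\Lambda \subset \mathbb{R}^2$, the Gabor system is $\mathcal{G}(g,\Lambda) = \{\pi(\lambda) g : \lambda \in \Lambda\}$. The sharp frame bounds are the optimal constants $A$ (largest possible) and $B$ (smallest possible) such that $$A \|f\|^2 \le \sum_{\lambda \in \Lambda} |\langle f, \pi(\lambda) g\rangle|^2 \le B\|f\|^2 \quad \text{for all } f \in L^2(\mathbb{R}),$$ and the system is a Gabor frame if $0 < A \le B < \infty$. The redundancy (density) of a lattice $\Lambda = S\mathbb{Z}^2$ is $1/|\det S|$. A hexagonal lattice of redundancy $2$ is a lattice of the form $Q S_h \mathbb{Z}^2$, where $Q$ is an orthogonal $2\times 2$ matrix and $$S_h = \frac{1}{\sqrt{2}} \begin{pmatrix} \frac{\sqrt[4]{3}}{\sqrt{2}} & 0 \\ \frac{\sqrt{2}}{2\sqrt[4]{3}} & \frac{\sqrt{2}}{\sqrt[4]{3}}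 \end{pmatrix}.$$ *)

(* Defs.v *)
From HB Require Import structures.
From mathcomp Require Import all_boot all_order all_algebra.
From mathcomp Require Import complex.
From mathcomp Require Import all_classical all_reals all_analysis.

Set Implicit Arguments.
Unset Strict Implicit.
Unset Printing Implicit Defensive.

Import Order.TTheory GRing.Theory Num.Theory.
Import ComplexField.
Import numFieldNormedType.Exports.

Local Open Scope classical_set_scope.
Local Open Scope complex_scope.
Local Open Scope ring_scope.

Section Gabor.
Variable R : realType.
Implicit Types (f g h : R -> R[i]) (L : set 'cV[R]_2) (S : 'M[R]_2).

Local Notation mu := (@lebesgue_measure R).

Definition cmeasurable f : Prop :=
  measurable_fun [set: R] (fun t => complex.Re (f t)) /\
  measurable_fun [set: R] (fun t => complex.Im (f t)).

Definition L2norm f : \bar R := 'N[mu]_2%:E [(fun t => (Normc.normc (f t))%:E)].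

(* Elements of L^2(R) are given by representatives: norms and inner products
   do not depend on the choice within an a.e.-class. *)
Definition L2 f : Prop := cmeasurable f /\ (L2norm f < +oo)%E.

Definition cintegral f : R[i] :=
  (\int[mu]_t complex.Re (f t)) +i* (\int[mu]_t complex.Im (f t)).

Definition inner f h : R[i] := cintegral (fun t => f t * (h t)^*).

Definition cis (x : R) : R[i] := cos x +i* sin x.

Definition tfshift (l : 'cV[R]_2) g : R -> R[i] :=
  let x := l 0 0 in let omega := l 1 0 in
  fun t => cis (2 * pi * omega * t) * g (t - x).

Definition lattice S : set 'cV[R]_2 :=
  range (fun k : 'cV[int]_2 => S *m map_mx intr k).

Definition gabor_sum g L f : \bar R :=
  (\esum_(l in L) ((Normc.normc (inner f (tfshift l g))) ^+ 2)%:E)%E.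

(* Since the inequalities are closed conditions on the constant, the supremum
   (resp. infimum) is the largest (resp. smallest) admissible constant whenever
   it is finite; the upper bound is +oo if no constant is admissible. *)
Definition lower_frame_bound g L : \bar R :=
  ereal_sup [set a%:E | a in
    [set a : R | forall f, L2 f -> (a%:E * L2norm f ^+ 2 <= gabor_sum g L f)%E]].

Definition upper_frame_bound g L : \bar R :=
  ereal_inf [set b%:E | b in
    [set b : R | forall f, L2 f -> (gabor_sum g L f <= b%:E * L2norm f ^+ 2)%E]].

Definition gabor_frame g L : Prop :=
  (0 < lower_frame_bound g L)%E /\
  (lower_frame_bound g L <= upper_frame_bound g L)%E /\
  (upper_frame_bound g L < +oo)%E.

Definition gaussian (t : R) : R[i] :=
  (2 `^ 4^-1 * expR (- pi * t ^+ 2))%:C.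

(* Hexagonal generating matrix of redundancy 2, i.e. of determinant 1/2. *)
Definition hex_matrix2 : 'M[R]_2 :=
  let r3 := 3 `^ 4^-1 in let r2 := Num.sqrt 2 in
  r2^-1 *: \matrix_(i < 2, j < 2)
    nth 0 (nth [::] [:: [:: r3 / r2;         0      ];
                        [:: r2 / (2 * r3);   r2 / r3]] i) j.

Definition hexagonal_lattice2 L : Prop :=
  exists Q : 'M[R]_2, Q *m Q^T = 1%:M /\ L = lattice (Q *m hex_matrix2).

End Gabor.

(* Main.v *)
(* For the symmetric time-frequency shifts [rho] one has
   [<rho z g, rho w g> = exp (- pi |z - w|^2 / 2) cis (pi [z, w])], so for a finite combination [f]
   of shifts of the Gaussian Poisson summation (Janssen's representation) turns the frame sum over
   the hexagonal lattice into [2 * sum_m q m * c m], where [m] ranges over the adjoint lattice, a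
   copy of [Z^2], [q m = exp (- pi |m|^2 / 2)] and [c m] is the correlation of [f] and [rho m f].
   The shifts by the adjoint lattice commute, so [c] is a positive definite function on [Z^2] with
   [c 0 = |f|^2]. This gives the upper bound [2 * sum q]. The lower bound is [2 * sum q * chi] with
   [chi] the character of order three of the hexagonal lattice, at which the transform of [q] is
   minimal: in [sum q * (c - c 0 * chi)] the six shortest vectors dominate, because positive
   definiteness bounds [c 0 - c m] quadratically in [m] by its values there. Averaging over large
   boxes of shifts, twisted by the trivial character or by [chi], shows that both bounds are sharp,
   and density of the combinations in L^2 extends them to all [f]. Finally [a = sum q] and [b = sum q * chi] are
   Borwein's cubic theta functions at the self-dual nome, where Poisson summation gives [b = c], and
   [a^3 = b^3 + c^3] yields [(a / b)^3 = 2]. *)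
Require Import Defs.
From mathcomp Require Import all_boot all_order all_algebra finmap.
From mathcomp Require Import all_classical all_reals all_analysis.
From mathcomp Require Import complex measurable_realfun ring lra zify.

Set Implicit Arguments.
Unset Strict Implicit.
Unset Printing Implicit Defensive.
Import Order.TTheory GRing.Theory Num.Theory.
Import numFieldNormedType.Exports.

Local Open Scope classical_set_scope.
Local Open Scope ring_scope.

(** * Absolutely convergent families *)

(** The lower bound is delicate because [chi] equals 1 on a sublattice of index three, where every
    term of [sum q * (c - c 0 * chi)] is nonpositive. The compensation comes from the six shortest
    vectors through the single quantity [En (1, 0)], the squared norm of a sum of three vectors in
    the Hilbert space of the positive definite function. It vanishes when [c] is [chi], so gain and
    loss must both be measured in multiples of it; what remains is one numerical inequality, true
    because the nome [exp (- 2 pi / sqrt 3)] is below 1/19. Complex exponentials are replaced by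
    cosines with a phase, complex functions by pairs of real ones, and each coefficient contributes
    two real squares. Norm and frame sum are explicit kernels on formal combinations of shifts
    before they are identified with integrals. Orthogonal matrices act on these formal combinations,
    preserving or reversing the symplectic form, so the reduction to one hexagonal lattice needs no
    operator on L^2. Poisson summation comes from evaluating Gaussian integrals against the Fejer
    kernel in two ways. *)

Lemma le_of_eq (d : Order.disp_t) (T : porderType d) (x y : T) : x = y -> (x <= y)%O.
Proof. by move->. Qed.

Section Rsum.
Context {R : realType}.

Definition summ (T : choiceType) (f : T -> R) : Prop :=
  (\esum_(i in [set: T]) `|f i|%:E < +oo)%E.

(** Unordered summation of signed families, built from [\esum] of the positive and negative parts.
    The value is meaningful only under [summ]: [fine] turns an infinite part into 0. *)
Definition rsum (T : choiceType) (f : T -> R) : R :=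
  fine (\esum_(i in [set: T]) (Num.max (f i) 0)%:E)
  - fine (\esum_(i in [set: T]) (Num.max (- f i) 0)%:E).

Lemma summ_le (T : choiceType) (f g : T -> R) :
  (forall i, `|f i| <= g i) -> summ g -> summ f.
Proof.
move=> fg; apply: le_lt_trans; apply: le_esum => i _.
by rewrite lee_fin (le_trans (fg i)) ?ler_norm.
Qed.

Lemma esum_fin (T : choiceType) (f : T -> R) : summ f ->
  forall g : T -> R, (forall i, 0 <= g i <= `|f i|) ->
  (\esum_(i in [set: T]) (g i)%:E)%E \is a fin_num.
Proof.
move=> sf g gf; rewrite ge0_fin_numE; last first.
  by apply: esum_ge0 => i _; rewrite lee_fin; case/andP: (gf i).
apply: le_lt_trans sf; apply: le_esum => i _.
by rewrite lee_fin; case/andP: (gf i).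
Qed.

Lemma pos_part_le (x : R) : 0 <= Num.max x 0 <= `|x|.
Proof. by rewrite le_max lexx orbT ge_max ler_norm normr_ge0. Qed.

Lemma neg_part_le (x : R) : 0 <= Num.max (- x) 0 <= `|x|.
Proof. by rewrite -normrN pos_part_le. Qed.

Lemma eq_summ (T : choiceType) (f g : T -> R) : f =1 g -> summ f -> summ g.
Proof. by move=> /funext ->. Qed.

Lemma eq_rsum (T : choiceType) (f g : T -> R) : f =1 g -> rsum f = rsum g.
Proof. by move=> /funext ->. Qed.

Lemma rsum_ge0E (T : choiceType) (f : T -> R) : (forall i, 0 <= f i) ->
  summ f -> (\esum_(i in [set: T]) (f i)%:E)%E = (rsum f)%:E.
Proof.
move=> f0 sf; rewrite /rsum.
rewrite [X in _ - fine X]esum1 ?subr0; last first.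
  by move=> i _; congr EFin; apply/max_idPr; rewrite oppr_le0.
rewrite fineK; last by apply: (esum_fin sf) => i; exact: pos_part_le.
by apply: eq_esum => i _; congr EFin; apply/esym/max_idPl.
Qed.

Lemma summ_ge0 (T : choiceType) (f : T -> R) (M : R) : (forall i, 0 <= f i) ->
  (\esum_(i in [set: T]) (f i)%:E <= M%:E)%E -> summ f.
Proof.
move=> f0 fM; rewrite /summ (eq_esum (b := fun i => (f i)%:E)).
  exact: le_lt_trans (ltry M).
by move=> i _; rewrite ger0_norm.
Qed.

Lemma summ_abs (T : choiceType) (f : T -> R) : summ f -> summ (fun i => `|f i|).
Proof. by rewrite /summ; under [X in _ -> is_true (X < _)%E]eq_esum do rewrite normr_id. Qed.

Lemma summD (T : choiceType) (f g : T -> R) : summ f -> summ g ->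
  summ (fun i => f i + g i).
Proof.
move=> sf sg; apply: (@summ_le _ _ (fun i => `|f i| + `|g i|)).
  by move=> i; exact: ler_normD.
apply: (@summ_ge0 _ _ (rsum (fun i => `|f i|) + rsum (fun i => `|g i|))).
- by move=> i; rewrite addr_ge0.
- under eq_esum do rewrite EFinD.
  by rewrite esumD// !rsum_ge0E//; exact: summ_abs.
Qed.

(** Any splitting into summable nonnegative families gives the same value as the canonical one: the
    positive and negative parts satisfy [p + h = g + n], and [\esum] is additive on nonnegative
    terms. Linearity of [rsum] rests on this. *)
Lemma rsum_diff (T : choiceType) (f g h : T -> R) :
  (forall i, 0 <= g i) -> (forall i, 0 <= h i) -> summ g -> summ h ->
  (forall i, f i = g i - h i) -> rsum f = rsum g - rsum h.
Proof.
move=> g0 h0 sg sh fE.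
have sf : summ f.
  apply: (@summ_le _ _ (fun i => g i + h i)); last exact: summD.
  move=> i; rewrite fE (le_trans (ler_normB _ _))// !ger0_norm//.
pose p i := Num.max (f i) 0; pose n i := Num.max (- f i) 0.
have p0 i : 0 <= p i by case/andP: (pos_part_le (f i)).
have n0 i : 0 <= n i by case/andP: (neg_part_le (f i)).
have sp : summ p.
  by apply: summ_le (summ_abs sf) => i; rewrite ger0_norm//; case/andP: (pos_part_le (f i)).
have sn : summ n.
  by apply: summ_le (summ_abs sf) => i; rewrite ger0_norm//; case/andP: (neg_part_le (f i)).
have pn i : p i + h i = g i + n i.
  have := fE i; rewrite /p /n; case: (leP (f i) 0) => f0; case: (leP (- f i) 0) => f1 => e; lra.
have : (\esum_(i in [set: T]) (p i)%:E + \esum_(i in [set: T]) (h i)%:E =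
        \esum_(i in [set: T]) (g i)%:E + \esum_(i in [set: T]) (n i)%:E)%E.
  rewrite -!esumD//; do ?by move=> i _; rewrite lee_fin.
  by apply: eq_esum => i _; rewrite -!EFinD pn.
rewrite !rsum_ge0E// -!EFinD => -[e].
have -> : rsum f = rsum p - rsum n.
  by congr (_ - _); apply: EFin_inj; rewrite -rsum_ge0E// fineK// (esum_fin sf)// => i;
    [exact: pos_part_le|exact: neg_part_le].
lra.
Qed.

Lemma summ_pos (T : choiceType) (f : T -> R) : summ f -> summ (fun i => Num.max (f i) 0).
Proof.
move=> /summ_abs; apply: summ_le => i.
by case/andP: (pos_part_le (f i)) => h1 h2; rewrite ger0_norm.
Qed.

Lemma summN (T : choiceType) (f : T -> R) : summ f -> summ (fun i => - f i).
Proof. by move=> /summ_abs; apply: summ_le => i; rewrite normrN. Qed.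

Lemma rsum_posneg (T : choiceType) (f : T -> R) : summ f ->
  rsum f = rsum (fun i => Num.max (f i) 0) - rsum (fun i => Num.max (- f i) 0).
Proof.
move=> sf; apply: rsum_diff; try by move=> i; rewrite le_max lexx orbT.
- exact: summ_pos.
- exact/summ_pos/summN.
- by move=> i; case: (leP (f i) 0); case: (leP (- f i) 0); lra.
Qed.

Lemma rsumD (T : choiceType) (f g : T -> R) : summ f -> summ g ->
  rsum (fun i => f i + g i) = rsum f + rsum g.
Proof.
move=> sf sg.
pose p i := Num.max (f i) 0; pose n i := Num.max (- f i) 0.
pose p' i := Num.max (g i) 0; pose n' i := Num.max (- g i) 0.
have [sp sn] : summ p /\ summ n by split; [exact: summ_pos|exact/summ_pos/summN].
have [sp' sn'] : summ p' /\ summ n' by split; [exact: summ_pos|exact/summ_pos/summN].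
have [p0 n0] : (forall i, 0 <= p i) /\ (forall i, 0 <= n i).
  by split=> i; rewrite le_max lexx orbT.
have [p'0 n'0] : (forall i, 0 <= p' i) /\ (forall i, 0 <= n' i).
  by split=> i; rewrite le_max lexx orbT.
have add (u v : T -> R) : (forall i, 0 <= u i) -> (forall i, 0 <= v i) -> summ u -> summ v ->
    rsum (fun i => u i + v i) = rsum u + rsum v.
  move=> u0 v0 su sv; apply: EFin_inj; rewrite [RHS]EFinD -(rsum_ge0E (f:=u))// -(rsum_ge0E (f:=v))// -rsum_ge0E.
  - by rewrite -esumD// => i _; rewrite lee_fin.
  - by move=> i; rewrite addr_ge0.
  - exact: summD.
rewrite (@rsum_diff _ _ (fun i => p i + p' i) (fun i => n i + n' i)).
- by rewrite !add// [rsum f]rsum_posneg// [rsum g]rsum_posneg// -/p -/n -/p' -/n'; lra.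
- by move=> i; rewrite addr_ge0.
- by move=> i; rewrite addr_ge0.
- exact: summD.
- exact: summD.
- move=> i; rewrite /p /n /p' /n'.
  by case: (leP (f i) 0); case: (leP (- f i) 0); case: (leP (g i) 0); case: (leP (- g i) 0); lra.
Qed.

Lemma rsumN (T : choiceType) (f : T -> R) : rsum (fun i => - f i) = - rsum f.
Proof.
rewrite /rsum opprB; congr (_ - fine _).
by apply: eq_esum => i _; rewrite opprK.
Qed.

Lemma rsumB (T : choiceType) (f g : T -> R) : summ f -> summ g ->
  rsum (fun i => f i - g i) = rsum f - rsum g.
Proof. by move=> sf sg; rewrite rsumD// ?rsumN//; exact: summN. Qed.

Lemma rsum_ge0 (T : choiceType) (f : T -> R) : (forall i, 0 <= f i) -> 0 <= rsum f.
Proof.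
move=> f0; rewrite /rsum [X in _ - fine X]esum1 ?subr0.
  by apply/fine_ge0/esum_ge0 => i _; rewrite lee_fin le_max f0.
by move=> i _; congr EFin; apply/max_idPr; rewrite oppr_le0.
Qed.

Lemma ler_rsum (T : choiceType) (f g : T -> R) : summ f -> summ g ->
  (forall i, f i <= g i) -> rsum f <= rsum g.
Proof.
move=> sf sg fg; rewrite -subr_ge0 -rsumB//.
by apply: rsum_ge0 => i; rewrite subr_ge0.
Qed.

Lemma ler_norm_rsum (T : choiceType) (f : T -> R) : summ f -> `|rsum f| <= rsum (fun i => `|f i|).
Proof.
move=> sf; rewrite ler_norml; apply/andP; split.
  rewrite -rsumN; apply: ler_rsum => //; first exact/summN/summ_abs.
  by move=> i; rewrite lerNl -normrN ler_norm.
by apply: ler_rsum => //; [exact: summ_abs|move=> i; exact: ler_norm].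
Qed.

Lemma summ0 (T : choiceType) : summ (fun _ : T => 0).
Proof. by rewrite /summ esum1 ?ltry// => i _; rewrite normr0. Qed.

Lemma rsum0 (T : choiceType) : rsum (fun _ : T => 0) = 0.
Proof. by rewrite /rsum oppr0 subrr. Qed.

Lemma summZ (T : choiceType) (c : R) (f : T -> R) : summ f -> summ (fun i => c * f i).
Proof.
move=> sf; apply: (@summ_le _ _ (fun i => `|c| * `|f i|)).
  by move=> i; rewrite normrM.
rewrite /summ; apply: (@le_lt_trans _ _ (`|c|%:E * \esum_(i in [set: T]) `|f i|%:E)%E); last first.
  rewrite (rsum_ge0E (f := fun i => `|f i|)) ?ltry//; exact: summ_abs.
under eq_esum do rewrite normrM !normr_id.
apply: ge_ereal_sup => _ [X [finX _]] <-.
have -> : (\sum_(x \in X) (`|c| * `|f x|)%:E = `|c|%:E * \sum_(x \in X) (`|f x|)%:E)%E.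
  by rewrite ge0_mule_fsumr.
rewrite lee_wpmul2l ?lee_fin//; apply: esum_ge; exists X => //.
Qed.

Lemma rsumZ (T : choiceType) (c : R) (f : T -> R) : summ f ->
  rsum (fun i => c * f i) = c * rsum f.
Proof.
wlog c0 : c / 0 <= c.
  move=> H sf; case: (leP 0 c) => [|/ltW c0]; first by move/H; apply.
  rewrite -[RHS]opprK -mulNr -H ?oppr_ge0// -rsumN.
  by apply: eq_rsum => i; rewrite mulNr opprK.
have ge0 (g : T -> R) : (forall i, 0 <= g i) -> summ g -> rsum (fun i => c * g i) = c * rsum g.
  move=> g0 sg; apply: EFin_inj; rewrite EFinM -!rsum_ge0E//; last 2 first.
  - by move=> i; rewrite mulr_ge0.
  - exact: summZ.
  apply/eqP; rewrite eq_le; apply/andP; split.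
    apply: ge_ereal_sup => _ [X [finX _]] <-.
    rewrite (eq_fsbigr (fun i => (c%:E * (g i)%:E)%E)) => [|i _]; last by rewrite EFinM.
    rewrite -ge0_mule_fsumr => [|i]; last by rewrite lee_fin.
    by rewrite lee_wpmul2l ?lee_fin//; apply: esum_ge; exists X.
  have [<-|c0'] := eqVneq 0 c.
    by rewrite mul0e; apply: esum_ge0 => i _; rewrite mul0r.
  have {c0'}c0 : 0 < c by rewrite lt_neqAle c0' c0.
  rewrite -lee_pdivlMl//; apply: ge_ereal_sup => _ [X [finX _]] <-.
  rewrite lee_pdivlMl// ge0_mule_fsumr => [|i]; last by rewrite lee_fin.
  by apply: esum_ge; exists X.
move=> sf; have sn : summ (fun i => - f i) by exact: summN.
rewrite (rsum_posneg sf) mulrBr -!ge0; first last.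
- exact: summ_pos.
- by move=> i; rewrite le_max lexx orbT.
- exact: summ_pos.
- by move=> i; rewrite le_max lexx orbT.
apply: rsum_diff => [i|i|||i].
- by rewrite mulr_ge0// le_max lexx orbT.
- by rewrite mulr_ge0// le_max lexx orbT.
- exact/summZ/summ_pos.
- exact/summZ/summ_pos.
- by rewrite -mulrBr; congr (_ * _); case: (leP (f i) 0); case: (leP (- f i) 0); lra.
Qed.

Lemma rsumZr (T : choiceType) (c : R) (f : T -> R) : summ f ->
  rsum (fun i => f i * c) = rsum f * c.
Proof. by move=> sf; rewrite mulrC -rsumZ//; apply: eq_rsum => i; rewrite mulrC. Qed.

Lemma summZr (T : choiceType) (c : R) (f : T -> R) : summ f -> summ (fun i => f i * c).
Proof. by move=> /(summZ c); apply: eq_summ => i; rewrite mulrC. Qed.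

Lemma summ_sum (T : choiceType) (I : Type) (s : seq I) (f : I -> T -> R) :
  (forall k, summ (f k)) -> summ (fun i => \sum_(k <- s) f k i).
Proof.
move=> sf; elim: s => [|k s IH].
  by apply: eq_summ (@summ0 T) => i; rewrite big_nil.
by apply: eq_summ (summD (sf k) IH) => i; rewrite big_cons.
Qed.

Lemma rsum_sum (T : choiceType) (I : Type) (s : seq I) (f : I -> T -> R) :
  (forall k, summ (f k)) ->
  rsum (fun i => \sum_(k <- s) f k i) = \sum_(k <- s) rsum (f k).
Proof.
move=> sf; elim: s => [|k s IH].
  by rewrite big_nil -[RHS](rsum0 T); apply: eq_rsum => i; rewrite big_nil.
rewrite big_cons -IH -rsumD//; last exact: summ_sum.
by apply: eq_rsum => i; rewrite big_cons.
Qed.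

Lemma summ_reindex (T T' : choiceType) (e : T -> T') (f : T' -> R) : bijective e ->
  summ f <-> summ (f \o e).
Proof.
move=> be; rewrite /summ (reindex_esum [set: T] _ e)//.
by rewrite setTT_bijective.
Qed.

Lemma rsum_reindex (T T' : choiceType) (e : T -> T') (f : T' -> R) : bijective e ->
  rsum f = rsum (fun i => f (e i)).
Proof.
move=> be; rewrite /rsum (reindex_esum [set: T] _ e); last by rewrite setTT_bijective.
by congr (_ - _); rewrite (reindex_esum [set: T] _ e)//; by rewrite setTT_bijective.
Qed.

Lemma esum_pair (T1 T2 : choiceType) (f : T1 * T2 -> R) : (forall i, 0 <= f i) ->
  (\esum_(i in [set: T1 * T2]) (f i)%:E =
   \esum_(i in [set: T1]) \esum_(j in [set: T2]) (f (i, j))%:E)%E.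
Proof.
move=> f0; rewrite (esum_esum (a := fun i j => (f (i, j))%:E)); last by move=> i j _ _; rewrite lee_fin.
have -> : [set: T1] `*`` (fun _ => [set: T2]) = [set: T1 * T2] by apply/seteqP; split.
by apply: eq_esum => -[i j].
Qed.

Lemma summ_pair1 (T1 T2 : choiceType) (f : T1 * T2 -> R) i : summ f ->
  summ (fun j => f (i, j)).
Proof.
rewrite /summ (esum_pair (f := fun i => `|f i|))// => h.
apply: le_lt_trans h; apply: esum_ge; exists [set i]; first by split.
by rewrite fsbig_set1.
Qed.

Lemma rsum_pair_ge0 (T1 T2 : choiceType) (f : T1 * T2 -> R) : (forall i, 0 <= f i) ->
  summ f -> summ (fun i => rsum (fun j => f (i, j))) /\
  rsum f = rsum (fun i => rsum (fun j => f (i, j))).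
Proof.
move=> f0 sf.
have h : (\esum_(i in [set: T1]) (rsum (fun j => f (i, j)))%:E = (rsum f)%:E)%E.
  rewrite -rsum_ge0E// esum_pair//; apply: eq_esum => i _; rewrite rsum_ge0E//.
  exact: summ_pair1.
have s : summ (fun i => rsum (fun j => f (i, j))).
  by apply: (@summ_ge0 _ _ (rsum f)); rewrite ?h// => i; exact: rsum_ge0.
by split=> //; apply: EFin_inj; rewrite -h rsum_ge0E// => i; exact: rsum_ge0.
Qed.

Lemma summ_pair (T1 T2 : choiceType) (f : T1 * T2 -> R) : summ f ->
  summ (fun i => rsum (fun j => f (i, j))).
Proof.
move=> sf; have [s _] := @rsum_pair_ge0 T1 T2 (fun i => `|f i|) (fun _ => normr_ge0 _) (summ_abs sf).
by apply: summ_le s => i; apply: ler_norm_rsum; exact: summ_pair1.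
Qed.

Lemma rsum_pair (T1 T2 : choiceType) (f : T1 * T2 -> R) : summ f ->
  rsum f = rsum (fun i => rsum (fun j => f (i, j))).
Proof.
move=> sf.
have [s1 e1] := @rsum_pair_ge0 T1 T2 (fun i => Num.max (f i) 0) (fun i => (andP (pos_part_le (f i))).1) (summ_pos sf).
have [s2 e2] := @rsum_pair_ge0 T1 T2 (fun i => Num.max (- f i) 0) (fun i => (andP (neg_part_le (f i))).1) (summ_pos (summN sf)).
rewrite (rsum_posneg sf) e1 e2 -rsumB//.
by apply: eq_rsum => i; rewrite -rsum_posneg//; exact: summ_pair1.
Qed.

Lemma summM (T1 T2 : choiceType) (f : T1 -> R) (g : T2 -> R) : summ f -> summ g ->
  summ (fun p : T1 * T2 => f p.1 * g p.2).
Proof.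
move=> sf sg; rewrite /summ (esum_pair (f := fun p => `|f p.1 * g p.2|))//=.
have e i : (\esum_(j in [set: T2]) `|f i * g j|%:E = (`|f i| * rsum (fun j => `|g j|))%:E)%E.
  rewrite -rsumZ; last exact: summ_abs.
  rewrite -rsum_ge0E => [|j|]; last 2 first.
  - by rewrite mulr_ge0.
  - exact/summZ/summ_abs.
  by apply: eq_esum => j _; rewrite normrM.
under eq_esum do rewrite e.
have : summ (fun i => `|f i| * rsum (fun j => `|g j|)) by exact/summZr/summ_abs.
apply: le_lt_trans; apply: le_esum => i _; rewrite lee_fin; exact: ler_norm.
Qed.

Lemma rsumM (T1 T2 : choiceType) (f : T1 -> R) (g : T2 -> R) : summ f -> summ g ->
  rsum (fun p : T1 * T2 => f p.1 * g p.2) = rsum f * rsum g.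
Proof.
move=> sf sg; rewrite rsum_pair; last exact: summM.
by rewrite -rsumZr//; apply: eq_rsum => i /=; rewrite rsumZ.
Qed.

Lemma rsum_swap (T1 T2 : choiceType) (f : T1 -> T2 -> R) :
  summ (fun p : T1 * T2 => f p.1 p.2) ->
  rsum (fun i => rsum (fun j => f i j)) = rsum (fun j => rsum (fun i => f i j)).
Proof.
move=> s; rewrite -(rsum_pair s).
have b : bijective (fun p : T2 * T1 => (p.2, p.1)) by exists (fun p => (p.2, p.1)); case.
rewrite (rsum_reindex _ b) rsum_pair//=.
by apply/(summ_reindex (fun p : T1 * T2 => f p.1 p.2) b).
Qed.

Lemma summ_bound (T : choiceType) (f : T -> R) (M : R) :
  (forall s : seq T, uniq s -> \sum_(i <- s) `|f i| <= M) ->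
  summ f /\ rsum (fun i => `|f i|) <= M.
Proof.
move=> H; have h : (\esum_(i in [set: T]) (`|f i|)%:E <= M%:E)%E.
  apply: ge_ereal_sup => _ [X [finX _]] <-.
  by rewrite fsbig_finite//= sumEFin lee_fin H// fset_uniq.
have s : summ f by apply: le_lt_trans h _; rewrite ltry.
by split=> //; rewrite -lee_fin -rsum_ge0E//; exact: summ_abs.
Qed.

Lemma esum_finite_seq (T : choiceType) (s : seq T) (f : T -> R) : uniq s ->
  (forall i, 0 <= f i) -> (forall i, i \notin s -> f i = 0) ->
  (\esum_(i in [set: T]) (f i)%:E = (\sum_(i <- s) f i)%:E)%E.
Proof.
move=> us f0 fs; have fin : finite_set [set` s] by exact: finite_seq.
have -> : (\esum_(i in [set: T]) (f i)%:E = \esum_(i in [set` s]) (f i)%:E)%E.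
  rewrite [RHS]esum_mkcond; apply: eq_esum => i _.
  by case: ifPn => //; rewrite notin_setE /= => /negP /fs ->.
rewrite esum_fset => [||i _]//; last by rewrite lee_fin.
by rewrite -fsbig_seq// sumEFin.
Qed.

Lemma rsum_finite (T : choiceType) (s : seq T) (f : T -> R) : uniq s ->
  (forall i, i \notin s -> f i = 0) -> summ f /\ rsum f = \sum_(i <- s) f i.
Proof.
move=> us fs; split.
  rewrite /summ (esum_finite_seq us) ?ltry// => i /fs ->; exact: normr0.
rewrite /rsum !(esum_finite_seq us) /=.
- rewrite -sumrB; apply: eq_bigr => i _.
  by case: (leP (f i) 0); case: (leP (- f i) 0); lra.
- by move=> i; rewrite le_max lexx orbT.
- by move=> i /fs ->; rewrite oppr0 maxxx.
- by move=> i; rewrite le_max lexx orbT.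
- by move=> i /fs ->; rewrite maxxx.
Qed.

Lemma summ_mask (T : choiceType) (f : T -> R) (P : pred T) : summ f ->
  summ (fun i => if P i then f i else 0).
Proof.
by move=> /summ_abs; apply: summ_le => i; case: ifP => // _; rewrite normr0.
Qed.

Lemma rsum_split (T : choiceType) (f : T -> R) (P : pred T) : summ f ->
  rsum f = rsum (fun i => if P i then f i else 0) + rsum (fun i => if P i then 0 else f i).
Proof.
move=> sf; rewrite -rsumD; [|exact: summ_mask|].
  by apply: eq_rsum => i; case: ifP; rewrite ?addr0 ?add0r.
by apply: eq_summ (summ_mask (predC P) sf) => i /=; case: (P i).
Qed.

Lemma ler_sum_rsum (T : choiceType) (f : T -> R) (s : seq T) : uniq s -> summ f ->
  (forall i, 0 <= f i) -> \sum_(i <- s) f i <= rsum f.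
Proof.
move=> us sf f0; rewrite (rsum_split (mem s) sf) -[leLHS]addr0 lerD//; last first.
  by apply: rsum_ge0 => i; case: ifP.
have [_ ->] := @rsum_finite _ s (fun i => if mem s i then f i else 0) us
  (fun i h => ifN _ _ h).
by rewrite [leRHS]big_seq [leLHS]big_seq; apply: ler_sum => i /= ->.
Qed.

Lemma rsum_tail (T : choiceType) (f : T -> R) (e : R) : (forall i, 0 <= f i) -> summ f ->
  0 < e -> exists2 s : seq T, uniq s & rsum (fun i => if i \in s then 0 else f i) < e.
Proof.
move=> f0 sf e0.
have : ((rsum f - e)%:E < \esum_(i in [set: T]) (f i)%:E)%E.
  by rewrite rsum_ge0E// lte_fin ltrBlDr ltrDl.
move=> /ereal_sup_gt[_ [X [finX _]] <-]; rewrite fsbig_finite//= sumEFin lte_fin => h.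
exists (fset_set X); first exact: fset_uniq.
move: h; rewrite (rsum_split (mem (fset_set X)) sf).
have [_ ->] := @rsum_finite _ (fset_set X) (fun i => if mem (fset_set X) i then f i else 0)
  (fset_uniq _) (fun i h => ifN _ _ h).
have -> : \sum_(i <- fset_set X) (if mem (fset_set X) i then f i else 0) = \sum_(i <- fset_set X) f i.
  by rewrite big_seq [RHS]big_seq; apply: eq_bigr => i /= ->.
rewrite /=; lra.
Qed.

(** Dominated convergence for sums. All but finitely many indices carry less than [e / 4] of [g], so
    they contribute at most [e / 2] to the difference; the finitely many others converge
    termwise. *)
Lemma rsum_dominated (T : choiceType) (F : nat -> T -> R) (f g : T -> R) :
  summ g -> (forall n i, `|F n i| <= g i) ->
  (forall i, F n i @[n --> \oo] --> f i) ->
  summ f /\ rsum (F n) @[n --> \oo] --> rsum f.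
Proof.
move=> sg Fg Ff.
have g0 i : 0 <= g i by exact: le_trans (Fg 0 i).
have fg i : `|f i| <= g i.
  have cn : `|F n i| @[n --> \oo] --> `|f i| by apply: cvg_norm; exact: Ff.
  rewrite -(cvg_lim _ cn)//; apply: limr_le; first by apply/cvg_ex; exists `|f i|.
  by apply: nearW => n; exact: Fg.
have sf : summ f by exact: summ_le sg.
have sF n : summ (F n) by exact: summ_le sg.
split=> //; apply/cvgrPdist_lt => e e0.
have e4 : 0 < e / 4 by rewrite divr_gt0.
have [s us hs] := rsum_tail g0 sg e4.
have h : \forall n \near \oo, \sum_(i <- s) `|f i - F n i| < e / 4.
  have : \sum_(i <- s) `|f i - F n i| @[n --> \oo] --> \sum_(i <- s) (0:R).
    elim: (s) => [|i s' IH].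
      by under eq_fun do rewrite big_nil; rewrite big_nil; exact: cvg_cst.
    under eq_fun do rewrite big_cons; rewrite big_cons; apply: cvgD => //.
    rewrite -[X in _ --> X](normr0 R).
    apply: cvg_norm; rewrite -[X in _ --> X](subrr (f i)).
    by apply: cvgB; [exact: cvg_cst|exact: Ff].
  rewrite [X in _ --> X]big1// => /cvgrPdist_lt /(_ _ e4).
  apply: filterS => n; rewrite sub0r normrN ger0_norm// sumr_ge0//.
near=> n.
have hn : \sum_(i <- s) `|f i - F n i| < e / 4 by near: n.
have sd : summ (fun i => f i - F n i) by apply: summD => //; exact: summN.
rewrite -rsumB//; apply: le_lt_trans (ler_norm_rsum sd) _.
rewrite (rsum_split (mem s) (summ_abs sd)).
have [_ ->] := @rsum_finite _ s (fun i => if mem s i then `|f i - F n i| else 0)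
  us (fun i h => ifN _ _ h).
have -> : \sum_(i <- s) (if mem s i then `|f i - F n i| else 0) = \sum_(i <- s) `|f i - F n i|.
  by rewrite big_seq [RHS]big_seq; apply: eq_bigr => i /= ->.
have tl : rsum (fun i => if mem s i then 0 else `|f i - F n i|) <=
    2 * rsum (fun i => if i \in s then 0 else g i).
  have sg' : summ (fun i => if i \in s then 0 else g i).
    by apply: eq_summ (summ_mask (predC (mem s)) sg) => i /=; case: (i \in s).
  rewrite -rsumZ//; apply: ler_rsum; last 2 first.
  - exact: summZ.
  - move=> i /=; case: ifP; rewrite ?mulr0// => _.
    rewrite (le_trans (ler_normB _ _))//; have := fg i; have := Fg n i; lra.
  apply: eq_summ (summ_mask (predC (mem s)) (summ_abs sd)) => i /=.
  by case: (i \in s).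
lra.
Unshelve. all: by end_near.
Qed.
End Rsum.


(** * Sums over the integers, and counting of differences *)

Section IntSums.
Context {R : realType}.

(** The bound is the exact value of the two-sided geometric series. Its size matters in the
    numerical estimate [tail_sum]. *)
Lemma summ_geom (r : R) : 0 <= r < 1 ->
  summ (fun k : int => r ^+ `|k|%N) /\
  rsum (fun k : int => r ^+ `|k|%N) <= (1 + r) / (1 - r).
Proof.
move=> /andP[r0 r1].
have H (s : seq int) : uniq s -> \sum_(i <- s) `|r ^+ `|i|%N| <= (1 + r) / (1 - r).
  move=> us; pose N := (\max_(i <- s) `|i|%N).+1.
  pose t := [seq Posz i | i <- iota 0 N] ++ [seq Negz i | i <- iota 0 N].
  have st : {subset s <= t}.
    move=> i si; have iN : (`|i| < N)%N by rewrite ltnS; exact: leq_bigmax_seq.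
    rewrite mem_cat; case: i si iN => i si iN; apply/orP; [left|right].
      by apply: map_f; rewrite mem_iota.
    by apply: map_f; rewrite mem_iota /=; move: iN; rewrite NegzE abszN absz_nat => /ltnW.
  have ut : uniq t.
    rewrite cat_uniq !map_inj_uniq ?iota_uniq ?andbT; last 2 first.
    - by move=> a b [].
    - by move=> a b [].
    by apply/hasPn => x /mapP[a _ ->]; apply/mapP => -[b _].
  have geom : \sum_(i <- iota 0 N) r ^+ i <= (1 - r)^-1.
    have := subrX1 r N; rewrite -[iota 0 N]/(index_iota 0 N) big_mkord => e.
    rewrite -[leRHS]mul1r ler_pdivlMr ?subr_gt0// mulrC.
    have -> : (1 - r) * \sum_(i < N) r ^+ i = 1 - r ^+ N by move: e; lra.
    by rewrite gerBl exprn_ge0.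
  apply: (@le_trans _ _ (\sum_(i <- t) `|r ^+ `|i|%N|)).
    have -> : \sum_(i <- t) `|r ^+ `|i|%N| = rsum (fun i => if i \in t then `|r ^+ `|i|%N| else 0).
      have [_ ->] := @rsum_finite R _ t (fun i => if i \in t then `|r ^+ `|i|%N| else 0) ut (fun i h => ifN _ _ h).
      by rewrite big_seq [RHS]big_seq; apply: eq_bigr => i ->.
    have [sm _] := @rsum_finite R _ t (fun i => if i \in t then `|r ^+ `|i|%N| else 0) ut (fun i h => ifN _ _ h).
    apply: le_trans (ler_sum_rsum us sm _); last by move=> i; case: ifP.
    by rewrite big_seq [leRHS]big_seq; apply: ler_sum => i /st ->.
  rewrite big_cat !big_map /=.
  under eq_bigr do rewrite ger0_norm ?exprn_ge0//.
  under [X in _ + X]eq_bigr do rewrite ger0_norm ?exprn_ge0// exprS.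
  by rewrite -mulr_sumr -[X in X + _]mul1r -mulrDl ler_wpM2l// addr_ge0.
have [s1 s2] := summ_bound H; split=> //.
by apply: le_trans s2; apply: ler_rsum => //; [exact: summ_abs|move=> i; exact: ler_norm].
Qed.

Lemma expRN_pow (c : R) (k : int) : expR (- (c * `|k|%:~R)) = expR (- c) ^+ `|k|%N.
Proof.
by rewrite -expRM_natl; congr expR; rewrite natr_absz mulrN mulrC.
Qed.

(** The additive constant [C] absorbs the lower order terms of a quadratic exponent, so that every
    Gaussian is compared with a geometric series. *)
Lemma summ_expR (c C : R) (X : int -> R) : 0 < c ->
  (forall k, c * `|k|%:~R <= X k + C) -> summ (fun k => expR (- X k)).
Proof.
move=> c0 H; have r1 : expR (- c) < 1 by rewrite -[X in _ < X]expR0 ltr_expR oppr_lt0.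
have [s _] := @summ_geom (expR (- c)) (introT andP (conj (expR_ge0 _) r1)).
apply: summ_le (summZ (expR C) s) => k.
by rewrite ger0_norm ?expR_ge0// -expRN_pow -expRD ler_expR; have := H k; lra.
Qed.

Lemma summ_expR2 (c C : R) (X : int * int -> R) : 0 < c ->
  (forall k, c * (`|k.1|%:~R + `|k.2|%:~R) <= X k + C) -> summ (fun k => expR (- X k)).
Proof.
move=> c0 H; have r1 : expR (- c) < 1 by rewrite -[X in _ < X]expR0 ltr_expR oppr_lt0.
have [s _] := @summ_geom (expR (- c)) (introT andP (conj (expR_ge0 _) r1)).
apply: summ_le (summZ (expR C) (summM s s)) => k.
by rewrite ger0_norm ?expR_ge0// -!expRN_pow -!expRD ler_expR; have := H k; lra.
Qed.

Lemma norm_le_sqr (k : int) : (`|k|%:~R : R) <= k%:~R ^+ 2.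
Proof. by rewrite -rmorphXn /= ler_int; nia. Qed.

(** The number of pairs in [[0, N)] with difference [d], that is [max (N - |d|) 0]. Divided by [N]
    these are the Fejer weights; they occur both in Poisson summation and in the averages over boxes
    of shifts. *)
Definition cnt (N : nat) (d : int) : R :=
  \sum_(i < N) \sum_(j < N) ((Posz i - Posz j == d)%:R).

Lemma cnt_le N d : 0 <= cnt N d <= N%:R.
Proof.
apply/andP; split; first by apply: sumr_ge0 => i _; apply: sumr_ge0.
rewrite -[N in N%:R]card_ord -sumr_const; apply: ler_sum => i _.
have [/existsP[j /eqP ij]|/existsPn h] := boolP [exists j : 'I_N, Posz i - Posz j == d].
  rewrite (bigD1 j)//= ij eqxx big1 ?addr0// => k kj.
  case: eqP => // ik; move: kj; rewrite -val_eqE /=; move: ij ik; lia.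
by rewrite big1// => j _; rewrite (negbTE (h j)).
Qed.

Lemma cnt_ge N d : N%:R - (`|d|%N)%:R <= cnt N d.
Proof.
have [dN|Nd] := leqP `|d|%N N; last first.
  apply: le_trans (_ : 0 <= _); last by case/andP: (cnt_le N d).
  by rewrite subr_le0 ler_nat ltnW.
rewrite -natrB//.
pose a := if 0 <= d then `|d|%N else 0%N; pose b := if 0 <= d then 0%N else `|d|%N.
have abN : (a + b = `|d|)%N by rewrite /a /b; case: ifP; rewrite ?addn0.
have H (i : 'I_(N - `|d|)) : (i + a < N)%N /\ (i + b < N)%N by have := ltn_ord i; lia.
pose e (i : 'I_(N - `|d|)) : 'I_N := Ordinal (H i).1.
have einj : injective e by move=> x y [] /addIn /val_inj.
rewrite -[leLHS]/((N - `|d|)%N%:R) -[X in X%:R]card_ord -sumr_const.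
apply: le_trans (_ : \sum_(i in [set e i | i in 'I_(N - `|d|)]%SET)
   \sum_(j < N) ((Posz i - Posz j == d)%:R) <= _); last first.
  rewrite [leRHS](bigID (mem [set e i | i in 'I_(N - `|d|)]%SET))/= lerDl.
  by apply: sumr_ge0 => i _; apply: sumr_ge0.
rewrite big_imset/=; last by move=> x y _ _ /einj.
apply: ler_sum => i _; rewrite (bigD1 (Ordinal (H i).2))//= -[leLHS]addr0 lerD//.
  suff -> : Posz (i + a) - Posz (i + b) == d by [].
  by rewrite /a /b; case: ifP; lia.
by apply: sumr_ge0.
Qed.

Lemma cnt_cvg d : cnt N d / N%:R @[N --> \oo] --> (1 : R).
Proof.
apply: (@squeeze_cvgr _ _ _ _ (fun N => 1 - (`|d|%N)%:R / N%:R) (fun _ => 1)).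
- near=> N; have N0 : (0 : R) < N%:R by rewrite ltr0n; near: N; exact: nbhs_infty_gt.
  have /andP[_ h2] := cnt_le N d; have h1 := cnt_ge N d.
  by rewrite ler_pdivrMr// mul1r h2 ler_pdivlMr// mulrBl mul1r divfK ?gt_eqF// h1.
- rewrite -[X in _ --> X]subr0; apply: cvgB; first exact: cvg_cst.
  rewrite -[X in _ --> X](mulr0 (`|d|%N)%:R); apply: cvgM; first exact: cvg_cst.
  apply/gtr0_cvgV0; last exact: cvgr_idn.
  by near=> N; rewrite ltr0n; near: N; exact: nbhs_infty_gt.
- exact: cvg_cst.
Unshelve. all: by end_near.
Qed.

Lemma sum_cnt (h : int -> R) N : summ h ->
  \sum_(i < N) \sum_(j < N) h (Posz i - Posz j) = rsum (fun d => h d * cnt N d).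
Proof.
move=> sh.
have e (d : int) : summ (fun x : int => h x * (d == x)%:R) /\ rsum (fun x : int => h x * (d == x)%:R) = h d.
  have z x : x \notin [:: d] -> h x * (d == x)%:R = 0.
    by rewrite inE eq_sym => /negbTE ->; rewrite mulr0.
  have [s ->] := @rsum_finite R _ [:: d] _ erefl z.
  by rewrite big_seq1 eqxx mulr1.
rewrite (eq_bigr (fun i : 'I_N => \sum_(j < N) rsum (fun x : int => h x * ((Posz i - Posz j) == x)%:R))); last first.
  by move=> i _; apply: eq_bigr => j _; rewrite (e _).2.
rewrite /cnt; under [RHS]eq_rsum do rewrite mulr_sumr.
rewrite rsum_sum => [|i]; last first.
  apply: (eq_summ (f := fun x => \sum_(j < N) (h x * ((Posz i - Posz j) == x)%:R))).
    by move=> x; rewrite mulr_sumr.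
  by apply: summ_sum => j; exact: (e _).1.
apply: eq_bigr => i _; under [RHS]eq_rsum do rewrite mulr_sumr.
by rewrite rsum_sum// => j; exact: (e _).1.
Qed.

End IntSums.

(** * Gaussian integrals *)

Section GaussInt.
Context {R : realType}.
Local Notation mu := (@lebesgue_measure R).

(** With the scale inside the square, the values at integers sample the standard Gaussian along
    [s Z - y]; as a function of [t] the centre is [y / s]. *)
Definition gau (s y t : R) : R := expR (- (pi * (s * t - y) ^+ 2)).

Lemma gau_ge0 s y t : 0 <= gau s y t. Proof. exact: expR_ge0. Qed.

Lemma integD (f g : R -> R) : mu.-integrable [set: R] (EFin \o f) ->
  mu.-integrable [set: R] (EFin \o g) -> mu.-integrable [set: R] (EFin \o (fun t => f t + g t)).
Proof. by move=> i1 i2; exact: (@integrableD _ _ _ mu _ measurableT _ _ i1 i2). Qed.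

Lemma integB (f g : R -> R) : mu.-integrable [set: R] (EFin \o f) ->
  mu.-integrable [set: R] (EFin \o g) -> mu.-integrable [set: R] (EFin \o (fun t => f t - g t)).
Proof. by move=> i1 i2; exact: (@integrableB _ _ _ mu _ measurableT _ _ i1 i2). Qed.

Lemma integZ (c : R) (f : R -> R) : mu.-integrable [set: R] (EFin \o f) ->
  mu.-integrable [set: R] (EFin \o (fun t => c * f t)).
Proof. by move=> i1; exact: (@integrableZl _ _ _ mu _ measurableT c _ i1). Qed.

Lemma is_derive_gau (s y t : R) :
  is_derive t 1 (gau s y) (- (2 * pi * s * (s * t - y)) * gau s y t).
Proof. by rewrite /gau; apply: is_derive_eq; rewrite /GRing.scale /=; ring. Qed.

Lemma continuous_EFin_meas (f : R -> R) : continuous f ->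
  measurable_fun [set: R] (fun x : R => (f x)%:E).
Proof. by move=> cf; apply/measurable_EFinP; exact: continuous_measurable_fun. Qed.

Lemma is_derive_cont (F f : R -> R) : (forall x : R, is_derive x 1 F (f x)) -> continuous F.
Proof. by move=> dF x; apply/differentiable_continuous/derivable1_diffP; case: (dF x). Qed.

Lemma ftc_cont (F f : R -> R) (a b : R) : a < b ->
  (forall x : R, is_derive x 1 F (f x)) -> continuous f ->
  (\int[mu]_(x in `[a, b]) (f x)%:E = (F b - F a)%:E)%E.
Proof.
move=> ab dF cf; rewrite (@continuous_FTC2 _ f F)//.
- by apply: continuous_subspaceT.
- have cF := is_derive_cont dF.
  split; first by move=> x _; case: (dF x).
  + by apply: cvg_at_right_filter; exact: cF.
  + by apply: cvg_at_left_filter; exact: cF.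
- by move=> x _; rewrite derive1E; case: (dF x).
Qed.

(** The fundamental theorem on [[-n, n]] combined with dominated convergence; this is the form of
    integration by parts used for the Fourier transform of the Gaussian. *)
Lemma int_deriv0 (F f : R -> R) :
  (forall x : R, is_derive x 1 F (f x)) -> continuous f ->
  mu.-integrable [set: R] (EFin \o f) ->
  F n%:R @[n --> \oo] --> 0 -> F (- n%:R) @[n --> \oo] --> 0 ->
  \int[mu]_(x in [set: R]) f x = 0.
Proof.
move=> dF cf intf F1 F2.
pose fn (n : nat) := (EFin \o f) \_ `[- n%:R, n%:R].
have mfn n : measurable_fun [set: R] (fn n).
  apply/(measurable_restrictT _ _).1 => //.
  by apply: measurable_funTS; exact: continuous_EFin_meas.
have [_ _ h] : [/\ mu.-integrable [set: R] (EFin \o f),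
  [sequence \int[mu]_(x in [set: R]) `|fn n x - (EFin \o f) x|]_n%E @ \oo --> 0%E &
  [sequence \int[mu]_(x in [set: R]) (fn n x)]_n%E @ \oo --> (\int[mu]_(x in [set: R]) ((EFin \o f) x))%E].
  apply: (@dominated_convergence _ _ _ mu setT measurableT fn (EFin \o f) (fun x => `|(f x)%:E|%E)).
  - exact: mfn.
  - exact: continuous_EFin_meas.
  - apply: aeW => x _; apply: cvg_near_cst; near=> n.
    rewrite /fn patchT// inE /= in_itv /= -ler_norml.
    by near: n; exact: nbhs_infty_ger.
  - exact: integrable_abse.
  - apply: aeW => x n _; rewrite /fn patchE; case: ifP => // _.
    by rewrite abse0.
have e : \forall n \near \oo, ((\int[mu]_(x in [set: R]) (fn n x)) = (F n%:R - F (- n%:R))%:E)%E.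
  near=> n; rewrite /fn -(ftc_cont (f := f))//.
    by rewrite [RHS]integral_mkcond.
  have : (0 < n)%N by near: n; exact: nbhs_infty_gt.
  by rewrite -(ltr0n R) => n0; lra.
have h2 : [sequence \int[mu]_(x in [set: R]) (fn n x)]_n%E @ \oo --> (0%:E : \bar R).
  apply: cvg_trans (_ : (F n%:R - F (- n%:R))%:E @[n --> \oo] --> 0%:E).
    by apply: near_eq_cvg; apply: filterS e => n /= ->.
  apply: cvg_EFin; first exact: nearW.
  by rewrite -[X in _ --> X](subrr 0); exact: cvgB.
have h3 := cvg_unique _ h h2; rewrite /Rintegral [X in fine X]h3.
by [].
Unshelve. all: by end_near.
Qed.

Lemma continuous_gau (s y : R) : continuous (gau s y).
Proof. exact: is_derive_cont (fun t => is_derive_gau s y t). Qed.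

(** A rescaled normal density, whose standard deviation [sg] satisfies [2 pi sg^2 = s^-2]. *)
Lemma gau_int (s y : R) : 0 < s ->
  mu.-integrable [set: R] (EFin \o gau s y) /\ \int[mu]_(x in [set: R]) gau s y x = s^-1.
Proof.
move=> s0.
have sp : 0 < Num.sqrt (2 * pi) :> R by rewrite sqrtr_gt0 mulr_gt0// pi_gt0.
have p0 : (0 : R) < pi by exact: pi_gt0.
pose sg := (s * Num.sqrt (2 * pi))^-1.
have sg0 : sg != 0 by rewrite invr_neq0// mulf_neq0// gt_eqF.
have sg2 : sg ^+ 2 * pi *+ 2 = s^-1 ^+ 2.
  rewrite /sg exprVn exprMn sqr_sqrtr; last by rewrite mulr_ge0// ltW.
  have h : 2 * pi != 0 :> R by rewrite mulf_neq0// lt0r_neq0.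
  by rewrite -mulrnAr -[pi *+ 2]mulr_natl invfM divfK// exprVn.
have pk : normal_peak sg = s.
  by rewrite /normal_peak sg2 sqrtr_sqr ger0_norm ?invr_ge0 ?ltW// invrK.
have e t : gau s y t = s^-1 * normal_pdf (y / s) sg t.
  rewrite normal_pdfE// pk mulrA mulVf ?gt_eqF// mul1r; congr expR.
  have -> : sg ^+ 2 *+ 2 = s^-1 ^+ 2 / pi by rewrite -sg2 mulrnAl mulfK// lt0r_neq0.
  have sn : s != 0 by rewrite lt0r_neq0.
  have pn : (pi : R) != 0 by rewrite lt0r_neq0.
  clear sg2 sg0 pk.
  by move: (pi) pn => P pn; field; rewrite pn sn.
have -> : gau s y = fun t => s^-1 * normal_pdf (y / s) sg t by apply/funext.
have ip := @integrable_normal_pdf R (y / s) sg.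
split.
  rewrite (_ : EFin \o _ = fun t => ((s^-1)%:E * (normal_pdf (y / s) sg t)%:E)%E)//.
  exact: integrableZl.
by rewrite RintegralZl// /Rintegral integral_normal_pdf /= mulr1.
Qed.

Lemma le_gau_int (c s y : R) (f : R -> R) : 0 < s -> continuous f ->
  (forall t, `|f t| <= c * gau s y t) -> mu.-integrable [set: R] (EFin \o f).
Proof.
move=> s0 cf H.
apply: (@le_integrable _ _ _ mu _ measurableT _ (fun t => (c%:E * (gau s y t)%:E)%E)).
- exact: continuous_EFin_meas.
- move=> t _; rewrite -EFinM !abse_EFin lee_fin (le_trans (H t))//; exact: ler_norm.
- by apply: integrableZl => //; exact: (gau_int y s0).1.
Qed.

Lemma gau_sqrt2 (s y t : R) : gau s y t =
  gau (s / Num.sqrt 2) (y / Num.sqrt 2) t ^+ 2.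
Proof.
rewrite /gau -expRM_natl; congr expR.
have s2 : Num.sqrt 2 ^+ 2 = 2 :> R by rewrite sqr_sqrtr.
rewrite (_ : s / Num.sqrt 2 * t - y / Num.sqrt 2 = (s * t - y) / Num.sqrt 2); last by field.
by rewrite exprMn exprVn s2; field.
Qed.

(** A linear factor costs half of the exponent: with [u = |s t - y|], the other half beats [u]
    because [u <= 1 + pi u^2 / 2 <= exp (pi u^2 / 2)]. The wider Gaussian on the right serves as the
    majorant when differentiating in the frequency. *)
Lemma gau_decay (s y t : R) : `|s * t - y| * gau s y t <= gau (s / Num.sqrt 2) (y / Num.sqrt 2) t.
Proof.
set g := gau (s / _) _ _.
have g0 : 0 < g by exact: expR_gt0.
have p1 : (1 : R) <= pi by have := pi_ge2 R; lra.
have h : `|s * t - y| * g <= 1.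
  rewrite /g /gau expRN ler_pdivrMr ?expR_gt0// mul1r.
  apply: le_trans (expR_ge1Dx _).
  rewrite (_ : s / Num.sqrt 2 * t - y / Num.sqrt 2 = (s * t - y) / Num.sqrt 2); last by field.
  rewrite exprMn exprVn sqr_sqrtr// -[(s * t - y) ^+ 2]real_normK ?num_real//.
  set u := `|_|; have : 0 <= u by exact: normr_ge0.
  have : 0 <= (u - 1) ^+ 2 by exact: sqr_ge0.
  by rewrite expr2; nra.
rewrite gau_sqrt2 -/g expr2 mulrA -[leRHS]mul1r ler_wpM2r// ltW//.
Qed.

Lemma gau_cvg (s y : R) : 0 < s ->
  gau s y n%:R @[n --> \oo] --> 0 /\ gau s y (- n%:R) @[n --> \oo] --> 0.
Proof.
move=> s0.
have p1 : (1 : R) <= pi by have := pi_ge2 R; lra.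
have H (u : nat -> R) : (forall n, n%:R <= `|u n|) -> gau s y (u n) @[n --> \oo] --> 0.
  move=> hu; apply: (@squeeze_cvgr _ _ _ _ (fun=> 0) (fun n => (1 + `|y|) / (s * n%:R))).
  - near=> n; have n0 : (0 : R) < n%:R by rewrite ltr0n; near: n; exact: nbhs_infty_gt.
    rewrite gau_ge0 /= ler_pdivlMr ?mulr_gt0//.
    have g1 : gau s y (u n) <= 1 by rewrite -expR0 ler_expR oppr_le0 mulr_ge0// ?sqr_ge0; lra.
    have : `|s * u n - y| * gau s y (u n) <= 1.
      apply: le_trans (gau_decay _ _ _) _.
      rewrite -expR0 ler_expR oppr_le0 mulr_ge0// ?sqr_ge0; lra.
    have := gau_ge0 s y (u n); set g := gau _ _ _ => g0 h.
    have : s * n%:R <= `|s * u n - y| + `|y|.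
      apply: le_trans (_ : `|s * u n| <= _).
        by rewrite normrM (gtr0_norm s0) ler_pM2l.
      by rewrite -{1}[s * u n](subrK y) ler_normD.
    have := normr_ge0 y; have := normr_ge0 (s * u n - y).
    rewrite -/g in g1; nra.
  - exact: cvg_cst.
  - have -> : (fun n : nat => (1 + `|y|) / (s * n%:R)) = fun n => (1 + `|y|) / s * n%:R^-1.
      by apply/funext => n; rewrite invfM; ring.
    rewrite -[X in _ --> X](mulr0 ((1 + `|y|) / s)); apply: cvgM; first exact: cvg_cst.
    apply/gtr0_cvgV0; last exact: cvgr_idn.
    by near=> n; rewrite ltr0n; near: n; exact: nbhs_infty_gt.
by split; apply: H => n; rewrite ?normrN ger0_norm.
Unshelve. all: by end_near.
Qed.

(** The phase is measured from the centre [y / s]. Differentiating in [xi] then produces the factor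
    [t - y / s], proportional to the one that comes out of the Gaussian, so that integration by
    parts closes up into a differential equation. *)
Definition osc (s y p xi t : R) : R := gau s y t * cos (p + 2 * pi * xi * (t - y / s)).

Lemma is_derive_gausin (s y p xi t : R) : 0 < s ->
  is_derive t 1 (fun t => gau s y t * sin (p + 2 * pi * xi * (t - y / s)))
   (2 * pi * xi * osc s y p xi t
    - (2 * pi * s) * (gau s y t * (s * t - y) * sin (p + 2 * pi * xi * (t - y / s)))).
Proof.
move=> s0; have dg := is_derive_gau s y t.
rewrite /osc; apply: is_derive_eq; rewrite /GRing.scale /=; ring.
Qed.

Lemma osc_deriv (s y p xi t : R) :
  is_derive xi 1 (fun xi => osc s y p xi t)
   (- (2 * pi * (t - y / s)) * (gau s y t * sin (p + 2 * pi * xi * (t - y / s)))).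
Proof. by rewrite /osc; apply: is_derive_eq; rewrite /GRing.scale /=; ring. Qed.

Lemma derivable_cont (f : R -> R) : (forall x : R, derivable f x 1) -> continuous f.
Proof. by move=> df x; apply/differentiable_continuous/derivable1_diffP. Qed.

Lemma continuous_osc (s y p xi : R) : continuous (osc s y p xi).
Proof.
apply: derivable_cont => t; rewrite /osc; have dg := is_derive_gau s y t.
exact: ex_derive.
Qed.

Lemma continuous_gausin (s y p xi : R) :
  continuous (fun t => gau s y t * (s * t - y) * sin (p + 2 * pi * xi * (t - y / s))).
Proof.
apply: derivable_cont => t; have dg := is_derive_gau s y t.
exact: ex_derive.
Qed.

Lemma osc_integrable (s y p xi : R) : 0 < s -> mu.-integrable [set: R] (EFin \o osc s y p xi).
Proof.
move=> s0; apply: (@le_gau_int 1 s y) => //; first exact: continuous_osc.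
by move=> t; rewrite /osc normrM mulrC (ger0_norm (gau_ge0 _ _ _)) ?gau_ge0// ler_wpM2r ?gau_ge0// cos_max.
Qed.

Lemma gausin_integrable (s y p xi : R) : 0 < s ->
  mu.-integrable [set: R] (EFin \o (fun t => gau s y t * (s * t - y) * sin (p + 2 * pi * xi * (t - y / s)))).
Proof.
move=> s0; have s2 : 0 < s / Num.sqrt 2 by rewrite divr_gt0// sqrtr_gt0.
apply: (@le_gau_int 1 _ (y / Num.sqrt 2) _ s2).
  exact: continuous_gausin.
move=> t; rewrite mul1r !normrM ger0_norm ?gau_ge0// mulrC.
apply: le_trans (gau_decay _ _ _).
rewrite mulrA -[leRHS]mul1r -mulrA mulrC [leLHS]mulrC.
rewrite [X in _ * X]mulrC ler_wpM2r ?sin_max ?mulr_ge0 ?gau_ge0//.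
Qed.

Lemma osc_parts (s y p xi : R) : 0 < s ->
  \int[mu]_(t in [set: R]) (gau s y t * (s * t - y) * sin (p + 2 * pi * xi * (t - y / s)))
  = xi / s * \int[mu]_(t in [set: R]) osc s y p xi t.
Proof.
move=> s0; have p0 : (0 : R) < pi by exact: pi_gt0.
have i1 := osc_integrable y p xi s0; have i2 := gausin_integrable y p xi s0.
have := @int_deriv0 (fun t => gau s y t * sin (p + 2 * pi * xi * (t - y / s))) _
  (fun t => is_derive_gausin y p xi t s0).
have i1' : mu.-integrable [set: R] (EFin \o (fun t => 2 * pi * xi * osc s y p xi t)).
  by rewrite (_ : EFin \o _ = fun t => ((2 * pi * xi)%:E * (osc s y p xi t)%:E)%E)//; exact: integrableZl.
have i2' : mu.-integrable [set: R] (EFin \o (fun t => (2 * pi * s) * (gau s y t * (s * t - y) * sin (p + 2 * pi * xi * (t - y / s))))).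
  by rewrite (_ : EFin \o _ = fun t => ((2 * pi * s)%:E * (gau s y t * (s * t - y) * sin (p + 2 * pi * xi * (t - y / s)))%:E)%E)//; exact: integrableZl.
rewrite RintegralB// !RintegralZl// => h.
have [g1 g2] := gau_cvg y s0.
have sq (u : nat -> R) : gau s y (u n) @[n --> \oo] --> 0 ->
   gau s y (u n) * sin (p + 2 * pi * xi * (u n - y / s)) @[n --> \oo] --> 0.
  move=> gu; apply/norm_cvg0P.
  apply: (@squeeze_cvgr _ _ _ _ (fun=> 0) (fun n => gau s y (u n))) => //; last exact: cvg_cst.
  apply: nearW => n; rewrite normr_ge0 normrM ger0_norm ?gau_ge0//=.
  by rewrite ler_piMr ?gau_ge0// sin_max.
have cf : continuous (fun t => 2 * pi * xi * osc s y p xi t - 2 * pi * s * (gau s y t * (s * t - y) * sin (p + 2 * pi * xi * (t - y / s)))).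
  move=> t; apply: cvgB.
    by apply: cvgM; [exact: cvg_cst|exact: continuous_osc].
  by apply: cvgM; [exact: cvg_cst|exact: continuous_gausin].
have i3 : mu.-integrable [set: R] (EFin \o (fun t => 2 * pi * xi * osc s y p xi t - 2 * pi * s * (gau s y t * (s * t - y) * sin (p + 2 * pi * xi * (t - y / s))))).
  exact: (integB i1' i2').
have := h cf i3 (sq _ g1) (sq _ g2).
set A := \int[mu]_(x in _) osc _ _ _ _ _; set B := \int[mu]_(x in _) _.
move=> e; have {}e : 2 * pi * (xi * A - s * B) = 0 by rewrite -e; ring.
have : xi * A = s * B.
  apply/eqP; rewrite -subr_eq0; move/eqP: e; rewrite mulf_eq0 => /orP[|//].
  by rewrite gt_eqF// mulr_gt0.
by move=> e2; rewrite -mulrA [X in _ * X]mulrC mulrA e2; field; rewrite gt_eqF.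
Qed.

(** As a function of the frequency the integral solves [X' = - (2 pi / s^2) xi X], so its product
    [Y] with the inverse Gaussian factor is constant; the value at frequency 0 is [gau_int]. *)
Lemma osc_integral0 (s y p xi : R) : 0 < s ->
  \int[mu]_(t in [set: R]) osc s y p xi t = s^-1 * expR (- (pi * (xi / s) ^+ 2)) * cos p.
Proof.
move=> s0.
pose X xi := \int[mu]_(t in [set: R]) osc s y p xi t.
have dX (x : R) : is_derive x 1 X (- (2 * pi / s ^+ 2 * x) * X x).
  have s2 : 0 < s / Num.sqrt 2 by rewrite divr_gt0// sqrtr_gt0.
  pose G t := 2 * pi / s * gau (s / Num.sqrt 2) (y / Num.sqrt 2) t.
  have p0 : (0 : R) < pi by exact: pi_gt0.
  have G0 t : 0 <= G t by rewrite mulr_ge0 ?gau_ge0// divr_ge0 ?mulr_ge0// ltW.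
  have intG : mu.-integrable [set: R] (EFin \o G).
    rewrite (_ : EFin \o _ = fun t => ((2 * pi / s)%:E * (gau (s / Num.sqrt 2) (y / Num.sqrt 2) t)%:E)%E)//.
    by apply: integrableZl => //; exact: (gau_int _ s2).1.
  have Ix : `](x - 1), (x + 1)[%classic x by rewrite /= in_itv /=; apply/andP; split; lra.
  have d1 u t : partial1of2 (osc s y p) u t = - (2 * pi * (t - y / s)) * (gau s y t * sin (p + 2 * pi * u * (t - y / s))).
    by rewrite partial1of2E; case: (osc_deriv s y p u t).
  have hub (u t : R) : `](x - 1), (x + 1)[%classic u -> [set: R] t -> `|partial1of2 (osc s y p) u t| <= G t.
    move=> _ _; rewrite d1 (_ : _ * _ = - (2 * pi / s * ((gau s y t * (s * t - y)) * sin (p + 2 * pi * u * (t - y / s))))); last by field; rewrite gt_eqF.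
    rewrite normrN normrM ger0_norm ?divr_ge0 ?mulr_ge0 ?(ltW p0) ?(ltW s0)//.
    rewrite ler_wpM2l ?divr_ge0 ?mulr_ge0 ?(ltW p0) ?(ltW s0)//.
    rewrite !normrM ger0_norm ?gau_ge0//; apply: le_trans (gau_decay _ _ _).
    by rewrite [X in X * _]mulrC ler_piMr ?mulr_ge0 ?gau_ge0// sin_max.
  have der (u t : R) : `](x - 1), (x + 1)[%classic u -> [set: R] t -> derivable (fun u => osc s y p u t) u 1.
    by move=> _ _; case: (osc_deriv s y p u t).
  have ii u : `](x - 1), (x + 1)[%classic u -> mu.-integrable [set: R] (EFin \o osc s y p u).
    by move=> _; exact: osc_integrable.
  have h1 := @derivable_under_integral _ _ _ mu _ _ measurableT _ _ _ Ix ii der G G0 intG hub.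
  have h2 := @differentiation_under_integral _ _ _ mu _ _ measurableT _ _ _ Ix ii der G G0 intG hub.
  apply: DeriveDef => //; rewrite -derive1E h2.
  rewrite (_ : (fun t => _) = fun t => - (2 * pi / s) * (gau s y t * (s * t - y) * sin (p + 2 * pi * x * (t - y / s)))).
    rewrite RintegralZl//; last exact: gausin_integrable.
    by rewrite osc_parts// -/(X x); field; rewrite gt_eqF.
  by apply/funext => t; rewrite d1; field; rewrite gt_eqF.
pose Y x := X x * expR (pi * (x / s) ^+ 2).
have dY (x : R) : is_derive x 1 Y 0.
  rewrite /Y; apply: is_derive_eq; rewrite /GRing.scale /=.
  by field; rewrite gt_eqF.
have : Y xi = Y 0 by apply: is_derive_0_is_cst.
rewrite /Y mul0r expr0n /= mulr0 expR0 mulr1 => e.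
have -> : \int[mu]_(t in [set: R]) osc s y p xi t = X xi by [].
have -> : X xi = X 0 * expR (- (pi * (xi / s) ^+ 2)) by rewrite -e expRN mulfK// gt_eqF// expR_gt0.
have -> : X 0 = s^-1 * cos p.
  rewrite /X (_ : osc s y p 0 = fun t => cos p * gau s y t).
    have [i1 i2] := gau_int y s0.
    by rewrite RintegralZl// i2 mulrC.
  by apply/funext => t; rewrite /osc mulr0 mul0r addr0 mulrC.
ring.
Qed.

Lemma osc_integral (s y p xi : R) : 0 < s ->
  mu.-integrable [set: R] (EFin \o (fun t => gau s y t * cos (p + 2 * pi * xi * t))) /\
  \int[mu]_(t in [set: R]) (gau s y t * cos (p + 2 * pi * xi * t))
  = s^-1 * expR (- (pi * (xi / s) ^+ 2)) * cos (p + 2 * pi * xi * (y / s)).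
Proof.
move=> s0; have -> : (fun t => gau s y t * cos (p + 2 * pi * xi * t)) =
    osc s y (p + 2 * pi * xi * (y / s)) xi.
  by apply/funext => t; rewrite /osc; congr (_ * cos _); ring.
by split; [exact: osc_integrable|exact: osc_integral0].
Qed.

End GaussInt.

(** * Poisson summation *)

Section Poisson1.
Context {R : realType}.
Local Notation mu := (@lebesgue_measure R).

Lemma cosD2pin (x : R) (n : nat) : cos (x + 2 * pi * n%:R) = cos x.
Proof.
elim: n => [|n IH]; first by rewrite mulr0 addr0.
have -> : x + 2 * pi * n.+1%:R = (x + 2 * pi * n%:R) + pi *+ 2 by rewrite -natr1 -mulr_natl; ring.
by rewrite cosD2pi.
Qed.

Lemma cosD2piz (x : R) (m : int) : cos (x + 2 * pi * m%:~R) = cos x.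
Proof.
case: m => n; first exact: cosD2pin.
by rewrite -(cosD2pin _ n.+1); congr cos; rewrite NegzE mulrNz; rewrite -pmulrn; ring.
Qed.

Lemma sin_piz (m : int) : sin (pi * m%:~R : R) = 0.
Proof.
have H (n : nat) : sin (pi * n%:R : R) = 0.
  elim: n => [|n IH]; first by rewrite mulr0 sin0.
  by rewrite -natr1 mulrDr mulr1 sinDpi IH oppr0.
by case: m => n; rewrite ?H// NegzE mulrNz -pmulrn mulrN sinN H oppr0.
Qed.

Lemma Rintegral_sum (D : set R) (I : Type) (s : seq I) (f : I -> R -> R) : measurable D ->
  (forall i, mu.-integrable D (EFin \o f i)) ->
  mu.-integrable D (EFin \o (fun x => \sum_(i <- s) f i x)) /\
  \int[mu]_(x in D) (\sum_(i <- s) f i x) = \sum_(i <- s) \int[mu]_(x in D) f i x.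
Proof.
move=> mD fi; elim: s => [|i s [IH1 IH2]].
  have -> : (fun x => \sum_(i <- [::]) f i x) = fun=> 0 by apply/funext => x; rewrite big_nil.
  rewrite big_nil; split; first exact: integrable0.
  by rewrite /Rintegral integral0.
have -> : (fun x => \sum_(i <- i :: s) f i x) = fun x => f i x + \sum_(i <- s) f i x.
  by apply/funext => x; rewrite big_cons.
split; last by rewrite RintegralD// IH2 big_cons.
pose g x := \sum_(j <- s) f j x.
rewrite (_ : EFin \o _ = ((EFin \o f i) \+ (EFin \o g))%E)//.
exact: integrableD.
Qed.

(** The Fejer kernel as a double sum rather than a quotient of sines: integrated against a Gaussian
    it produces the counts [cnt], and [fejerE] shows its positivity. *)
Definition fejer (N : nat) (x : R) : R :=
  N%:R^-1 * \sum_(i < N) \sum_(j < N) cos (2 * pi * (Posz i - Posz j)%:~R * x).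

Definition csum N (t : R) : R := \sum_(i < N) cos (t * i%:R).
Definition ssum N (t : R) : R := \sum_(i < N) sin (t * i%:R).

(** With [z = cis t], this and [ssumE] are the real and imaginary parts of [(1 - z) (1 + z + ... +
    z^(N-1)) = 1 - z^N]. *)
Lemma csumE N t : csum N t * (1 - cos t) + ssum N t * sin t = 1 - cos (t * N%:R).
Proof.
elim: N => [|N IH]; first by rewrite /csum /ssum !big_ord0 mulr0 cos0; ring.
rewrite /csum /ssum !big_ord_recr/= -/(csum N t) -/(ssum N t) (_ : t * N.+1%:R = t * N%:R + t) ?cosD; last by rewrite -natr1; ring.
by move: IH; lra.
Qed.

Lemma ssumE N t : ssum N t * (1 - cos t) - csum N t * sin t = - sin (t * N%:R).
Proof.
elim: N => [|N IH]; first by rewrite /csum /ssum !big_ord0 mulr0 sin0; ring.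
rewrite /csum /ssum !big_ord_recr/= -/(csum N t) -/(ssum N t) (_ : t * N.+1%:R = t * N%:R + t) ?sinD; last by rewrite -natr1; ring.
by move: IH; lra.
Qed.

Lemma fejerE N x : fejer N x = N%:R^-1 * (csum N (2 * pi * x) ^+ 2 + ssum N (2 * pi * x) ^+ 2).
Proof.
rewrite /fejer; congr (_ * _); rewrite !expr2 /csum /ssum !mulr_suml -big_split /=.
apply: eq_bigr => i _; rewrite !mulr_sumr -big_split /=; apply: eq_bigr => j _.
by rewrite -cosB intrB -!pmulrn; congr cos; ring.
Qed.

Lemma fejer_ge0 N x : 0 <= fejer N x.
Proof. by rewrite fejerE mulr_ge0// ?invr_ge0// addr_ge0// sqr_ge0. Qed.

(** Squared moduli in the geometric sum, with [|1 - z|^2 = 2 (1 - cos t)]. Away from the integers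
    the kernel is therefore [O(1 / N)]. *)
Lemma fejer_bound N x : fejer N x * (1 - cos (2 * pi * x)) <= 2 / N%:R.
Proof.
rewrite fejerE; set t := 2 * pi * x.
have e : (csum N t ^+ 2 + ssum N t ^+ 2) * (1 - cos t) = 1 - cos (t * N%:R).
  have h1 := csumE N t; have h2 := ssumE N t.
  have [c0|c1] := eqVneq (cos t) 1.
    have s0 : sin t = 0 by apply/eqP; rewrite -sqrf_eq0 sin2cos2 c0 expr1n subrr.
    by rewrite -h1 c0 s0; ring.
  have c2 : 2 - 2 * cos t != 0 by apply: contra c1 => /eqP c; apply/eqP; lra.
  apply: (mulfI c2).
  have k1 := cos2Dsin2 t; have k2 := cos2Dsin2 (t * N%:R).
  have : (csum N t * (1 - cos t) + ssum N t * sin t) ^+ 2 + (ssum N t * (1 - cos t) - csum N t * sin t) ^+ 2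
    = 2 - 2 * cos (t * N%:R).
    by rewrite h1 h2; move: k2; nra.
  have -> : (csum N t * (1 - cos t) + ssum N t * sin t) ^+ 2 + (ssum N t * (1 - cos t) - csum N t * sin t) ^+ 2
   = (csum N t ^+ 2 + ssum N t ^+ 2) * ((1 - cos t) ^+ 2 + sin t ^+ 2) by ring.
  have -> : (1 - cos t) ^+ 2 + sin t ^+ 2 = 2 - 2 * cos t by move: k1; nra.
  move=> h; have -> : (2 - 2 * cos t) * (1 - cos (t * N%:R)) = (1 - cos t) * (2 - 2 * cos (t * N%:R)) by ring.
  by rewrite -h; ring.
rewrite -mulrA e mulrC ler_wpM2r ?invr_ge0//.
by have := cos_geN1 (t * N%:R); lra.
Qed.

Lemma continuous_cos_lin (a b : R) : continuous (fun t : R => cos (a + b * t)).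
Proof. by apply: derivable_cont => t; exact: ex_derive. Qed.

Lemma continuous_sum (I : Type) (s : seq I) (f : I -> R -> R) :
  (forall i, continuous (f i)) -> continuous (fun x => \sum_(i <- s) f i x).
Proof.
move=> cf; elim: s => [|i s IH].
  by under eq_fun do rewrite big_nil; move=> x; exact: cvg_cst.
by under eq_fun do rewrite big_cons; move=> x; apply: cvgD; [exact: cf|exact: IH].
Qed.

Lemma continuous_fejer N : continuous (fejer N).
Proof.
move=> x; apply: cvgM; first exact: cvg_cst.
apply: (@continuous_sum _ _ (fun (i : 'I_N) x => \sum_(j < N) cos (2 * pi * (Posz i - Posz j)%:~R * x))) => i.
apply: continuous_sum => j.
by apply: derivable_cont => t; exact: ex_derive.
Qed.

(** Unit intervals centred at the integers, so that each peak of the kernel is interior to one of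
    them; half-open, so that they tile the line. *)
Definition J (k : int) : set R := `[k%:~R - 2^-1, k%:~R + 2^-1[%classic.

Lemma measurable_J k : measurable (J k). Proof. exact: measurable_itv. Qed.

Lemma continuous_integrable_J (f : R -> R) k : continuous f -> mu.-integrable (J k) (EFin \o f).
Proof.
move=> cf; apply: (@integrableS _ _ _ mu (`[k%:~R - 2^-1, k%:~R + 2^-1]%classic)) => //.
- exact: measurable_itv.
- by move=> x; rewrite /J /= !in_itv /= => /andP[-> /ltW ->].
apply: continuous_compact_integrable; first exact: segment_compact.
exact: continuous_subspaceT.
Qed.

Lemma Rintegral_J (F f : R -> R) k : (forall x : R, is_derive x 1 F (f x)) -> continuous f ->
  \int[mu]_(x in J k) f x = F (k%:~R + 2^-1) - F (k%:~R - 2^-1).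
Proof.
move=> dF cf; rewrite /J Rintegral_itv_bndo_bndc; last first.
  by apply: continuous_integrable_J.
rewrite /Rintegral (ftc_cont (F := F))//; lra.
Qed.

Lemma cos_integral_J (d k : int) :
  \int[mu]_(x in J k) cos (2 * pi * d%:~R * x) = (d == 0)%:R.
Proof.
have [->|d0] := eqVneq d 0.
  have dF (x : R) : is_derive x 1 (id : R -> R) (cos (2 * pi * 0%:~R * x)).
    by rewrite mulr0 mul0r cos0; exact: is_derive_id.
  rewrite (Rintegral_J k dF); last by apply: derivable_cont => t; exact: ex_derive.
  by rewrite /=; lra.
have p0 : (pi : R) != 0 by rewrite lt0r_neq0// pi_gt0.
have dR : (d%:~R : R) != 0 by rewrite intr_eq0.
have dF (x : R) : is_derive x 1 (fun x : R => sin (2 * pi * d%:~R * x) / (2 * pi * d%:~R)) (cos (2 * pi * d%:~R * x)).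
  apply: is_derive_eq; rewrite /GRing.scale /=.
  by move: (pi) p0 (cos _) => P P0 c; field; rewrite P0 dR.
rewrite (Rintegral_J k dF); last by apply: derivable_cont => t; exact: ex_derive.
have e1 : 2 * pi * d%:~R * (k%:~R + 2^-1) = pi * (d * (2 * k + 1))%:~R :> R.
  by rewrite intrM intrD intrM; field.
have e2 : 2 * pi * d%:~R * (k%:~R - 2^-1) = pi * (d * (2 * k - 1))%:~R :> R.
  by rewrite intrM intrB intrM; field.
by rewrite e1 e2 !sin_piz !mul0r subrr.
Qed.

Lemma fejer_integral_J N k : (0 < N)%N -> \int[mu]_(x in J k) fejer N x = 1.
Proof.
move=> N0.
have ic (d : int) : mu.-integrable (J k) (EFin \o (fun x : R => cos (2 * pi * d%:~R * x))).
  by apply: continuous_integrable_J; apply: derivable_cont => t; exact: ex_derive.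
have h i := @Rintegral_sum (J k) _ (index_enum 'I_N) (fun j x => cos (2 * pi * (Posz i - Posz (nat_of_ord j))%:~R * x)) (measurable_J k) (fun j => ic _).
have [h1 h2] := @Rintegral_sum (J k) _ (index_enum 'I_N) (fun i x => \sum_(j < N) cos (2 * pi * (Posz (nat_of_ord i) - Posz j)%:~R * x)) (measurable_J k) (fun i => (h i).1).
rewrite /fejer RintegralZl//; last exact: measurable_J.
rewrite h2 (eq_bigr (fun=> 1)) ?sumr_const ?card_ord ?mulVf ?pnatr_eq0 ?gt_eqF//.
move=> i _; rewrite (h i).2 (bigD1 i)//= cos_integral_J subrr eqxx big1 ?addr0//.
move=> j ji; rewrite cos_integral_J; case: eqP => // /eqP; rewrite subr_eq0 => /eqP [] ij.
by move: ji; rewrite -val_eqE /= ij eqxx.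
Qed.

Definition natint (n : nat) : int := if odd n then Negz n./2 else Posz n./2.

Lemma natint_bij : bijective natint.
Proof.
exists (fun k : int => match k with Posz n => n.*2 | Negz n => n.*2.+1 end).
  by move=> n; rewrite /natint; have := odd_double_half n; case: ifP => /= _; lia.
by case=> n; rewrite /natint /= ?odd_double ?doubleK //= uphalf_double.
Qed.

Lemma J_trivIset : trivIset [set: nat] (fun n => J (natint n)).
Proof.
apply/trivIsetP => i j _ _ ij; apply/seteqP; split=> // x [].
rewrite /J /= !in_itv /= => /andP[a1 a2] /andP[b1 b2].
have h1 : (natint i)%:~R < (natint j)%:~R + 1 :> R by lra.
have h2 : (natint j)%:~R < (natint i)%:~R + 1 :> R by lra.
rewrite -[1]/(1%:~R) -intrD ltr_int in h1; rewrite -[1]/(1%:~R) -intrD ltr_int in h2.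
have : natint i = natint j by lia.
by move/(bij_inj natint_bij) => e; rewrite e eqxx in ij.
Qed.

Lemma J_cover : \bigcup_n J (natint n) = [set: R].
Proof.
apply/seteqP; split=> // x _.
have [g gK Kg] := natint_bij.
exists (g (Num.floor (x + 2^-1))) => //; rewrite Kg /J /= in_itv /=.
have := floor_itv (x + 2^-1); rewrite intrD => /andP[h1 h2].
by apply/andP; split; lra.
Qed.

Lemma integral_J_rsum (f : R -> R) : (forall x, 0 <= f x) -> continuous f ->
  mu.-integrable [set: R] (EFin \o f) ->
  summ (fun k => \int[mu]_(x in J k) f x) /\
  \int[mu]_(x in [set: R]) f x = rsum (fun k => \int[mu]_(x in J k) f x).
Proof.
move=> f0 cf intf.
have mf := continuous_EFin_meas cf.
have e : (\int[mu]_(x in [set: R]) (f x)%:E = \esum_(k in [set: int]) (\int[mu]_(x in J k) f x)%:E)%E.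
  rewrite (reindex_esum [set: nat] _ natint); last by rewrite setTT_bijective; exact: natint_bij.
  rewrite -nneseries_esumT => [|n]; last by rewrite lee_fin; apply: Rintegral_ge0.
  rewrite -J_cover ge0_integral_bigcup//.
  - apply: eq_eseriesr => n _; rewrite fineK//; apply: integrable_fin_num; first exact: measurable_J.
    exact: continuous_integrable_J.
  - by move=> n; exact: measurable_J.
  - by rewrite J_cover.
  - by move=> x _; rewrite lee_fin.
  - exact: J_trivIset.
have fin : (\int[mu]_(x in [set: R]) (f x)%:E)%E \is a fin_num by exact: integrable_fin_num.
have s : summ (fun k => \int[mu]_(x in J k) f x).
  apply: (@summ_ge0 _ _ _ (fine (\int[mu]_(x in [set: R]) (f x)%:E)%E)).
    by move=> k; apply: Rintegral_ge0.
  by rewrite -e fineK.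
split=> //; rewrite /Rintegral [X in fine X = _]e rsum_ge0E// => k.
exact: Rintegral_ge0.
Qed.

Lemma cos_far (dl : R) (k : int) (x : R) : 0 < dl <= 2^-1 -> J k x -> dl <= `|x - k%:~R| ->
  cos (2 * pi * x) <= cos (2 * pi * dl).
Proof.
move=> /andP[d0 d1]; rewrite /J /= in_itv /= => /andP[x1 x2] dx.
have p0 : (0 : R) < pi by exact: pi_gt0.
have -> : 2 * pi * x = 2 * pi * (x - k%:~R) + 2 * pi * k%:~R by ring.
rewrite cosD2piz -cos_norm normrM (@ger0_norm _ (2 * pi)); last by rewrite mulr_ge0// ltW.
have u1 : `|x - k%:~R| <= 2^-1 by rewrite ler_norml; apply/andP; split; lra.
by rewrite leNgt ltr_cos ?in_itv /= -?leNgt; nra.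
Qed.

(** The kernel has mass 1 on each unit interval and concentrates at its centre: near [k] the
    continuity of [h] leaves an error [e / 2], and elsewhere [fejer_bound] leaves [B], which is of
    order [1 / N]. *)
Lemma fejer_J_cvg (h : R -> R) (M : R) (k : int) : continuous h ->
  (forall x, `|h x| <= M) ->
  \int[mu]_(x in J k) (h x * fejer N x) @[N --> \oo] --> h k%:~R.
Proof.
move=> ch hM; apply/cvgrPdist_le => e e0.
have e2 : 0 < e / 2 by rewrite divr_gt0.
have : \forall x \near (k%:~R : R), `|h k%:~R - h x| < e / 2.
  by move: (ch k%:~R) => /cvgrPdist_lt; apply.
move=> -[d /= d0 hd].
(* [cos_far] needs a radius of at most half a period, and [dl < d] makes it a lower bound for the
   distance of all points outside the radius of continuity. *)
pose dl := Num.min (2^-1) (d / 2).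
have dl0 : 0 < dl by rewrite /dl lt_min invr_gt0 ltr0n divr_gt0.
have dl2 : dl <= 2^-1 by rewrite /dl ge_min lexx.
have dld : dl < d by rewrite /dl gt_min; apply/orP; right; rewrite ltr_pdivrMr// ltr_pMr// ltr1n.
have p0 : (0 : R) < pi by exact: pi_gt0.
have c0 : 0 < 1 - cos (2 * pi * dl).
  have a1 : 0 < 2 * pi * dl by rewrite !mulr_gt0.
  have a2 : 2 * pi * dl <= pi by nra.
  have i1 : 2 * pi * dl \in `[0, pi] by rewrite in_itv/= (ltW a1) a2.
  have i0 : (0 : R) \in `[0, pi] by rewrite in_itv/= lexx (ltW p0).
  by rewrite subr_gt0 -[X in _ < X]cos0 ltr_cos.
set c := 1 - _ in c0.
have M0 : 0 <= M by exact: le_trans (hM 0).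
near=> N.
have N0 : (0 < N)%N by near: N; exact: nbhs_infty_gt.
have NR : (0 : R) < N%:R by rewrite ltr0n.
have iF := continuous_integrable_J k (@continuous_fejer N).
have chF : continuous (fun x => h x * fejer N x).
  by move=> x; apply: cvgM; [exact: ch|exact: continuous_fejer].
have ihF := continuous_integrable_J k chF.
have cd : continuous (fun x => (h k%:~R - h x) * fejer N x).
  move=> x; apply: cvgM; last exact: continuous_fejer.
  by apply: cvgB; [exact: cvg_cst|exact: ch].
have -> : h k%:~R - \int[mu]_(x in J k) (h x * fejer N x)
   = \int[mu]_(x in J k) ((h k%:~R - h x) * fejer N x).
  rewrite -[h k%:~R in LHS]mulr1 -(fejer_integral_J k N0) -RintegralZl//; last exact: measurable_J.
  rewrite -RintegralB//; last 2 first.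
  - exact: measurable_J.
  - apply: continuous_integrable_J => x; apply: cvgM; first exact: cvg_cst.
    exact: continuous_fejer.
  by apply: eq_Rintegral => x _; ring.
pose B := 2 * M * (2 / N%:R / c).
have iB : mu.-integrable (J k) (EFin \o (fun x => e / 2 * fejer N x + B)).
  apply: continuous_integrable_J => x; apply: cvgD; last exact: cvg_cst.
  by apply: cvgM; [exact: cvg_cst|exact: continuous_fejer].
have ieF : mu.-integrable (J k) (EFin \o (fun x => e / 2 * fejer N x)).
  by apply: continuous_integrable_J => x; apply: cvgM; [exact: cvg_cst|exact: continuous_fejer].
have iBB : mu.-integrable (J k) (EFin \o (fun=> B)).
  by apply: continuous_integrable_J => x; exact: cvg_cst.
have hn := @le_normr_Rintegral _ _ _ mu (J k) _ (measurable_J k) (continuous_integrable_J k cd).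
apply: (le_trans hn) => {hn}.
apply: (@le_trans _ _ (\int[mu]_(x in J k) (e / 2 * fejer N x + B))).
  apply: le_Rintegral => //; first exact: measurable_J.
  - by apply: continuous_integrable_J => x; apply: cvg_norm; exact: cd.
  move=> x Jx; rewrite normrM (ger0_norm (fejer_ge0 _ _)).
  have B0 : 0 <= B := mulr_ge0 (mulr_ge0 (ler0n R 2) M0) (divr_ge0 (divr_ge0 (ler0n R 2) (ltW NR)) (ltW c0)).
  have [xd|dx] := ltP `|x - k%:~R| d.
    rewrite -[leLHS]addr0 lerD// ler_wpM2r ?fejer_ge0// ltW//; apply: hd => /=.
    by rewrite distrC.
  have q : 0 <= e / 2 * fejer N x by apply: mulr_ge0; [exact: ltW|exact: fejer_ge0].
  rewrite -[leLHS]add0r; apply: lerD => //.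
  have F1 : fejer N x <= 2 / N%:R / c.
    rewrite ler_pdivlMr//; apply: le_trans (fejer_bound N x).
    rewrite ler_wpM2l ?fejer_ge0// /c lerD2l lerN2.
    by apply: (@cos_far dl k) => //; [rewrite dl0|apply: le_trans dx; exact: ltW].
  apply: ler_pM; rewrite ?normr_ge0 ?fejer_ge0//.
  by rewrite (le_trans (ler_normB _ _))// mulr_natl mulr2n lerD.
rewrite RintegralD//; last exact: measurable_J.
rewrite RintegralZl//; last exact: measurable_J.
rewrite fejer_integral_J// mulr1.
have -> : \int[mu]_(x in J k) B = B.
  have dB (x : R) : is_derive x 1 (fun x : R => B * x) B.
    by apply: is_derive_eq; rewrite /GRing.scale /= mulr1.
  rewrite (Rintegral_J k dB); last by move=> x; exact: cvg_cst.
  lra.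
have : B <= e / 2.
  have : 2 * M * 2 / c / (e / 2) <= N%:R by near: N; exact: nbhs_infty_ger.
  rewrite ler_pdivrMr// => hN.
  rewrite /B (_ : _ * _ = (2 * M * 2 / c) / N%:R); last by field; rewrite !gt_eqF.
  by rewrite ler_pdivrMr// [leRHS]mulrC.
lra.
Unshelve. all: by end_near.
Qed.

(** From [(s k - y)^2 <= 2 (s x - y)^2 + 2 s^2 (x - k)^2] and [|x - k| <= 1/2]. It gives a summable
    majorant for the integrals over [J k] that does not depend on the order of the kernel. *)
Lemma gau_J_bound (s y x : R) k : 0 < s -> J k x ->
  gau s y x <= expR (pi * s ^+ 2 / 4) * expR (- (pi / 2 * (s * k%:~R - y) ^+ 2)).
Proof.
move=> s0; rewrite /J /= in_itv /= => /andP[x1 x2].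
have p0 : (0 : R) < pi by exact: pi_gt0.
rewrite -expRD ler_expR.
have : (x - k%:~R) ^+ 2 <= 4^-1.
  by rewrite expr2; nra.
move=> u; have := sqr_ge0 ((s * x - y) + s * (x - k%:~R)) => w.
have : 0 <= s ^+ 2 * (4^-1 - (x - k%:~R) ^+ 2) by rewrite mulr_ge0 ?sqr_ge0 ?subr_ge0.
move=> v.
have : 0 <= pi / 2 * (2 * (s * x - y) ^+ 2 - (s * k%:~R - y) ^+ 2 + 2 * s ^+ 2 / 4).
  apply: mulr_ge0; first by rewrite divr_ge0// ltW.
  have -> : 2 * (s * x - y) ^+ 2 - (s * k%:~R - y) ^+ 2 + 2 * s ^+ 2 / 4 =
    ((s * x - y) + s * (x - k%:~R)) ^+ 2 + 2 * (s ^+ 2 * (4^-1 - (x - k%:~R) ^+ 2)) by field.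
  by lra.
lra.
Qed.

Lemma summ_gauss (c s y : R) : 0 < c -> 0 < s ->
  summ (fun k : int => expR (- (c * (s * k%:~R - y) ^+ 2))).
Proof.
move=> c0 s0.
have cs : 0 < c * s ^+ 2 / 2 by rewrite divr_gt0// mulr_gt0// exprn_gt0.
apply: (@summ_expR _ (c * s ^+ 2 / 2) (c * y ^+ 2)) => //.
move=> k; apply: le_trans (_ : c * s ^+ 2 / 2 * k%:~R ^+ 2 <= _).
  by rewrite ler_wpM2l ?(ltW cs)//; exact: norm_le_sqr.
have : 0 <= c * (s * k%:~R - 2 * y) ^+ 2 / 2 by rewrite divr_ge0// mulr_ge0 ?sqr_ge0// ltW.
lra.
Qed.

Lemma fejer_rsum (s y C : R) (h : R -> R) : 0 < s -> continuous h -> 0 <= C ->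
  (forall x, 0 <= h x <= C * gau s y x) ->
  summ (fun k : int => h k%:~R) /\
  \int[mu]_(x in [set: R]) (h x * fejer N x) @[N --> \oo] --> rsum (fun k : int => h k%:~R).
Proof.
move=> s0 ch C0 hg.
have p0 : (0 : R) < pi by exact: pi_gt0.
have h0 x : 0 <= h x by case/andP: (hg x).
have hC x : `|h x| <= C.
  rewrite ger0_norm//; case/andP: (hg x) => _ /le_trans; apply.
  by rewrite ler_piMr// -expR0 ler_expR oppr_le0 mulr_ge0 ?sqr_ge0 ?(ltW p0).
pose G k := C * (expR (pi * s ^+ 2 / 4) * expR (- (pi / 2 * (s * k%:~R - y) ^+ 2))).
have sG : summ G by apply/summZ/summZ/summ_gauss => //; rewrite divr_gt0.
have chF N : continuous (fun x => h x * fejer N x).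
  by move=> x; apply: cvgM; [exact: ch|exact: continuous_fejer].
have hF0 N x : 0 <= h x * fejer N x by rewrite mulr_ge0 ?fejer_ge0.
have ihF N : mu.-integrable [set: R] (EFin \o (fun x => h x * fejer N x)).
  have [F Fb] : exists F, forall x, fejer N x <= F.
    exists (N%:R^-1 * (N%:R * N%:R)) => x; rewrite /fejer ler_wpM2l ?invr_ge0//.
    have -> : N%:R * N%:R = \sum_(i < N) \sum_(j < N) (1 : R).
      under eq_bigr do rewrite sumr_const card_ord.
      by rewrite sumr_const card_ord mulr_natr.
    by apply: ler_sum => i _; apply: ler_sum => j _; exact: cos_le1.
  apply: (@le_gau_int _ (C * F) s y) => //.
  move=> x; rewrite ger0_norm// mulrAC; apply: ler_pM; rewrite ?fejer_ge0//.
  by case/andP: (hg x).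
have eN N := integral_J_rsum (hF0 N) (chF N) (ihF N).
have bd N k : `|\int[mu]_(x in J k) (h x * fejer N x)| <= G k.
  have [->|N0] := posnP N.
    rewrite (@eq_Rintegral _ _ _ mu (J k) (fun=> 0)).
      rewrite /Rintegral integral0 /= normr0 !mulr_ge0 ?expR_ge0//.
    by move=> x _; rewrite /fejer big_ord0 !mulr0.
  have h1 : 0 <= \int[mu]_(x in J k) (h x * fejer N x) by apply: Rintegral_ge0.
  rewrite (ger0_norm h1) -[G k]mulr1 -(fejer_integral_J k N0) -RintegralZl//; last 2 first.
  - exact: measurable_J.
  - by apply: continuous_integrable_J; exact: continuous_fejer.
  apply: le_Rintegral.
  - exact: measurable_J.
  - by apply: continuous_integrable_J.
  - by apply: continuous_integrable_J => x; apply: cvgM; [exact: cvg_cst|exact: continuous_fejer].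
  move=> x Jx; rewrite ler_wpM2r ?fejer_ge0//.
  case/andP: (hg x) => _ /le_trans; apply; rewrite ler_wpM2l//.
  exact: gau_J_bound.
have [s1 s2] := rsum_dominated sG bd (fun k => @fejer_J_cvg h C k ch hC).
split=> //; apply: cvg_trans s2; apply: near_eq_cvg; apply: nearW => N.
by rewrite (eN N).2.
Qed.

(** The [d]-th term of the dual side: the integral of [gau s y] against the cosine of phase [p] and
    frequency [th + d]. *)
Definition theta_dual (s y p th : R) (d : int) : R :=
  s^-1 * expR (- (pi * ((th + d%:~R) / s) ^+ 2)) * cos (p + 2 * pi * (th + d%:~R) * (y / s)).

Lemma summ_theta_dual (s y p th : R) : 0 < s -> summ (theta_dual s y p th).
Proof.
move=> s0; have p0 : (0 : R) < pi by exact: pi_gt0.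
have si : 0 < s^-1 by rewrite invr_gt0.
apply: summ_le (summZ s^-1 (summ_gauss (- (th / s)) p0 si)) => d.
rewrite /theta_dual !normrM (gtr0_norm si) (@gtr0_norm _ (expR _)) ?expR_gt0// -mulrA.
rewrite (_ : s^-1 * d%:~R - - (th / s) = (th + d%:~R) / s); last by rewrite mulrDl; ring.
by rewrite ler_wpM2l ?(ltW si)// ler_piMr ?expR_ge0 ?cos_max.
Qed.

(** The Gaussian is integrated exactly against each cosine of the double sum. A product of two
    cosines has the frequencies [th + d] and [th - d], whence the symmetrization in [d]. *)
Lemma fejer_gau (s y p th : R) N : 0 < s ->
  mu.-integrable [set: R] (EFin \o (fun x => gau s y x * cos (p + 2 * pi * th * x) * fejer N x)) /\
  \int[mu]_(x in [set: R]) (gau s y x * cos (p + 2 * pi * th * x) * fejer N x) =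
  N%:R^-1 * rsum (fun d => (theta_dual s y p th d + theta_dual s y p th (- d)) / 2 * cnt N d).
Proof.
move=> s0.
have sH := summ_theta_dual y p th s0.
have sHN : summ (fun d => theta_dual s y p th (- d)).
  have bN : bijective (fun d : int => - d) by exists (fun d : int => - d) => d; rewrite opprK.
  by apply/(summ_reindex (theta_dual s y p th) bN).
pose K d := (theta_dual s y p th d + theta_dual s y p th (- d)) / 2.
have sK : summ K by apply/summZr/summD.
pose g (d : int) x := gau s y x * cos (p + 2 * pi * th * x) * cos (2 * pi * d%:~R * x).
have gE (d : int) x : g d x = 2^-1 * (gau s y x * cos (p + 2 * pi * (th + d%:~R) * x) +
    gau s y x * cos (p + 2 * pi * (th - d%:~R) * x)).
  rewrite /g (_ : p + 2 * pi * (th + d%:~R) * x = (p + 2 * pi * th * x) + 2 * pi * d%:~R * x); last by ring.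
  rewrite (_ : p + 2 * pi * (th - d%:~R) * x = (p + 2 * pi * th * x) - 2 * pi * d%:~R * x); last by ring.
  move: (p + 2 * pi * th * x) (2 * pi * d%:~R * x) => a b.
  by rewrite cosB cosD; field.
have og xi := osc_integral y p xi s0.
have gI (d : int) : mu.-integrable [set: R] (EFin \o g d) /\ \int[mu]_(x in [set: R]) g d x = K d.
  have -> : g d = fun x => 2^-1 * (gau s y x * cos (p + 2 * pi * (th + d%:~R) * x) +
    gau s y x * cos (p + 2 * pi * (th - d%:~R) * x)) by apply/funext => x; exact: gE.
  have i1 := (og (th + d%:~R)).1; have i2 := (og (th - d%:~R)).1.
  split; first by apply: integZ; exact: integD.
  rewrite RintegralZl//; last exact: integD.
  rewrite RintegralD// (og _).2 (og _).2 /K /theta_dual mulrNz; field.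
  by rewrite lt0r_neq0.
have h i := @Rintegral_sum setT _ (index_enum 'I_N) (fun j x => g (Posz i - Posz (nat_of_ord j)) x) measurableT (fun j => (gI _).1).
have [h1 h2] := @Rintegral_sum setT _ (index_enum 'I_N) (fun i x => \sum_(j < N) g (Posz (nat_of_ord i) - Posz j) x) measurableT (fun i => (h i).1).
have -> : (fun x => gau s y x * cos (p + 2 * pi * th * x) * fejer N x) =
   fun x => N%:R^-1 * \sum_(i < N) \sum_(j < N) g (Posz i - Posz j) x.
  apply/funext => x; rewrite /fejer /g mulrCA; congr (_ * _).
  by rewrite mulr_sumr; apply: eq_bigr => i _; rewrite mulr_sumr.
split; first exact: integZ.
rewrite RintegralZl// h2 -(sum_cnt _ sK); congr (_ * _); apply: eq_bigr => i _.
by rewrite (h i).2; apply: eq_bigr => j _; rewrite (gI _).2.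
Qed.

Lemma fejer_gau_cvg (s y p th : R) : 0 < s ->
  \int[mu]_(x in [set: R]) (gau s y x * cos (p + 2 * pi * th * x) * fejer N x) @[N --> \oo]
  --> rsum (theta_dual s y p th).
Proof.
move=> s0.
have sH := summ_theta_dual y p th s0.
have bN : bijective (fun d : int => - d) by exists (fun d : int => - d) => d; rewrite opprK.
have sHN : summ (fun d => theta_dual s y p th (- d)).
  by apply/(summ_reindex (theta_dual s y p th) bN).
pose K d := (theta_dual s y p th d + theta_dual s y p th (- d)) / 2.
have sK : summ K by apply/summZr/summD.
have -> : rsum (theta_dual s y p th) = rsum K.
  rewrite /K rsumZr ?rsumD//; last exact: summD.
  by rewrite -(rsum_reindex (theta_dual s y p th) bN); field.
have bd N d : `|K d * (cnt N d / N%:R)| <= `|K d|.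
  rewrite normrM ler_piMr// ger0_norm; have /andP[c0 c1] := @cnt_le R N d.
    have [->|N0] := posnP N; first by rewrite invr0 mulr0.
    by rewrite ler_pdivrMr ?mul1r// ltr0n.
  by rewrite divr_ge0.
have cv d : K d * (cnt N d / N%:R) @[N --> \oo] --> K d.
  rewrite -[X in _ --> X]mulr1; apply: cvgM; first exact: cvg_cst.
  exact: cnt_cvg.
have [_ h] := rsum_dominated (summ_abs sK) bd cv.
apply: cvg_trans h; apply: near_eq_cvg; apply: nearW => N.
rewrite (fejer_gau y p th N s0).2 -rsumZ.
  by apply: eq_rsum => d; rewrite -/(K d); ring.
apply: (@summ_le _ _ _ (fun d => N%:R * `|K d|)); last exact/summZ/summ_abs.
move=> d; rewrite normrM mulrC ler_wpM2r//.
by have /andP[c0 c1] := @cnt_le R N d; rewrite ger0_norm.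
Qed.

Lemma summ_theta (s y p th : R) : 0 < s ->
  summ (fun k : int => gau s y k%:~R * cos (p + 2 * pi * th * k%:~R)).
Proof.
move=> s0; apply: summ_le (summ_gauss y (@pi_gt0 R) s0) => k.
by rewrite normrM ger0_norm ?gau_ge0// ler_piMr ?gau_ge0 ?cos_max.
Qed.

(** The integrals against the Fejer kernel tend to the sum over the integers, because the kernel
    concentrates there, and to the sum of the Fourier transforms, because the weights [cnt N d / N]
    tend to 1. *)
Theorem poisson1 (s y p th : R) : 0 < s ->
  rsum (fun k : int => gau s y k%:~R * cos (p + 2 * pi * th * k%:~R)) = rsum (theta_dual s y p th).
Proof.
move=> s0.
have c0 x : gau s y x = gau s y x * cos (0 + 2 * pi * 0 * x).
  by rewrite mulr0 mul0r addr0 cos0 mulr1.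
have ccos : continuous (fun x => gau s y x * cos (p + 2 * pi * th * x)).
  move=> x; apply: cvgM; [exact: continuous_gau|exact: continuous_cos_lin].
have [sg lg] := @fejer_rsum s y 1 (gau s y) s0 (@continuous_gau R s y) ler01
  (fun x => introT andP (conj (gau_ge0 s y x) (eq_ind_r (fun z => gau s y x <= z) (lexx _) (mul1r _)))).
(* Concentration is established for nonnegative functions, so the oscillating Gaussian is raised by
   [gau s y], whose own sum is cancelled at the end. *)
have b2 x : 0 <= gau s y x + gau s y x * cos (p + 2 * pi * th * x) <= 2 * gau s y x.
  have g0 := gau_ge0 s y x; have c1 := cos_le1 (p + 2 * pi * th * x); have c2 := cos_geN1 (p + 2 * pi * th * x).
  by apply/andP; split; nra.
have ch : continuous (fun x => gau s y x + gau s y x * cos (p + 2 * pi * th * x)).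
  by move=> x; apply: cvgD; [exact: continuous_gau|exact: ccos].
have [s2 l2] := @fejer_rsum s y 2 _ s0 ch (ler0n _ 2) b2.
have l1 := @fejer_gau_cvg s y p th s0.
have l3 : \int[mu]_(x in [set: R]) ((gau s y x + gau s y x * cos (p + 2 * pi * th * x)) * fejer N x) @[N --> \oo]
   --> rsum (fun k : int => gau s y k%:~R) + rsum (theta_dual s y p th).
  rewrite (_ : (fun N => _) = (fun N => \int[mu]_(x in [set: R]) (gau s y x * fejer N x) +
    \int[mu]_(x in [set: R]) (gau s y x * cos (p + 2 * pi * th * x) * fejer N x))); first exact: cvgD.
  apply/funext => N; rewrite -RintegralD//; last 2 first.
  - have := (fejer_gau y 0 0 N s0).1.
    by rewrite (_ : (fun x => _) = (fun x => gau s y x * fejer N x))//; apply/funext => x; rewrite -c0.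
  - exact: (fejer_gau y p th N s0).1.
  by apply: eq_Rintegral => x _; rewrite mulrDl.
have := cvg_unique _ l2 l3; rewrite rsumD//; last exact: summ_theta.
by move=> /(_ (@Rhausdorff R) _) e; apply: addrI; exact: e.
Qed.

End Poisson1.


(** * Poisson summation for planar Gaussians on a sheared lattice *)

Section Poisson2.
Context {R : realType}.

Lemma norm_le_quad (A b x : R) : 0 < A -> b * `|x| <= A * x ^+ 2 + b ^+ 2 / (4 * A).
Proof.
move=> A0; rewrite -[x ^+ 2]real_normK ?num_real//; set u := `|x|.
have h : 0 <= (2 * A * u - b) ^+ 2 / (4 * A) by rewrite divr_ge0 ?sqr_ge0// mulr_ge0// ltW.
have : (2 * A * u - b) ^+ 2 / (4 * A) = A * u ^+ 2 + b ^+ 2 / (4 * A) - b * u.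
  by field; rewrite lt0r_neq0.
lra.
Qed.

Lemma summ_gauss2 (a1 a3 r m1 m2 : R) : 0 < a1 -> 0 < a3 ->
  summ (fun k : int * int => expR (- (pi * ((a1 * k.1%:~R - m1) ^+ 2 +
     (a3 * (k.2%:~R + r * k.1%:~R) - m2) ^+ 2)))).
Proof.
move=> a10 a30; have p0 : (0 : R) < pi by exact: pi_gt0.
pose A1 := pi / 2 * a1 ^+ 2; pose A3 := pi / 2 * a3 ^+ 2.
have A10 : 0 < A1 by rewrite mulr_gt0 ?divr_gt0// exprn_gt0.
have A30 : 0 < A3 by rewrite mulr_gt0 ?divr_gt0// exprn_gt0.
apply: (@summ_expR2 R 1 (1 ^+ 2 / (4 * A3) + (1 + `|r|) ^+ 2 / (4 * A1) + pi * (m1 ^+ 2 + m2 ^+ 2))) => //.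
move=> [k l] /=; rewrite mul1r !intr_norm.
set K := k%:~R; set L := l%:~R.
have h1 := norm_le_quad 1 (L + r * K) A30.
have h2 := norm_le_quad (1 + `|r|) K A10.
have h3 : `|L| <= `|L + r * K| + `|r| * `|K|.
  by rewrite -{1}[L](addrK (r * K)) (le_trans (ler_normB _ _))// normrM.
have h4 : A1 * K ^+ 2 <= pi * (a1 * K - m1) ^+ 2 + pi * m1 ^+ 2.
  have : 0 <= pi / 2 * (a1 * K - 2 * m1) ^+ 2 by rewrite mulr_ge0 ?sqr_ge0 ?divr_ge0 ?ltW.
  rewrite /A1; lra.
have h5 : A3 * (L + r * K) ^+ 2 <= pi * (a3 * (L + r * K) - m2) ^+ 2 + pi * m2 ^+ 2.
  have : 0 <= pi / 2 * (a3 * (L + r * K) - 2 * m2) ^+ 2 by rewrite mulr_ge0 ?sqr_ge0 ?divr_ge0 ?ltW.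
  rewrite /A3; lra.
lra.
Qed.

Lemma summ_gauss2_dual (a1 a3 m1 m2 t1 t2 p : R) : 0 < a1 -> 0 < a3 ->
  summ (fun n : int * int => expR (- (pi * ((t1 + (n.2%:~R - n.1%:~R / 2) / a1) ^+ 2 +
     (t2 + n.1%:~R / a3) ^+ 2))) *
     cos (p + 2 * pi * ((t1 + (n.2%:~R - n.1%:~R / 2) / a1) * m1 + (t2 + n.1%:~R / a3) * m2))).
Proof.
move=> a10 a30.
have i1 : 0 < a1^-1 by rewrite invr_gt0.
have i3 : 0 < a3^-1 by rewrite invr_gt0.
apply: summ_le (summ_gauss2 (- 2^-1) (- t2) (- t1) i3 i1) => -[n m] /=.
rewrite normrM ger0_norm ?expR_ge0//.
rewrite (_ : (a3^-1 * n%:~R - - t2) ^+ 2 + (a1^-1 * (m%:~R + - 2^-1 * n%:~R) - - t1) ^+ 2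
  = (t1 + (m%:~R - n%:~R / 2) / a1) ^+ 2 + (t2 + n%:~R / a3) ^+ 2); last by ring.
by rewrite ler_piMr ?expR_ge0 ?cos_max.
Qed.

(** One-dimensional summation in the second index, exchange of the sums, and one-dimensional
    summation in the first. The shear [2^-1 * k.1] displaces the inner Gaussian, and this
    displacement reappears as the frequency [- n / 2] of the outer sum. *)
Theorem poisson2 (a1 a3 m1 m2 t1 t2 p : R) : 0 < a1 -> 0 < a3 ->
  rsum (fun k : int * int => expR (- (pi * ((a1 * k.1%:~R - m1) ^+ 2 +
     (a3 * (k.2%:~R + 2^-1 * k.1%:~R) - m2) ^+ 2))) *
     cos (p + 2 * pi * (t1 * (a1 * k.1%:~R) + t2 * (a3 * (k.2%:~R + 2^-1 * k.1%:~R))))) =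
  (a1 * a3)^-1 *
  rsum (fun n : int * int => expR (- (pi * ((t1 + (n.2%:~R - n.1%:~R / 2) / a1) ^+ 2 +
     (t2 + n.1%:~R / a3) ^+ 2))) *
     cos (p + 2 * pi * ((t1 + (n.2%:~R - n.1%:~R / 2) / a1) * m1 + (t2 + n.1%:~R / a3) * m2))).
Proof.
move=> a10 a30; have p0 : (0 : R) < pi by exact: pi_gt0.
have n1 : a1 != 0 by rewrite lt0r_neq0.
have n3 : a3 != 0 by rewrite lt0r_neq0.
rewrite rsum_pair; last first.
  apply: summ_le (summ_gauss2 2^-1 m1 m2 a10 a30) => k.
  by rewrite normrM ger0_norm ?expR_ge0// ler_piMr ?expR_ge0 ?cos_max.
pose f (k n : int) := gau a1 m1 k%:~R * (a3^-1 * expR (- (pi * (t2 + n%:~R / a3) ^+ 2)) *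
   cos ((p + 2 * pi * (t2 * a3 + n%:~R) * (m2 / a3)) + 2 * pi * (t1 * a1 - n%:~R / 2) * k%:~R)).
transitivity (rsum (fun k => rsum (fun n => f k n))).
  apply: eq_rsum => k /=.
  have H := @poisson1 R a3 (m2 - a3 * (2^-1 * k%:~R))
      (p + 2 * pi * (t1 * (a1 * k%:~R) + t2 * a3 * (2^-1 * k%:~R))) (t2 * a3) a30.
  transitivity (gau a1 m1 k%:~R * rsum (fun l : int => gau a3 (m2 - a3 * (2^-1 * k%:~R)) l%:~R *
     cos (p + 2 * pi * (t1 * (a1 * k%:~R) + t2 * a3 * (2^-1 * k%:~R)) + 2 * pi * (t2 * a3) * l%:~R))).
    rewrite -rsumZ; last exact: summ_theta.
    apply: eq_rsum => l; rewrite [RHS]mulrA /gau -expRD; congr (expR _ * cos _); ring.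
  rewrite H -rsumZ; last exact: summ_theta_dual.
  apply: eq_rsum => n; rewrite /theta_dual /f; congr (_ * (_ * expR _ * cos _)).
    by congr (- (_ * _ ^+ 2)); field.
  by move: (pi) => P; field; rewrite ?n1 ?n3.
have sf : summ (fun q : int * int => f q.1 q.2).
  have s1 : summ (fun k : int => gau a1 m1 k%:~R) by exact: summ_gauss.
  have a3i : 0 < a3^-1 by rewrite invr_gt0.
  have s2 := summZ a3^-1 (summ_gauss (- t2) p0 a3i).
  apply: summ_le (summM s1 s2) => -[k n] /=; rewrite /f !normrM.
  rewrite (ger0_norm (gau_ge0 _ _ _)) (gtr0_norm a3i) (@ger0_norm _ (expR _)) ?expR_ge0//.
  rewrite ler_wpM2l ?gau_ge0// -mulrA ler_wpM2l ?(ltW a3i)//.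
  rewrite (_ : a3^-1 * n%:~R - - t2 = t2 + n%:~R / a3); last by ring.
  by rewrite ler_piMr ?expR_ge0 ?cos_max.
rewrite rsum_swap//.
have srhs := summ_gauss2_dual m1 m2 t1 t2 p a10 a30.
rewrite [in RHS]rsum_pair// -rsumZ; last first.
  exact: (summ_pair srhs).
apply: eq_rsum => n /=.
have H := @poisson1 R a1 m1 (p + 2 * pi * (t2 * a3 + n%:~R) * (m2 / a3)) (t1 * a1 - n%:~R / 2) a10.
transitivity (a3^-1 * expR (- (pi * (t2 + n%:~R / a3) ^+ 2)) * rsum (fun k : int => gau a1 m1 k%:~R *
     cos (p + 2 * pi * (t2 * a3 + n%:~R) * (m2 / a3) + 2 * pi * (t1 * a1 - n%:~R / 2) * k%:~R))).
  rewrite -rsumZ; last exact: summ_theta.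
  by apply: eq_rsum => k; rewrite /f; ring.
rewrite H -[LHS]rsumZ; last exact: summ_theta_dual.
rewrite -[RHS]rsumZ; last by have := summ_pair1 n srhs.
apply: eq_rsum => m; rewrite /theta_dual.
have -> : a3^-1 * expR (- (pi * (t2 + n%:~R / a3) ^+ 2)) *
   (a1^-1 * expR (- (pi * ((t1 * a1 - n%:~R / 2 + m%:~R) / a1) ^+ 2)) *
   cos (p + 2 * pi * (t2 * a3 + n%:~R) * (m2 / a3) + 2 * pi * (t1 * a1 - n%:~R / 2 + m%:~R) * (m1 / a1)))
  = (a1^-1 * a3^-1) * ((expR (- (pi * ((t1 * a1 - n%:~R / 2 + m%:~R) / a1) ^+ 2)) * expR (- (pi * (t2 + n%:~R / a3) ^+ 2))) *
   cos (p + 2 * pi * (t2 * a3 + n%:~R) * (m2 / a3) + 2 * pi * (t1 * a1 - n%:~R / 2 + m%:~R) * (m1 / a1))) by ring.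
rewrite -invfM -expRD; congr (_ * (expR _ * cos _)).
  by move: (pi) => P; field; rewrite ?n1 ?n3.
by move: (pi) => P; field; rewrite ?n1 ?n3.
Qed.

End Poisson2.

(** * Cubic theta functions *)

Section Eisenstein.
Context {R : realType}.
Local Notation L := (int * int)%type.

(** The pair [(j, k)] is the Eisenstein integer [j + k zeta] with [zeta = exp (i pi / 3)]. [nz] is
    its norm, [thz] is multiplication by [sqrt(-3) = 2 zeta - 1], [omz] is multiplication by
    [omega = zeta^2], and [cls r] parametrizes the residue class of [r] modulo [sqrt(-3)]. *)
Definition nz (x : L) : int := x.1 ^+ 2 + x.1 * x.2 + x.2 ^+ 2.
Definition thz (x : L) : L := (- x.1 - 2 * x.2, 2 * x.1 + x.2).
Definition omz (x : L) : L := (- x.1 - x.2, x.1).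
Definition cls (r : int) (v : L) : L := ((r : int), 0) + thz v.

Lemma inj_surj_bij (T T' : Type) (e : T -> T') : injective e ->
  (forall y, exists x, e x = y) -> bijective e.
Proof.
move=> ie /boolp.choice[g eg]; exists g => // x; exact/ie/eg.
Qed.

(** Residues are kept as the integers 0, 1, 2, so that classes can be handled by integer arithmetic,
    and are packed into ['I_3] only here. *)
Lemma rsum_ord3 (T T' : choiceType) (e : int -> T' -> T) (f : T -> R) :
  (forall c c' t t', 0 <= c < 3 -> 0 <= c' < 3 -> e c t = e c' t' -> c = c' /\ t = t') ->
  (forall y, exists c t, 0 <= c < 3 /\ e c t = y) ->
  summ f -> [/\ summ (f \o e 0), summ (f \o e 1), summ (f \o e 2)
   & rsum f = rsum (f \o e 0) + rsum (f \o e 1) + rsum (f \o e 2)].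
Proof.
move=> ie se sf.
pose e' (p : 'I_3 * T') := e (Posz p.1) p.2.
have be : bijective e'.
  apply: inj_surj_bij.
    move=> [c t] [c' t'] /ie[||]; rewrite /= ?ltz_nat ?ltn_ord //.
    by move=> [/val_inj -> ->].
  move=> y; have [c [t [c03 <-]]] := se y.
  case: c c03 => // c c3; rewrite ltz_nat in c3.
  by exists (Ordinal c3, t).
have sfe : summ (f \o e') by apply/(summ_reindex f be).
have s c : summ (fun t => f (e' (c, t))) by exact: (summ_pair1 c sfe).
split.
- exact: (s (@Ordinal 3 0 isT)).
- exact: (s (@Ordinal 3 1 isT)).
- exact: (s (@Ordinal 3 2 isT)).
rewrite (rsum_reindex f be) rsum_pair//.
have nin (g : 'I_3 -> R) i : i \notin index_enum 'I_3 -> g i = 0 by rewrite mem_index_enum.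
have [_ ->] := @rsum_finite R _ (index_enum 'I_3) (fun i => rsum (fun j => f (e' (i, j)))) (index_enum_uniq _) (nin _).
by rewrite !big_ord_recl big_ord0 addr0 addrA; do !congr (_ + _).
Qed.

Lemma cls_inj (c c' : int) (t t' : L) : 0 <= c < 3 -> 0 <= c' < 3 ->
  cls c t = cls c' t' -> c = c' /\ t = t'.
Proof.
case: t t' => t1 t2 [t1' t2'] h h' []; rewrite /= => e1 e2.
have : c = c' by lia.
by move=> cc; split=> //; congr (_, _); lia.
Qed.

Lemma cls_surj (y : L) : exists c t, 0 <= c < 3 /\ cls c t = y.
Proof.
case: y => j k.
have := divz_eq (j - k) 3; have := modz_ge0 (j - k) (d := 3) isT; have := ltz_pmod (j - k) (d := 3) isT.
set m := (_ %% _)%Z; set d := (_ %/ _)%Z => m3 m0 E.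
exists m, (d + k, k - 2 * (d + k)); split; first by rewrite m0.
by rewrite /cls /thz /=; congr (_, _) => /=; lia.
Qed.

Lemma norm_nz (x : L) : (`|x.1|%:~R + `|x.2|%:~R : R) <= 4 * (nz x)%:~R.
Proof.
rewrite -intrD -[4]/(4%:~R) -intrM ler_int /nz.
case: x => j k /=; have h1 : `|j| <= j ^+ 2 by nia.
nia.
Qed.

Lemma thz_inj : injective thz.
Proof. by move=> [a b] [c d] []; rewrite /= => e1 e2; congr (_, _); lia. Qed.

Lemma summ_inj (T T' : choiceType) (e : T' -> T) (f : T -> R) : injective e ->
  summ f -> summ (f \o e).
Proof.
move=> ie; rewrite /summ => sf; apply: le_lt_trans sf.
rewrite -(esum_image [set: T'] e (fun i => `|f i|%:E)); last by move=> x y _ _ /ie.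
rewrite esum_mkcond; apply: le_esum => i _; case: ifP => // _.
Qed.

Lemma cls_injv r : injective (cls r).
Proof. by move=> x y; rewrite /cls => /addrI /thz_inj. Qed.

Lemma bij_addl (x : L) : bijective (fun v : L => x + v).
Proof. by exists (fun v => v - x) => v; rewrite ?addrK ?(addrC x) ?subrK ?addrK. Qed.

Lemma bij_omz (x : L) : bijective (fun v : L => x + omz v).
Proof.
exists (fun v : L => omz (omz (v - x))) => -[v1 v2].
  by case: x => x1 x2; rewrite /omz /=; congr (_, _) => /=; lia.
by case: x => x1 x2; rewrite /omz /=; congr (_, _) => /=; lia.
Qed.

Lemma bij_oppl (x : L) : bijective (fun v : L => x - v).
Proof. by exists (fun v : L => x - v) => v; rewrite opprB addrC subrK. Qed.

(** The inverse of the Fourier transform of order three. For a triple [(x0, x1, x2)] in the image,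
    [x0 + x1 + x2], [x0 + omega x1 + omega^2 x2] and [x0 + omega^2 x1 + omega x2] are [cls c w0],
    [cls c w1] and [cls c (thz v - w0 - w1)]. Parseval's identity for these is [qz3_cubemap]. *)
Definition cubemap (c : int) (p : L * L * L) : L * L * L :=
  let: (w0, w1, v) := p in
  ((c, 0) - v, - omz (omz w0) + w1 - omz v, omz w0 - w1 - omz (omz v)).

Lemma cubemap_inj c c' t t' : 0 <= c < 3 -> 0 <= c' < 3 ->
  cubemap c t = cubemap c' t' -> c = c' /\ t = t'.
Proof.
case: t t' => [[[a1 a2] [b1 b2]] [v1 v2]] [[[a1' a2'] [b1' b2']] [v1' v2']] h h'.
rewrite /cubemap /omz => -[] /= e1 e2 e3 e4 e5 e6.
have cc : c = c' by lia.
have v1E : v1 = v1' by lia.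
have v2E : v2 = v2' by lia.
have a1E : a1 = a1' by lia.
have a2E : a2 = a2' by lia.
have b1E : b1 = b1' by lia.
have b2E : b2 = b2' by lia.
by rewrite cc v1E v2E a1E a2E b1E b2E.
Qed.

Lemma cubemap_surj (y : L * L * L) : exists c t, 0 <= c < 3 /\ cubemap c t = y.
Proof.
case: y => [[x0 x1] x2].
(* The sum of the entries determines [c] and [w0], and the first entry then determines [v]. *)
have [c [w0 [c3 e]]] := cls_surj (x0 + x1 + x2).
pose v := (c, 0) - x0.
exists c, (w0, x1 + omz (omz w0) + omz v, v); split=> //.
move: e; rewrite /cubemap /v /cls /thz /omz.
case: x0 x1 x2 w0 {v} => [x01 x02] [x11 x12] [x21 x22] [w1 w2] [] /= e1 e2.
by congr (_, _, _); congr (_, _) => /=; lia.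
Qed.

Variable kp : R.
Hypothesis kp0 : 0 < kp.

Definition qz (x : L) : R := expR (- (kp * (nz x)%:~R)).

Lemma summ_qz : summ qz.
Proof.
apply: (@summ_expR2 R (kp / 4) 0); first by rewrite divr_gt0.
move=> x; rewrite addr0 -mulrA ler_wpM2l ?(ltW kp0)//.
by have := norm_nz x; lra.
Qed.

Lemma qz_omz x : qz (omz x) = qz x.
Proof. by rewrite /qz /nz /omz /=; congr (expR (- (_ * _%:~R))); ring. Qed.

Lemma qzN x : qz (- x) = qz x.
Proof. by rewrite /qz /nz /=; congr (expR (- (_ * _%:~R))); ring. Qed.

(** [cls c (cls r v)] runs through the class of [c + sqrt(-3) r] modulo 3, so these are the theta
    sums of the nine classes modulo 3. *)
Definition Tcr (c r : int) : R := rsum (fun v : L => qz (cls c (cls r v))).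

Lemma summ_cc c r : summ (fun v : L => qz (cls c (cls r v))).
Proof.
apply: (@summ_inj _ _ (fun v => cls c (cls r v)) qz _ summ_qz).
by move=> x y /cls_injv /cls_injv.
Qed.

Lemma Tcr_period c r : Tcr c (r + 3) = Tcr c r.
Proof.
rewrite /Tcr (rsum_reindex _ (bij_addl (-1, 2))).
apply: eq_rsum => -[v1 v2]; rewrite /qz /nz /cls /thz /=.
by congr (expR (- (_ * _%:~R))); ring.
Qed.

(** Multiplication by [omega] preserves the norm, and modulo 3 it takes [c + sqrt(-3) r] to
    [c + sqrt(-3) (r - c)]. For [c = 1] this makes the three sums equal. *)
Lemma Tcr_rot c r : Tcr c r = Tcr c (r - c).
Proof.
rewrite /Tcr [RHS](rsum_reindex _ (bij_omz (c, - c + r))).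
apply: eq_rsum => v; rewrite -qz_omz; case: v => v1 v2.
by rewrite /qz /nz /cls /thz /omz /=; congr (expR (- (_ * _%:~R))); ring.
Qed.

Definition Uc (c : int) : R :=
  rsum (fun p : L * L * L => qz (cls c p.1.1) * qz (cls c p.1.2)
    * qz (cls c (thz p.2 - p.1.1 - p.1.2))).

Definition qz3 (x : L) : R := expR (- (3 * kp * (nz x)%:~R)).

Lemma qz3E x : qz3 x = qz (thz x).
Proof. by rewrite /qz3 /qz -mulrA mulrCA -[3]/(3%:~R) -intrM /nz /thz /=; congr (expR (- (_ * _%:~R))); ring. Qed.

Lemma summ_qz3 : summ qz3.
Proof.
apply: eq_summ (summ_inj thz_inj summ_qz) => x; by rewrite /= qz3E.
Qed.

Lemma qz3_cubemap c p : qz3 (cubemap c p).1.1 * qz3 (cubemap c p).1.2 * qz3 (cubemap c p).2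
  = qz (cls c p.1.1) * qz (cls c p.1.2) * qz (cls c (thz p.2 - p.1.1 - p.1.2)).
Proof.
case: p => [[[a1 a2] [b1 b2]] [v1 v2]]; rewrite !qz3E /qz -!expRD -!opprD -!mulrDr -!intrD.
by rewrite /nz /thz /cls /omz /=; congr (expR (- (_ * _%:~R))); ring.
Qed.

Definition aa : R := rsum qz3.

Lemma summ_cube (f g h : L -> R) : summ f -> summ g -> summ h ->
  summ (fun p : L * L * L => f p.1.1 * g p.1.2 * h p.2).
Proof. by move=> sf sg sh; exact: (summM (summM sf sg) sh). Qed.

Lemma rsum_cube (f g h : L -> R) : summ f -> summ g -> summ h ->
  rsum (fun p : L * L * L => f p.1.1 * g p.1.2 * h p.2) = rsum f * rsum g * rsum h.
Proof. by move=> sf sg sh; rewrite (rsumM (summM sf sg) sh) rsumM. Qed.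

Lemma aa_cube : aa ^+ 3 = Uc 0 + Uc 1 + Uc 2 /\
  (forall c, 0 <= c < 3 -> summ (fun p : L * L * L => qz (cls c p.1.1) * qz (cls c p.1.2)
    * qz (cls c (thz p.2 - p.1.1 - p.1.2)))).
Proof.
have s := summ_cube summ_qz3 summ_qz3 summ_qz3.
have [s0 s1 s2 e] := rsum_ord3 cubemap_inj cubemap_surj s.
split.
  have -> : aa ^+ 3 = aa * aa * aa by rewrite exprS expr2 mulrA.
  apply: etrans (esym (rsum_cube summ_qz3 summ_qz3 summ_qz3)) _; apply: etrans e _.
  have h c : rsum ((fun p : L * L * L => qz3 p.1.1 * qz3 p.1.2 * qz3 p.2) \o cubemap c) = Uc c.
    by apply: eq_rsum => p; exact: qz3_cubemap.
  by rewrite (h 0) (h 1) (h 2).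
move=> c c3; have s' := @summ_inj _ _ (cubemap c) _ _ s.
apply: eq_summ (s' _) => [p|]; first by rewrite /= qz3_cubemap.
by move=> t t' /(cubemap_inj c3 c3)[].
Qed.

(** Fixing the classes of the first two arguments modulo [sqrt(-3)] forces the third into the class
    of [- r0 - r1]; a shear of the summation variable then makes the three arguments independent. *)
Lemma Uc_fix c (r0 r1 : int) :
  rsum (fun p : L * L * L => qz (cls c (cls r0 p.1.1)) * qz (cls c (cls r1 p.1.2))
    * qz (cls c (thz p.2 - cls r0 p.1.1 - cls r1 p.1.2))) =
  Tcr c r0 * Tcr c r1 * Tcr c (- r0 - r1).
Proof.
rewrite /Tcr -rsum_cube; try exact: summ_cc.
have b : bijective (fun p : L * L * L => (p.1.1, p.1.2, p.2 - p.1.1 - p.1.2)).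
  exists (fun p : L * L * L => (p.1.1, p.1.2, p.2 + p.1.1 + p.1.2)) => -[[[a1 a2] [b1 b2]] [v1 v2]];
  by congr (_, _, _); congr (_, _) => /=; lia.
rewrite [RHS](rsum_reindex _ b); apply: eq_rsum => -[[[a1 a2] [b1 b2]] [v1 v2]].
congr (_ * _); rewrite /qz /nz /cls /thz /=; congr (expR (- (_ * _%:~R))); ring.
Qed.

Lemma UcE c : 0 <= c < 3 -> Uc c =
  (Tcr c 0 * Tcr c 0 * Tcr c 0 + Tcr c 0 * Tcr c 1 * Tcr c 2 + Tcr c 0 * Tcr c 2 * Tcr c 1)
  + (Tcr c 1 * Tcr c 0 * Tcr c 2 + Tcr c 1 * Tcr c 1 * Tcr c 1 + Tcr c 1 * Tcr c 2 * Tcr c 0)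
  + (Tcr c 2 * Tcr c 0 * Tcr c 1 + Tcr c 2 * Tcr c 1 * Tcr c 0 + Tcr c 2 * Tcr c 2 * Tcr c 2).
Proof.
move=> c3; pose e (r : int) (p : L * L * L) : L * L * L := (cls r p.1.1, p.1.2, p.2).
pose e' (r : int) (p : L * L * L) : L * L * L := (p.1.1, cls r p.1.2, p.2).
have ei r r' t t' : 0 <= r < 3 -> 0 <= r' < 3 -> e r t = e r' t' -> r = r' /\ t = t'.
  move=> h h' E; have [|-> e1] := @cls_inj r r' t.1.1 t'.1.1 h h'; first exact: (congr1 (fun p => p.1.1) E).
  have e2 := congr1 (fun p => p.1.2) E; have e3 := congr1 snd E.
  by split=> //; case: t t' {E} e1 e2 e3 => [[a b] v] [[a' b'] v'] /= -> -> ->.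
have es y : exists r t, 0 <= r < 3 /\ e r t = y.
  by case: y => [[a b] v]; have [r [t [r3 <-]]] := cls_surj a; exists r, (t, b, v).
have ei' r r' t t' : 0 <= r < 3 -> 0 <= r' < 3 -> e' r t = e' r' t' -> r = r' /\ t = t'.
  move=> h h' E; have [|-> e1] := @cls_inj r r' t.1.2 t'.1.2 h h'; first exact: (congr1 (fun p => p.1.2) E).
  have e2 := congr1 (fun p => p.1.1) E; have e3 := congr1 snd E.
  by split=> //; case: t t' {E} e1 e2 e3 => [[a b] v] [[a' b'] v'] /= -> -> ->.
have es' y : exists r t, 0 <= r < 3 /\ e' r t = y.
  by case: y => [[a b] v]; have [r [t [r3 <-]]] := cls_surj b; exists r, (a, t, v).
rewrite /Uc; have [s0 s1 s2 ->] := rsum_ord3 ei es (aa_cube.2 c c3).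
have [_ _ _ ->] := rsum_ord3 ei' es' s0.
have [_ _ _ ->] := rsum_ord3 ei' es' s1.
have [_ _ _ ->] := rsum_ord3 ei' es' s2.
have per r : Tcr c (r - 3) = Tcr c r by rewrite -(Tcr_period c (r - 3)) subrK.
have F r0 r1 r2 x : - r0 - r1 = x -> Tcr c x = Tcr c r2 -> rsum (fun p : L * L * L =>
    qz (cls c (cls r0 p.1.1)) * qz (cls c (cls r1 p.1.2)) * qz (cls c (thz p.2 - cls r0 p.1.1 - cls r1 p.1.2))) =
    Tcr c r0 * Tcr c r1 * Tcr c r2 by move=> <- <-; exact: Uc_fix.
have p1 : Tcr c (- 1) = Tcr c 2 by exact: (per 2).
have p2 : Tcr c (- 2) = Tcr c 1 by exact: (per 1).
have p3 : Tcr c (- 3) = Tcr c 0 by exact: (per 0).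
have p4 : Tcr c (- 4) = Tcr c 2 by apply: etrans p1; exact: (per (- 1)).
congr (_ + _ + _ + (_ + _ + _) + (_ + _ + _)).
- exact: (F 0 0 0 0 erefl erefl).
- exact: (F 0 1 2 (- 1) erefl p1).
- exact: (F 0 2 1 (- 2) erefl p2).
- exact: (F 1 0 2 (- 1) erefl p1).
- exact: (F 1 1 1 (- 2) erefl p2).
- exact: (F 1 2 0 (- 3) erefl p3).
- exact: (F 2 0 1 (- 2) erefl p2).
- exact: (F 2 1 0 (- 3) erefl p3).
- exact: (F 2 2 2 (- 4) erefl p4).
Qed.

Lemma Tcr_neg c r : Tcr (- c) r = Tcr c (- r).
Proof.
rewrite /Tcr [RHS](rsum_reindex _ (bij_oppl 0)).
apply: eq_rsum => -[v1 v2]; rewrite -qzN sub0r; congr qz; rewrite /cls /thz /=.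
by congr (_, _) => /=; lia.
Qed.

Lemma Tcr_periodc c r : Tcr (c + 3) r = Tcr c r.
Proof.
rewrite /Tcr [RHS](rsum_reindex _ (bij_addl (-1, 0))).
apply: eq_rsum => -[v1 v2]; congr qz; rewrite /cls /thz /=.
by congr (_, _) => /=; lia.
Qed.

(** With nome [q = exp (- 3 kp)], [aa] is Borwein's [a(q)], [s0 - s1] is [b(q)] and [cc] is [c(q)].
    The translated lattice of [c(q)] is multiplied by [sqrt(-3)] to stay among Eisenstein integers,
    which is why [cc] uses [qz] in place of [qz3]. *)
Definition s0 : R := rsum (fun v : L => qz3 (thz v)).
Definition s1 : R := rsum (fun v : L => qz3 (cls 1 v)).
Definition cc : R := rsum (fun w : L => qz (cls 1 w)).

Lemma T0 r : Tcr 0 r = rsum (fun v : L => qz3 (cls r v)).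
Proof.
apply: eq_rsum => v; rewrite qz3E; congr qz; rewrite [in LHS]/cls.
by case: (thz _) => a b; congr (_, _); rewrite /= add0r.
Qed.

Lemma T0_0 : Tcr 0 0 = s0.
Proof.
rewrite T0; apply: eq_rsum => v; congr qz3; rewrite /cls.
by case: (thz _) => a b; congr (_, _); rewrite /= add0r.
Qed.

Lemma T0_1 : Tcr 0 1 = s1. Proof. exact: T0. Qed.

Lemma T0_2 : Tcr 0 2 = s1.
Proof. by rewrite -T0_1 -(Tcr_neg 0 (-1)) oppr0 -(Tcr_period _ (-1)). Qed.

Lemma T1_all r : Tcr 1 r = Tcr 1 0.
Proof.
elim/int_ind: r => [|n IH|n IH]; first reflexivity.
  refine (eq_trans (eq_trans (Tcr_rot 1 (n.+1)%:Z) _) IH).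
  by have -> : (n.+1)%:Z - 1 = n%:Z by rewrite intS addrC addrA addNr add0r.
refine (eq_trans (eq_trans _ (esym (Tcr_rot 1 (- n%:Z)))) IH).
by have -> : - (n.+1)%:Z = - n%:Z - 1 by rewrite intS opprD addrC.
Qed.

Lemma ccE : cc = 3 * Tcr 1 0.
Proof.
have [_ _ _ e] := rsum_ord3 cls_inj cls_surj (@summ_inj _ _ (cls 1) qz (@cls_injv 1) summ_qz).
rewrite /cc [LHS]e -[X in X + _ + _]/(Tcr 1 0) -[X in _ + X + _]/(Tcr 1 1) -[X in _ + X]/(Tcr 1 2).
by rewrite (T1_all 1) (T1_all 2); ring.
Qed.

Lemma U1E : Uc 1 = cc ^+ 3 / 3.
Proof. by rewrite UcE// (T1_all 1) (T1_all 2) ccE; field. Qed.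

Lemma U2E : Uc 2 = cc ^+ 3 / 3.
Proof.
have H r : Tcr 2 r = Tcr 1 0.
  by rewrite -(T1_all (- r)) -Tcr_neg -(Tcr_periodc (- 1)).
by rewrite UcE// !H ccE; field.
Qed.

Lemma summ_qz3_cls r : summ (fun v : L => qz3 (cls r v)).
Proof. exact: (@summ_inj _ _ (cls r) _ (@cls_injv r) summ_qz3). Qed.

Lemma s2E : rsum (fun v : L => qz3 (cls 2 v)) = s1.
Proof. by rewrite -T0 T0_2. Qed.

Lemma s0E : rsum (fun v : L => qz3 (cls 0 v)) = s0.
Proof. by rewrite -T0 T0_0. Qed.

Lemma aaE : aa = s0 + 2 * s1.
Proof.
have [_ _ _ e] := rsum_ord3 cls_inj cls_surj summ_qz3.
apply: (etrans e); rewrite (s0E : rsum (qz3 \o cls 0) = s0).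
by rewrite (s2E : rsum (qz3 \o cls 2) = s1) /s1; ring.
Qed.

(* Borwein's cubic theta identity, by Chapman's lattice argument: the unitary matrix
   [(omega^(ij))_(i,j) / sqrt(-3)] maps [(sqrt(-3) Z[omega])^3] onto the lattice of
   triples whose entries agree modulo [sqrt(-3)] and whose sum is divisible by [3]. *)
Theorem borwein_cubic : aa ^+ 3 = (s0 - s1) ^+ 3 + cc ^+ 3.
Proof.
have [e _] := aa_cube.
have e0 : Uc 0 = s0 ^+ 3 + 6 * s0 * s1 ^+ 2 + 2 * s1 ^+ 3.
  by rewrite UcE// T0_0 T0_1 T0_2; ring.
move: e; rewrite e0 U1E U2E aaE => e; lra.
Qed.

Lemma s0_gt0 : 0 < aa.
Proof.
apply: (@lt_le_trans _ _ (\sum_(x <- [:: (0, 0) : L]) qz3 x)).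
  by rewrite big_seq1 expR_gt0.
by apply: ler_sum_rsum => //; [exact: summ_qz3|move=> i; exact: expR_ge0].
Qed.

End Eisenstein.

(** * The cubic theta functions at the self-dual nome *)

Section SelfDual.
Context {R : realType}.
Local Notation L := (int * int)%type.

(* the nome of the hexagonal lattice of covolume 1 is [Q = exp (- 3 * kappa)] *)
Definition kappa : R := 2 * pi / (3 * Num.sqrt 3).

Lemma sqrt3_gt0 : 0 < Num.sqrt 3 :> R. Proof. by rewrite sqrtr_gt0. Qed.

Lemma kappa_gt0 : 0 < kappa.
Proof. by rewrite divr_gt0 ?mulr_gt0 ?pi_gt0 ?sqrt3_gt0. Qed.

Definition fr3 : R := 3 `^ 4^-1.

Lemma fr3_gt0 : 0 < fr3. Proof. by rewrite powR_gt0. Qed.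

Lemma fr3_sqr : fr3 ^+ 2 = Num.sqrt 3.
Proof.
rewrite -powR12_sqrt// /fr3 -powR_mulrn ?powR_ge0// -powRrM; congr (_ `^ _).
by field.
Qed.

(** The real part of the character of order three, trivial exactly on the multiples of [sqrt(-3)]
    because [zeta = -1] modulo [sqrt(-3)]. The imaginary part drops out of sums against the even
    weight [qz3]. *)
Definition chi (x : L) : R := cos (2 * pi * ((x.1 - x.2)%:~R / 3)).

Lemma cos_third : cos (2 * pi * (1 / 3)) = - 2^-1 :> R.
Proof.
set c := cos _.
have e : cos (2 * pi * (1 / 3) *+ 2) = c.
  rewrite -[RHS]cosN -(cosD2piz (- (2 * pi * (1 / 3))) 1); congr cos.
  by rewrite -mulr_natr; field.
have : (2 * c + 1) * (c - 1) = 0.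
  by move: e; rewrite cos_mulr2n -/c -mulr_natr; lra.
move=> /eqP; rewrite mulf_eq0 => /orP[/eqP h|/eqP h]; first lra.
have p0 : (0 : R) < pi by exact: pi_gt0.
have : c < cos 0.
  have i1 : 2 * pi * (1 / 3) \in `[0, pi : R] by rewrite in_itv/=; apply/andP; split; nra.
  have i0 : (0 : R) \in `[0, pi] by rewrite in_itv/= lexx (ltW p0).
  by rewrite ltr_cos//; nra.
rewrite cos0; lra.
Qed.

Lemma chi_cls0 v : chi (cls 0 v) = 1.
Proof.
rewrite /chi /cls /thz /= (_ : _ - _ = 3 * (- v.1 - v.2)); last by ring.
rewrite intrM -[RHS]cos0 -(cosD2piz 0 (- v.1 - v.2)); congr cos.
by move: ((- v.1 - v.2)%:~R) => z; field.
Qed.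

Lemma chi_cls1 v : chi (cls 1 v) = - 2^-1.
Proof.
rewrite /chi /cls /thz /= (_ : _ - _ = 1 + 3 * (- v.1 - v.2)); last by ring.
rewrite intrD intrM -cos_third -(cosD2piz (2 * pi * (1 / 3)) (- v.1 - v.2)); congr cos.
by move: ((- v.1 - v.2)%:~R) => z; field.
Qed.

Lemma chi_cls2 v : chi (cls 2 v) = - 2^-1.
Proof.
rewrite /chi /cls /thz /= (_ : 2 + (- v.1 - 2 * v.2) - (0 + (2 * v.1 + v.2)) = - (1 + 3 * (v.1 + v.2 - 1))); last by lia.
rewrite intrN intrD intrM mulNr mulrN cosN -cos_third -(cosD2piz (2 * pi * (1 / 3)) (v.1 + v.2 - 1)).
by congr cos; move: ((v.1 + v.2 - 1)%:~R) => z; field.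
Qed.

Lemma chi_abs x : `|chi x| <= 1. Proof. exact: cos_max. Qed.

Definition av : R := aa kappa.
Definition bv : R := s0 kappa - s1 kappa.

Lemma bvE : rsum (fun x : L => chi x * qz3 kappa x) = bv.
Proof.
have s : summ (fun x : L => chi x * qz3 kappa x).
  apply: summ_le (summ_qz3 kappa_gt0) => x; rewrite normrM (@ger0_norm _ (qz3 _ _)) ?expR_ge0//.
  by rewrite ler_piMl ?expR_ge0 ?chi_abs.
have [_ _ _ ->] := rsum_ord3 cls_inj cls_surj s.
have e0 : rsum ((fun x : L => chi x * qz3 kappa x) \o cls 0) = s0 kappa.
  by rewrite -s0E; apply: eq_rsum => v /=; rewrite chi_cls0 mul1r.
have e1 : rsum ((fun x : L => chi x * qz3 kappa x) \o cls 1) = - 2^-1 * s1 kappa.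
  rewrite /s1 -rsumZ; last exact: (summ_qz3_cls kappa_gt0).
  by apply: eq_rsum => v /=; rewrite chi_cls1.
have e2 : rsum ((fun x : L => chi x * qz3 kappa x) \o cls 2) = - 2^-1 * s1 kappa.
rewrite -(s2E kappa_gt0) -rsumZ; last exact: (summ_qz3_cls kappa_gt0).
  by apply: eq_rsum => v /=; rewrite chi_cls2.
by rewrite e0 e1 e2 /bv; field.
Qed.

(** Poisson summation turns the character into a translation of the dual lattice. The hexagonal
    lattice of covolume 1 is a rotation of its dual, and the translate is a scaled isometric copy of
    [1 + sqrt(-3) Z[omega]]. *)
Lemma bv_eq_cc : bv = cc kappa.
Proof.
pose r2 : R := Num.sqrt 2.
have r20 : 0 < r2 by rewrite sqrtr_gt0.
have r22 : r2 ^+ 2 = 2 by rewrite sqr_sqrtr.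
pose a1 := fr3 / r2; pose a3 := r2 / fr3.
have f0 := fr3_gt0; have f2 := fr3_sqr.
have a10 : 0 < a1 by rewrite divr_gt0.
have a30 : 0 < a3 by rewrite divr_gt0.
have nf : fr3 != 0 by rewrite lt0r_neq0.
have nr : r2 != 0 by rewrite lt0r_neq0.
have a13 : a1 * a3 = 1 by rewrite /a1 /a3; field; rewrite nf nr.
have t0 := sqrt3_gt0; have t2 : Num.sqrt 3 ^+ 2 = 3 :> R by rewrite sqr_sqrtr.
set T := Num.sqrt 3 in f2 t0 t2.
have nt : T != 0 by rewrite lt0r_neq0.
have a1s : a1 ^+ 2 = T / 2 by rewrite /a1 exprMn exprVn r22 f2.
have a3s : a3 ^+ 2 = 2 / T by rewrite /a3 exprMn exprVn r22 f2.
clearbody a1 a3.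
(* The frequency [(t1, t2)] pairs with the lattice point of index [(k, l)] to
   [k / 2 - (l + k / 2) / 3 = (k - l) / 3], the phase of [chi]. *)
have H := @poisson2 R a1 a3 0 0 (2^-1 / a1) (- 3^-1 / a3) 0 a10 a30.
rewrite a13 invr1 mul1r in H.
rewrite -bvE; apply: etrans (etrans _ H) _.
  apply: eq_rsum => -[k l] /=; rewrite mulrC; congr (expR _ * cos _).
    rewrite !subr0 !exprMn a1s a3s /kappa -/T /nz /= !intrD rmorphM !rmorphXn /=.
    have -> : 3 * (2 * pi / (3 * T)) = pi * (2 / T) by move: (pi) => P; field; rewrite nt.
    have -> : T / 2 = 2 / T * (3 / 4) by rewrite -[in RHS]t2; field; rewrite nt.
    by move: (2 / T) (pi) => z P; field.
  rewrite add0r; congr (_ * _); rewrite intrB.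
  rewrite (_ : 2^-1 / a1 * (a1 * k%:~R) = 2^-1 * k%:~R); last by rewrite mulrA divfK// lt0r_neq0.
  rewrite (_ : - 3^-1 / a3 * (a3 * (l%:~R + 2^-1 * k%:~R)) = - 3^-1 * (l%:~R + 2^-1 * k%:~R)); last by rewrite mulrA divfK// lt0r_neq0.
  by move: (k%:~R) (l%:~R) => K LL; field.
have b : bijective (fun n : L => (n.1 - n.2 - 1, 1 - n.1)).
  by exists (fun w : L => (1 - w.2, - w.1 - w.2)) => -[x y] /=; congr (_, _); lia.
rewrite /cc [RHS](rsum_reindex _ b); apply: eq_rsum => -[n m] /=.
rewrite !mulr0 addr0 mulr0 addr0 cos0 mulr1 /qz; congr expR.
rewrite -!mulrDl !exprMn !exprVn a1s a3s /kappa -/T /nz /cls /thz /=.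
have -> : (2 / T)^-1 = 2 / T * (3 / 4) by rewrite -t2; field; rewrite nt.
have -> : (T / 2)^-1 = 2 / T by rewrite invf_div.
have -> : 2 * pi / (3 * T) = pi * (2 / T) / 3 by move: (pi) => P; field; rewrite nt.
rewrite !expr2 !(intrD, intrB, intrN, intrM).
by move: (2 / T) (pi) (n%:~R) (m%:~R) => z P nn mm; field.
Qed.

Lemma av_gt0 : 0 < av. Proof. exact: (s0_gt0 kappa_gt0). Qed.

Lemma av_cube : av ^+ 3 = 2 * bv ^+ 3.
Proof. by rewrite /av (borwein_cubic kappa_gt0) -/bv -bv_eq_cc; ring. Qed.

Lemma bv_gt0 : 0 < bv.
Proof.
have h : 0 < bv ^+ 3 by have := av_cube; have : 0 < av ^+ 3 := exprn_gt0 _ av_gt0; lra.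
by rewrite ltNge; apply/negP => b0; move: h; rewrite ltNge => /negP; apply; rewrite exprn_odd_le0.
Qed.

Theorem av_over_bv : av / bv = 2 `^ 3^-1.
Proof.
have b0 := bv_gt0; have a0 := av_gt0.
have h : (av / bv) ^+ 3 = 2.
  by rewrite exprMn exprVn av_cube mulfK// expf_neq0// lt0r_neq0.
rewrite -h -powR_mulrn ?divr_ge0 ?ltW// -powRrM divff// powRr1// divr_ge0// ltW//.
Qed.

End SelfDual.

(** * Extremal characters for the theta weights *)

Section Numeric.
Context {R : realType}.

Lemma sin_le (x : R) : 0 < x -> sin x <= x.
Proof.
move=> x0; have [|y _] := @MVT _ (@sin R) (@cos R) 0 x x0 (fun y _ => is_derive_sin y).
  by apply: continuous_subspaceT; exact: continuous_sin.
rewrite sin0 !subr0 => ->; by rewrite ler_piMl ?cos_le1// ltW.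
Qed.

(** From [sin (pi / 6) = 1 / 2] and [sin x <= x]. *)
Lemma pi_ge3 : 3 <= pi :> R.
Proof.
have h : sin (pi / 6 : R) = 2^-1.
  have -> : pi / 6 = 2 * pi * (1 / 3) - pi / 2 :> R by move: (pi) => P; field.
  by rewrite sinBpihalf cos_third opprK.
have p6 : (0 : R) < pi / 6 by rewrite divr_gt0// pi_gt0.
have := sin_le p6; rewrite h; lra.
Qed.

(** The nome is [exp (- 2 pi / sqrt 3)], about 0.027. With [pi >= 3] and [sqrt 3 <= 7 / 4] the
    exponent is at least 24/7 in absolute value, and 1/19 is accurate enough for [tail_sum]. *)
Lemma nome_small : expR (- (3 * kappa : R)) <= 19^-1.
Proof.
rewrite expRN lef_pV2 ?posrE ?expR_gt0//.
have t0 := @sqrt3_gt0 R; have t2 : Num.sqrt 3 ^+ 2 = 3 :> R by rewrite sqr_sqrtr.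
set T := Num.sqrt 3 in t0 t2.
have T1 : T <= 7 / 4.
  have : T ^+ 2 <= (7 / 4) ^+ 2 by rewrite t2; lra.
  by rewrite ler_sqr// nnegrE; lra.
have k1 : 24 / 7 <= 3 * kappa :> R.
  rewrite /kappa -/T (_ : 3 * (2 * pi / (3 * T)) = 2 * pi / T).
    by rewrite ler_pdivlMr//; have := pi_ge3; lra.
  by move: (pi) => P; field; rewrite lt0r_neq0.
apply: le_trans (_ : expR (24 / 7) <= _); last by rewrite ler_expR.
(* A sixteenth power by four squarings, starting from [1 + 3 / 14] and rounding down each time. *)
have -> : 24 / 7 = 16%:R * (3 / 14) :> R by field.
rewrite expRM_natl.
have h1 : 17 / 14 <= expR (3 / 14) :> R by have := expR_ge1Dx (3 / 14 : R); lra.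
have sq (a b z : R) : 0 <= a -> a <= z -> b <= a ^+ 2 -> b <= z ^+ 2.
  by move=> a0 az; move/le_trans; apply; rewrite ler_sqr// nnegrE (le_trans a0).
set z := expR _ in h1 *.
have h2 : 22 / 15 <= z ^+ 2 by apply: (sq (17 / 14)) => //; lra.
have h4 : 15 / 7 <= z ^+ 4 by rewrite (exprM z 2 2); apply: (sq (22 / 15)) => //; lra.
have h8 : 9 / 2 <= z ^+ 8 by rewrite (exprM z 4 2); apply: (sq (15 / 7)) => //; lra.
by rewrite (exprM z 8 2); apply: (sq (9 / 2)) => //; lra.
Qed.

End Numeric.

Section NormForm.
Local Notation L := (int * int)%type.

Lemma nz_ge0 (x : L) : 0 <= nz x.
Proof.
rewrite /nz; case: x => a b /=.
have := sqr_ge0 (2 * a + b); have := sqr_ge0 b; lia.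
Qed.

Lemma nz_thz (x : L) : nz (thz x) = 3 * nz x.
Proof. by rewrite /nz /thz; case: x => a b /=; ring. Qed.

Lemma nz_bound (x : L) : x.1 ^+ 2 + x.2 ^+ 2 <= 2 * nz x.
Proof. have := sqr_ge0 (x.1 + x.2); rewrite /nz; case: x => a b /=; lia. Qed.

End NormForm.

(** * Theta sums of positive definite functions on the hexagonal lattice *)

Section Certificate.
Context {R : realType}.
Local Notation L := (int * int)%type.
Local Notation kap := (@kappa R).
Local Notation q := (@qz3 R kap).

Variable c : L -> R.
Hypothesis ceven : forall x, c (- x) = c x.
Hypothesis cpsd : forall s : seq (R * L),
  0 <= \sum_(x <- s) \sum_(y <- s) x.1 * y.1 * c (x.2 - y.2).

(** Positive definiteness on four points is enough for every inequality below; fewer points are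
    handled by zero weights. *)
Lemma psd4 (a1 a2 a3 a4 : R) (x1 x2 x3 x4 : L) :
  0 <= (a1 ^+ 2 + a2 ^+ 2 + a3 ^+ 2 + a4 ^+ 2) * c 0
    + 2 * (a1 * a2 * c (x1 - x2) + a1 * a3 * c (x1 - x3) + a1 * a4 * c (x1 - x4)
         + a2 * a3 * c (x2 - x3) + a2 * a4 * c (x2 - x4) + a3 * a4 * c (x3 - x4)).
Proof.
have := cpsd [:: (a1, x1); (a2, x2); (a3, x3); (a4, x4)].
rewrite !big_cons !big_nil /= !subrr !addr0.
rewrite -(opprB x1 x2) -(opprB x1 x3) -(opprB x1 x4) -(opprB x2 x3) -(opprB x2 x4) -(opprB x3 x4) !ceven.
by move=> h; apply: le_trans h _; apply: le_of_eq; ring.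
Qed.

(** Think of [c (x - y)] as the inner product of vectors [e x] and [e y]. Then [d2 x] is the squared
    distance of [e x] and [e 0], and [En x] is the squared norm of [e 0 + e x + e (x + omz x)], the
    sum over an equilateral triangle. For [c = chi] the latter vanishes at [(1, 0)]: it measures the
    excess over the extremal character. *)
Definition d2 x := 2 * c 0 - 2 * c x.
Definition En (x : L) := 2 * (c x + c (omz x) + c (omz (omz x))) + 3 * c 0.

Lemma d2_ge0 x : 0 <= d2 x.
Proof.
have := psd4 1 (-1) 0 0 0 x 0 0.
rewrite !(mul0r, mulr0, addr0, expr0n, expr1n, mul1r, sub0r, ceven, sqrrN) /= /d2; lra.
Qed.

Lemma c_ub x : `|c x| <= c 0.
Proof.
have h1 := d2_ge0 x; rewrite /d2 in h1.
have := psd4 1 1 0 0 0 x 0 0.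
rewrite !(mul0r, mulr0, addr0, expr0n, expr1n, mul1r, sub0r, ceven, sqrrN) /= => h2.
by rewrite ler_norml; apply/andP; split; lra.
Qed.

(** The weighted triangle inequality [|a + b|^2 <= (1 + t) |a|^2 + (1 + 1/t) |b|^2], for the steps
    from 0 to [x] and from [x] to [x + y]. *)
Lemma d2_add (t : R) x y : 0 < t -> d2 (x + y) <= (1 + t) * d2 x + (1 + t^-1) * d2 y.
Proof.
move=> t0.
have := psd4 t (- t - 1) 1 0 0 x (x + y) 0.
rewrite !(mul0r, mulr0, addr0, expr0n, sub0r, ceven) /= opprD addNKr ceven => h.
have {}h : 0 <= t * ((1 + t) * d2 x + (1 + t^-1) * d2 y - d2 (x + y)).
  apply: le_trans h _; apply: le_of_eq; rewrite /d2.
  by rewrite /=; field; rewrite lt0r_neq0.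
by move: h; rewrite pmulr_rge0// subr_ge0.
Qed.

Definition smul (k : int) (x : L) : L := (k * x.1, k * x.2).

Lemma d2_mul x (k : int) : d2 (smul k x) <= k%:~R ^+ 2 * d2 x.
Proof.
have H (n : nat) : d2 (smul n x) <= n%:R ^+ 2 * d2 x.
  elim: n => [|n IH].
    by rewrite /smul !mul0r /d2 subrr expr0n mul0r.
  have -> : smul n.+1 x = x + smul n x.
    by case: x {IH} => a b; rewrite /smul intS !mulrDl !mul1r.
  have [->|n0] := posnP n; first by rewrite /smul !mul0r addr0 expr1n mul1r.
  have nR : (0 : R) < n%:R by rewrite ltr0n.
  (* With the weight [t = n] the recursion is exact: [(1 + n) + (1 + 1/n) n^2 = (n + 1)^2]. *)
  apply: le_trans (d2_add _ _ nR) _.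
  have h2 : (1 + n%:R^-1) * d2 (smul n x) <= (1 + n%:R^-1) * (n%:R ^+ 2 * d2 x).
    by rewrite ler_wpM2l// addr_ge0// invr_ge0 ltW.
  apply: (le_trans (lerD (lexx _) h2)).
  apply: le_of_eq; rewrite -natr1.
  by field; rewrite lt0r_neq0.
case: k => n; first exact: H.
have -> : smul (Negz n) x = - smul n.+1 x by rewrite /smul NegzE !mulNr.
by rewrite /d2 ceven NegzE mulrNz sqrrN; exact: H.
Qed.

Lemma omz3 x : omz (omz (omz x)) = x.
Proof. by case: x => a b; rewrite /omz /=; congr (_, _); ring. Qed.

Lemma En_om x : En (omz x) = En x.
Proof. by rewrite /En omz3; ring. Qed.

Lemma omzN x : omz (- x) = - omz x.
Proof. by case: x => a b; rewrite /omz /=; congr (_, _) => /=; ring. Qed.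

Lemma En_N x : En (- x) = En x.
Proof. by rewrite /En !omzN !ceven. Qed.

Lemma omz_sum x : x + omz x = - omz (omz x).
Proof. by case: x => a b; rewrite /omz /=; congr (_, _) => /=; ring. Qed.

Lemma En_ge0 x : 0 <= En x.
Proof.
have := psd4 1 1 1 0 0 x (x + omz x) 0.
rewrite !(mul0r, mulr0, addr0, expr0n, expr1n, mul1r, sub0r, ceven) /=.
rewrite opprD addNKr ceven omz_sum ceven /En; lra.
Qed.

(** The triangles on the two sides of the edge from 0 to [x] have vector sums [T] and [T'] of
    squared norm [En x], and [T - T'] joins their opposite vertices, which differ by [sqrt(-3) x] up
    to sign. The weights 2, 2, 1, 1 are those of [T + T']: by the parallelogram law,
    [|T - T'|^2 <= 2 |T|^2 + 2 |T'|^2]. *)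
Lemma d2_theta x : d2 (omz x - omz (omz x)) <= 4 * En x.
Proof.
have := psd4 2 2 1 1 0 x (- omz x) (- omz (omz x)).
rewrite !sub0r !opprK ceven.
have -> : x + omz x = - omz (omz x) by exact: omz_sum.
have -> : x + omz (omz x) = - omz x by case: (x) => a b; rewrite /omz /=; congr (_, _) => /=; ring.
have -> : - omz x + omz (omz x) = - (omz x - omz (omz x)) by rewrite opprB addrC.
rewrite !ceven /d2 /En; lra.
Qed.

(** [thz v] is an integral combination of two vectors of norm 3, each controlled by [d2_theta]. Thus
    all deviations on the sublattice are governed by the excess at the shortest vectors. *)
Lemma d2_thz (v : L) : d2 (thz v) <= 8 * ((v.1%:~R) ^+ 2 + (v.2%:~R) ^+ 2) * En (1, 0).
Proof.
pose t1 : L := thz (1, 0); pose t2 : L := thz (0, 1).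
have h1 : d2 t1 <= 4 * En (1, 0) by exact: (d2_theta (1, 0)).
have h2 : d2 t2 <= 4 * En (1, 0).
  by have := d2_theta (- omz (omz (1, 0))); rewrite En_N !En_om.
have -> : thz v = smul v.1 t1 + smul v.2 t2.
  by case: v => a b; rewrite /t1 /t2 /thz /smul /=; congr (_, _) => /=; lia.
have := d2_add (smul v.1 t1) (smul v.2 t2) ltr01; rewrite invr1.
have k1 := d2_mul t1 v.1; have k2 := d2_mul t2 v.2.
have s1 : 0 <= (v.1%:~R : R) ^+ 2 by exact: sqr_ge0.
have s2 : 0 <= (v.2%:~R : R) ^+ 2 by exact: sqr_ge0.
move=> h; apply: le_trans h _.
have m1 : v.1%:~R ^+ 2 * d2 t1 <= v.1%:~R ^+ 2 * (4 * En (1, 0)) by rewrite ler_wpM2l.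
have m2 : v.2%:~R ^+ 2 * d2 t2 <= v.2%:~R ^+ 2 * (4 * En (1, 0)) by rewrite ler_wpM2l.
lra.
Qed.

Let qpos x : 0 < q x. Proof. exact: expR_gt0. Qed.
Let sq : summ q. Proof. exact: summ_qz3 (@kappa_gt0 R). Qed.

Lemma summ_qc : summ (fun x => q x * c x).
Proof.
apply: summ_le (summZr (c 0) sq) => x.
by rewrite normrM (gtr0_norm (qpos x)) ler_wpM2l ?c_ub// ltW.
Qed.

Lemma cert_upper : rsum (fun x => q x * c x) <= @av R * c 0.
Proof.
rewrite /av /aa -rsumZr//; apply: ler_rsum; [exact: summ_qc|exact: summZr|].
move=> x; rewrite ler_wpM2l ?(ltW (qpos x))//.
by apply: le_trans (c_ub x); exact: ler_norm.
Qed.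

Lemma qzE x : q x = expR (- (3 * kap)) ^+ `|nz x|%N.
Proof.
rewrite -expRM_natl /qz3; congr expR; rewrite natr_absz ger0_norm ?nz_ge0//.
by rewrite mulrN [in RHS]mulrC.
Qed.

(** The term at 0 vanishes. Elsewhere the weight is [Q ^ (3 n)] with [n = nz v >= 1]; after one
    factor [Q] is set aside, at least [2 n] of them remain to outweigh the quadratic growth. *)
Lemma tail_sum :
  summ (fun v : L => q (thz v) * (4 * ((v.1%:~R : R) ^+ 2 + (v.2%:~R) ^+ 2))) /\
  rsum (fun v : L => q (thz v) * (4 * ((v.1%:~R : R) ^+ 2 + (v.2%:~R) ^+ 2)))
    <= expR (- (3 * kap)).
Proof.
pose Q := expR (- (3 * kap)).
have Q0 : 0 < Q by exact: expR_gt0.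
have Q1 : Q <= 19^-1 := nome_small.
(* The ratio must satisfy [2 / 19^2 <= w^4], to dominate the terms, and
   [2 w (1 + w) / (1 - w) <= 1], to keep the total below [Q]; 7/25 meets both. *)
pose w : R := 7 / 25.
have w01 : 0 <= w < 1 by rewrite /w; apply/andP; split; lra.
have [sg bg] := summ_geom w01.
have sg2 := summM sg sg.
have bound v : q (thz v) * (4 * ((v.1%:~R : R) ^+ 2 + (v.2%:~R) ^+ 2)) <=
   Q * (4 * w ^+ 2) * (w ^+ `|v.1|%N * w ^+ `|v.2|%N).
  rewrite qzE.
  pose n := `|nz v|%N.
  have nE : nz v = n.
    by rewrite /n gez0_abs// nz_ge0.
  have n3 : `|nz (thz v)|%N = (3 * n)%N by rewrite nz_thz nE abszM.
  have jk : v.1 ^+ 2 + v.2 ^+ 2 <= 2 * (n%:Z) by rewrite -nE nz_bound.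
  have jkR : (v.1%:~R : R) ^+ 2 + (v.2%:~R) ^+ 2 <= 2 * n%:R.
    by move: jk; rewrite -(ler_int R) intrD intrM !rmorphXn.
  rewrite n3.
  have [n0|n0] := posnP n.
    have : (v.1%:~R : R) ^+ 2 + (v.2%:~R) ^+ 2 <= 0 by rewrite n0 mulr0 in jkR.
    have := sqr_ge0 (v.1%:~R : R); have := sqr_ge0 (v.2%:~R : R) => s1 s2 s3.
    have -> : (v.1%:~R : R) ^+ 2 + (v.2%:~R) ^+ 2 = 0 by lra.
    case/andP: w01 => w0 _.
    by rewrite !mulr0 !mulr_ge0 ?exprn_ge0// ltW.
  have e1 : (2 * n <= 2 ^ n)%N.
    case: (n) n0 => // m _; rewrite expnS leq_pmul2l//.
    exact: ltn_expl.
  (* The exponent [4 n] of [w] pays for [|v.1| + |v.2|] and for the constant factor [w^2]. *)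
  have e2 : (`|v.1| + `|v.2| + 2 <= 4 * n)%N.
    have h1 : (Posz `|v.1|) <= v.1 ^+ 2 by rewrite abszE; nia.
    have h2 : (Posz `|v.2|) <= v.2 ^+ 2 by rewrite abszE; nia.
    move: jk h1 h2; set A := v.1 ^+ 2; set B := v.2 ^+ 2; lia.
  apply: (@le_trans _ _ (Q ^+ (3 * n) * (4 * (2 ^ n)%:R))).
    rewrite ler_wpM2l ?exprn_ge0 ?(ltW Q0)// ler_wpM2l//.
    by apply: le_trans jkR _; rewrite -natrM ler_nat.
  have -> : Q ^+ (3 * n) = Q * Q ^+ (3 * n).-1 by rewrite -exprS prednK// muln_gt0.
  apply: (@le_trans _ _ (Q * Q ^+ (2 * n) * (4 * (2 ^ n)%:R))).
    rewrite ler_wpM2r ?mulr_ge0// ler_wpM2l ?(ltW Q0)//.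
    by apply: ler_wiXn2l; [exact: ltW|lra|lia].
  have -> : Q * Q ^+ (2 * n) * (4 * (2 ^ n)%:R) = Q * (4 * (2 * Q ^+ 2) ^+ n).
    by rewrite natrX exprMn exprM; ring.
  rewrite -mulrA ler_wpM2l ?(ltW Q0)// -mulrA ler_wpM2l// -!exprD.
  apply: (@le_trans _ _ ((w ^+ 4) ^+ n)).
    rewrite lerXn2r ?nnegrE ?mulr_ge0 ?exprn_ge0 ?(ltW Q0)//; case/andP: w01 => //.
    have : Q ^+ 2 <= 19^-1 ^+ 2 by rewrite ler_sqr ?nnegrE ?(ltW Q0)//.
    rewrite /w; lra.
  by rewrite -exprM; apply: ler_wiXn2l; case/andP: w01 => ? /ltW //; lia.
have sB : summ (fun v : L => Q * (4 * w ^+ 2) * (w ^+ `|v.1|%N * w ^+ `|v.2|%N)) by exact: summZ.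
have s : summ (fun v : L => q (thz v) * (4 * ((v.1%:~R : R) ^+ 2 + (v.2%:~R) ^+ 2))).
  apply: summ_le sB => v; rewrite ger0_norm ?bound//.
  by rewrite !mulr_ge0 ?(ltW (qpos _))// addr_ge0// sqr_ge0.
split=> //; apply: le_trans (ler_rsum s sB bound) _.
rewrite rsumZ// (rsumM sg sg) -/Q -mulrA ler_piMr ?(ltW Q0)//.
have g0 : 0 <= rsum (fun k : int => w ^+ `|k|%N).
  by apply: rsum_ge0 => k; case/andP: w01 => w0 _; rewrite exprn_ge0.
set G := rsum _ in bg g0 *.
have wE : (1 + w) / (1 - w) = 16 / 9 by rewrite /w; field.
rewrite wE in bg; rewrite /w; nra.
Qed.

Let D x := q x * (c x - chi x * c 0).

Let summ_D : summ D.
Proof.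
apply: eq_summ (summD summ_qc (summN (summZr (c 0) (_ : summ (fun x => chi x * q x))))) => [x|].
  by rewrite /D; ring.
apply: summ_le sq => x; rewrite normrM (gtr0_norm (qpos x)).
by rewrite ler_piMl ?chi_abs// ltW.
Qed.

Let Q := expR (- (3 * kap)).

Let q_nz1 x : nz x = 1 -> q x = Q.
Proof. by move=> e; rewrite /qz3 e mulr1. Qed.

(** On this class [chi = 1] and all terms are nonpositive; [d2_thz] and [tail_sum] limit the loss to
    [Q * En (1, 0)]. *)
Let D_cls0 : - (Q * En (1, 0)) <= rsum (D \o cls 0).
Proof.
have [s b] := tail_sum; have E0 := En_ge0 (1, 0).
have h : rsum (fun v : L => - (En (1, 0) * (q (thz v) * (4 * ((v.1%:~R : R) ^+ 2 + (v.2%:~R) ^+ 2)))))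
    <= rsum (D \o cls 0).
  apply: ler_rsum.
  - exact/summN/summZ.
  - exact: (summ_inj (@cls_injv 0) summ_D).
  move=> v; rewrite /= /D chi_cls0 mul1r.
  have -> : cls 0 v = thz v by rewrite /cls; case: (thz v) => x y; congr (_, _); rewrite /= add0r.
  have := d2_thz v; rewrite /d2 => h.
  have : c 0 - c (thz v) <= 4 * ((v.1%:~R : R) ^+ 2 + (v.2%:~R) ^+ 2) * En (1, 0) by lra.
  have := qpos (thz v); set Z := 4 * _; nra.
apply: le_trans h; by rewrite rsumN rsumZ// lerN2 mulrC; apply: ler_wpM2r.
Qed.

Let omz_cls1 v : omz (cls 1 v) = cls 1 ((0, 1) + omz v).
Proof. by case: v => a b; rewrite /cls /thz /omz /=; congr (_, _) => /=; lia. Qed.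

Let rot_sum (f : L -> R) : rsum (fun v => f (cls 1 v)) = rsum (fun v => f (omz (cls 1 v))).
Proof.
rewrite (rsum_reindex _ (bij_omz (0, 1))); apply: eq_rsum => v.
by rewrite omz_cls1.
Qed.

(** Averaging over the rotations by [omega] replaces [c + c 0 / 2] by [En / 6], so that all terms
    become nonnegative, and the vectors [1], [omega], [omega^2] of the class already give the bound.
    Together with the opposite class the gain is at least [Q * En (1, 0)], which covers the loss on
    the sublattice. *)
Let D_cls1 : Q * En (1, 0) / 2 <= rsum (D \o cls 1).
Proof.
pose f x := q x * (c x + 2^-1 * c 0).
have fE v : D (cls 1 v) = f (cls 1 v) by rewrite /D /f chi_cls1 mulNr opprK.
have sD1 : summ (fun v => f (cls 1 v)).
  by apply: eq_summ (summ_inj (@cls_injv 1) summ_D) => v; rewrite /= fE.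
have qom x : q (omz x) = q x.
  by rewrite /qz3 /nz /omz /=; congr (expR (- (_ * _%:~R))); ring.
have ib : injective (fun v : L => (0, 1) + omz v) := bij_inj (bij_omz (0, 1)).
have sD2 : summ (fun v => f (omz (cls 1 v))).
  by apply: eq_summ (summ_inj ib sD1) => v; rewrite /= omz_cls1.
have sD3 : summ (fun v => f (omz (omz (cls 1 v)))).
  by apply: eq_summ (summ_inj ib sD2) => v; rewrite /= -omz_cls1.
have e : 3 * rsum (D \o cls 1) = rsum (fun v => 2^-1 * (q (cls 1 v) * En (cls 1 v))).
  have -> : rsum (D \o cls 1) = rsum (fun v => f (cls 1 v)) by apply: eq_rsum => v; exact: fE.
  have r1 := rot_sum f; have r2 := rot_sum (fun x => f (omz x)).
  have -> : 3 * rsum (fun v => f (cls 1 v)) = rsum (fun v => f (cls 1 v)) +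
    rsum (fun v => f (omz (cls 1 v))) + rsum (fun v => f (omz (omz (cls 1 v)))).
    by rewrite -r2 -r1; ring.
  rewrite -!rsumD//; last exact: summD.
  by apply: eq_rsum => v; rewrite /f !qom /En; field.
have sE : summ (fun v => 2^-1 * (q (cls 1 v) * En (cls 1 v))).
  by apply: eq_summ (summD (summD sD1 sD2) sD3) => v; rewrite /f !qom /En; field.
have nn v : 0 <= 2^-1 * (q (cls 1 v) * En (cls 1 v)).
  by rewrite mulr_ge0 ?invr_ge0// mulr_ge0 ?En_ge0// ltW.
have us : uniq [:: ((0, 0) : L); (0, 1); (-1, 1)] by [].
have := ler_sum_rsum us sE nn.
rewrite !big_cons big_nil addr0.
have -> : cls 1 (0, 0) = (1, 0) by [].
have -> : cls 1 (0, 1) = omz (1, 0) by [].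
have -> : cls 1 (-1, 1) = omz (omz (1, 0)) by [].
rewrite !En_om !qom (_ : q (1, 0) = Q) ?q_nz1// -e; lra.
Qed.

Let D_cls2 : rsum (D \o cls 2) = rsum (D \o cls 1).
Proof.
rewrite [RHS](rsum_reindex _ (bij_oppl (-1, 2))); apply: eq_rsum => v.
rewrite /= /D chi_cls1 chi_cls2.
have -> : cls 1 ((-1, 2) - v) = - cls 2 v.
  by case: v => a b; rewrite /cls /thz /=; congr (_, _) => /=; lia.
by rewrite ceven /qz3 /nz /=; congr (expR (- (_ * _%:~R)) * _); ring.
Qed.

Lemma cert_lower : @bv R * c 0 <= rsum (fun x => q x * c x).
Proof.
have schi : summ (fun x => chi x * q x).
  apply: summ_le sq => x; rewrite normrM (gtr0_norm (qpos x)).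
  by rewrite ler_piMl ?chi_abs// ltW.
have e : rsum D = rsum (fun x => q x * c x) - @bv R * c 0.
  rewrite -bvE -rsumZr// -rsumB; [|exact: summ_qc|exact: summZr].
  by apply: eq_rsum => x; rewrite /D; ring.
have [_ _ _ e2] := rsum_ord3 cls_inj cls_surj summ_D.
rewrite -subr_ge0 -e e2 D_cls2.
by have := D_cls0; have := D_cls1; lra.
Qed.

End Certificate.

(** * Janssen's representation *)

Section Forms.
Context {R : realType}.
Local Notation L := (int * int)%type.
Local Notation pt := (R * R)%type.
Local Notation q := (@qz3 R (@kappa R)).

(* [(r, th, z)] stands for [r * cis th * rho z g] where [g] is the Gaussian, [z = (x, w)] and
   [rho z g t = cis (2 * pi * w * t - pi * x * w) * g (t - x)] is the symmetric time-frequency shift *)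
Definition atom := (R * R * pt)%type.

Implicit Types (z w l : pt) (a b : atom) (s : seq atom).

Definition symp z w : R := z.2 * w.1 - z.1 * w.2.
Definition nsq z : R := z.1 ^+ 2 + z.2 ^+ 2.

Lemma nsq_ge0 z : 0 <= nsq z. Proof. by rewrite addr_ge0 ?sqr_ge0. Qed.

(** The hexagonal lattice of covolume 1/2. Its adjoint lattice, given by [Sd], is the lattice
    divided by its covolume. *)
Definition Sl (n : L) : pt := (fr3 / 2 * n.1%:~R, fr3^-1 * (n.2%:~R + 2^-1 * n.1%:~R)).
Definition Sd (n : L) : pt := (2 * (Sl n).1, 2 * (Sl n).2).

Lemma nsq_Sl n : nsq (Sl n) = (nz n)%:~R / Num.sqrt 3.
Proof.
have f0 := @fr3_gt0 R; have f2 := @fr3_sqr R.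
have t0 := @sqrt3_gt0 R; have t2 : Num.sqrt 3 ^+ 2 = 3 :> R by rewrite sqr_sqrtr.
set T := Num.sqrt 3 in f2 t0 t2 *.
have nt : T != 0 by rewrite lt0r_neq0.
have e : T / 4 = 3 / 4 / T by rewrite -t2; field.
rewrite /nsq /Sl /= !exprMn !exprVn f2 (_ : 2 ^- 2 = 4^-1) ?e; last by field.
by rewrite /nz !(intrD, intrM); move: n.1%:~R n.2%:~R => k l; field.
Qed.

(** The real part of the inner product of the functions of two atoms, so that [Bf] is the squared
    norm of a combination. [cK] is the same with the first atom moved by [Sd m], and [gK] collects
    the terms of the squared modulus of the coefficient at [l]. [ip_wave] and [gf_ip] justify these
    closed expressions. *)
Definition Kf a b : R := a.1.1 * b.1.1 * (expR (- (pi / 2 * nsq (a.2 - b.2))) *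
  cos (a.1.2 - b.1.2 + pi * symp a.2 b.2)).

Definition Bf s : R := \sum_(a <- s) \sum_(b <- s) Kf a b.

Definition cK a b (m : L) : R := a.1.1 * b.1.1 * (expR (- (pi / 2 * nsq (a.2 - b.2 + Sd m))) *
  cos (a.1.2 - b.1.2 + pi * (symp a.2 b.2 + symp (Sd m) (a.2 + b.2)))).

Definition cf s (m : L) : R := \sum_(a <- s) \sum_(b <- s) cK a b m.

Definition gK a b l : R := a.1.1 * b.1.1 *
  (expR (- (pi / 2 * (nsq (a.2 - l) + nsq (b.2 - l)))) *
   cos (a.1.2 - b.1.2 + pi * symp (a.2 - b.2) l)).

Definition gf s l : R := \sum_(a <- s) \sum_(b <- s) gK a b l.

Lemma q_Sd m : q m = expR (- (pi / 2 * nsq (Sd m))).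
Proof.
have -> : nsq (Sd m) = 4 * nsq (Sl m) :> R by rewrite /nsq /Sd /=; ring.
rewrite nsq_Sl /qz3 /kappa; congr (expR (- _)).
by move: (Num.sqrt 3) (lt0r_neq0 (@sqrt3_gt0 R)) (pi) ((nz m)%:~R) => T T0 P z; field.
Qed.

Lemma fr3_a13 : (fr3 / 2) * fr3^-1 = 2^-1 :> R.
Proof. by field; rewrite lt0r_neq0// fr3_gt0. Qed.

Lemma janssen_atom a b :
  [/\ summ (fun n => gK a b (Sl n)), summ (fun m => q m * cK a b m) &
  rsum (fun n => gK a b (Sl n)) = 2 * rsum (fun m => q m * cK a b m)].
Proof.
case: a => [[ra tha] [x1 w1]]; case: b => [[rb thb] [x2 w2]].
pose a1 : R := fr3 / 2; pose a3 : R := fr3^-1.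
have f0 := @fr3_gt0 R.
have a10 : 0 < a1 by rewrite divr_gt0.
have a30 : 0 < a3 by rewrite invr_gt0.
have a13 : a1 * a3 = 2^-1 by exact: fr3_a13.
have i1 : a1^-1 = 2 * a3.
  apply: (mulfI (lt0r_neq0 a10)); rewrite mulfV ?lt0r_neq0// mulrCA a13.
  by rewrite mulfV.
have i3 : a3^-1 = 2 * a1.
  apply: (mulfI (lt0r_neq0 a30)); rewrite mulfV ?lt0r_neq0// mulrCA [a3 * _]mulrC a13.
  by rewrite mulfV.
pose m1 := (x1 + x2) / 2; pose m2 := (w1 + w2) / 2.
pose t1 := (w1 - w2) / 2; pose t2 := - (x1 - x2) / 2.
pose p := tha - thb.
pose C := ra * rb * expR (- (pi / 4 * nsq (x1 - x2, w1 - w2))).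
pose F (k : L) := expR (- (pi * ((a1 * k.1%:~R - m1) ^+ 2 + (a3 * (k.2%:~R + 2^-1 * k.1%:~R) - m2) ^+ 2))) *
     cos (p + 2 * pi * (t1 * (a1 * k.1%:~R) + t2 * (a3 * (k.2%:~R + 2^-1 * k.1%:~R)))).
pose G (n : L) := expR (- (pi * ((t1 + (n.2%:~R - n.1%:~R / 2) / a1) ^+ 2 + (t2 + n.1%:~R / a3) ^+ 2))) *
     cos (p + 2 * pi * ((t1 + (n.2%:~R - n.1%:~R / 2) / a1) * m1 + (t2 + n.1%:~R / a3) * m2)).
have sF : summ F.
  apply: summ_le (summ_gauss2 2^-1 m1 m2 a10 a30) => k.
  by rewrite normrM ger0_norm ?expR_ge0// ler_piMr ?expR_ge0 ?cos_max.
have b : bijective (fun m : L => (- m.1, m.2)).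
  by exists (fun m : L => (- m.1, m.2)) => -[x y] /=; rewrite opprK.
have eF n : gK (ra, tha, (x1, w1)) (rb, thb, (x2, w2)) (Sl n) = C * F n.
  rewrite /gK /C /F /= -[RHS]mulrA; congr (_ * _); rewrite [RHS]mulrA -expRD.
  congr (expR _ * cos _).
    rewrite /nsq /Sl /= -/a1 -/a3 /m1 /m2.
    by move: (a1 * _) (a3 * _) (pi) => A B P; field.
  rewrite /symp /Sl /= -/a1 -/a3 /p /t1 /t2.
  by move: (a1 * _) (a3 * _) (pi) => A B P; field.
have eG m : q m * cK (ra, tha, (x1, w1)) (rb, thb, (x2, w2)) m = C * G (- m.1, m.2).
  rewrite q_Sd /cK /C /G /= mulrCA -[RHS]mulrA; congr (_ * _); rewrite !mulrA -!expRD.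
  rewrite i1 i3 /p /t1 /t2 /m1 /m2 /nsq /symp /Sd /Sl /= -/a1 -/a3 intrN.
  congr (expR _ * cos _).
    by move: (m.1%:~R) (m.2%:~R) (pi) a1 a3 {a10 a30 a13 i1 i3 F G sF eF} => A B P A1 A3; field.
  by move: (m.1%:~R) (m.2%:~R) (pi) a1 a3 {a10 a30 a13 i1 i3 F G sF eF} => A B P A1 A3; field.
have sG : summ G by exact: summ_gauss2_dual.
have sG' : summ (fun m : L => G (- m.1, m.2)) by apply/(summ_reindex G b).
split.
- by apply: eq_summ (summZ C sF) => n; rewrite eF.
- by apply: eq_summ (summZ C sG') => n; rewrite eG.
rewrite (eq_rsum eF) (eq_rsum eG) !rsumZ// -(rsum_reindex G b).
rewrite (@poisson2 R a1 a3 m1 m2 t1 t2 p a10 a30) a13 invrK; ring.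
Qed.

Theorem janssen s :
  [/\ summ (fun n => gf s (Sl n)), summ (fun m => q m * cf s m) &
  rsum (fun n => gf s (Sl n)) = 2 * rsum (fun m => q m * cf s m)].
Proof.
have s1 a b : summ (fun n => gK a b (Sl n)) by case: (janssen_atom a b).
have s2 a b : summ (fun m => q m * cK a b m) by case: (janssen_atom a b).
have e2 m : q m * cf s m = \sum_(a <- s) \sum_(b <- s) q m * cK a b m.
  by rewrite /cf mulr_sumr; apply: eq_bigr => a _; rewrite mulr_sumr.
split.
- by rewrite /gf; apply: summ_sum => a; apply: summ_sum.
- apply: eq_summ (_ : summ (fun m => \sum_(a <- s) \sum_(b <- s) q m * cK a b m)) => //.
  by apply: summ_sum => a; apply: summ_sum.
rewrite (eq_rsum e2) /gf rsum_sum => [|a]; last exact: summ_sum.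
rewrite rsum_sum => [|a]; last exact: summ_sum.
rewrite mulr_sumr; apply: eq_bigr => a _; rewrite !rsum_sum// mulr_sumr.
by apply: eq_bigr => b _; case: (janssen_atom a b).
Qed.

Lemma cf0 s : cf s 0 = Bf s.
Proof.
apply: eq_bigr => a _; apply: eq_bigr => b _; rewrite /cK /Kf.
rewrite /nsq /symp /Sd /Sl /= !mulr0z !(mulr0, addr0, mul0r, subr0).
by [].
Qed.

Lemma SdD m n : Sd (m + n) = Sd m + Sd n.
Proof. by rewrite /Sd /Sl /=; congr (_, _); rewrite /= !intrD; ring. Qed.

Lemma SdN m : Sd (- m) = - Sd m.
Proof. by rewrite /Sd /Sl /=; congr (_, _); rewrite /= !intrN; ring. Qed.

Lemma cf_even s m : cf s (- m) = cf s m.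
Proof.
rewrite /cf exchange_big /=; apply: eq_bigr => a _; apply: eq_bigr => b _.
rewrite /cK SdN [b.1.1 * _]mulrC; congr (_ * (expR (- (_ * _)) * _)).
  by rewrite /nsq /=; ring.
by rewrite -[LHS]cosN; congr cos; rewrite /symp /=; ring.
Qed.

(** The value is an even integer, so the phase [pi * symp] with which two symmetric shifts compose
    is a multiple of [2 * pi]. *)
Lemma symp_Sd m n : symp (Sd m) (Sd n) = 2 * (m.2 * n.1 - m.1 * n.2)%:~R.
Proof.
rewrite /symp /Sd /Sl /=.
have e := fr3_a13; set A := fr3 / 2 in e *; set B := fr3^-1 in e *.
have -> : 2 * (B * (m.2%:~R + 2^-1 * m.1%:~R)) * (2 * (A * n.1%:~R)) -
  2 * (A * m.1%:~R) * (2 * (B * (n.2%:~R + 2^-1 * n.1%:~R))) =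
  4 * (A * B) * (m.2%:~R * n.1%:~R - m.1%:~R * n.2%:~R) by field.
by rewrite e intrB !intrM; field.
Qed.

(** The form is [Bf] of a larger combination, in which every atom is moved by each [Sd x.2] with
    amplitude [x.1]; the phase left over is a multiple of [2 * pi] by [symp_Sd]. *)
Lemma cf_psd s (t : seq (R * L)) : (forall s', 0 <= Bf s') ->
  0 <= \sum_(x <- t) \sum_(y <- t) x.1 * y.1 * cf s (x.2 - y.2).
Proof.
move=> B0.
pose sh (x : R * L) a : atom := (x.1 * a.1.1, a.1.2 + pi * symp (Sd x.2) a.2, a.2 + Sd x.2).
have := B0 [seq sh x a | x <- t, a <- s].
rewrite /Bf big_allpairs_dep /=; under eq_bigr do under eq_bigr do rewrite big_allpairs_dep /=.
under eq_bigr do rewrite exchange_big /=.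
move=> h; apply: le_trans h _; apply: le_of_eq.
apply: eq_bigr => x _; apply: eq_bigr => y _; rewrite /cf mulr_sumr.
apply: eq_bigr => a _; rewrite mulr_sumr; apply: eq_bigr => b _.
rewrite /Kf /cK /sh /= SdD SdN.
have -> : x.1 * a.1.1 * (y.1 * b.1.1) = x.1 * y.1 * (a.1.1 * b.1.1) by ring.
rewrite -!mulrA; congr (_ * (_ * (_ * (_ * (expR (- (_ * (_ * _))) * _))))).
  by rewrite /nsq /=; ring.
rewrite -[RHS](cosD2piz _ (x.2.2 * y.2.1 - x.2.1 * y.2.2)); congr cos.
have -> : 2 * pi * (x.2.2 * y.2.1 - x.2.1 * y.2.2)%:~R = pi * symp (Sd x.2) (Sd y.2) :> R.
  by rewrite symp_Sd; ring.
by rewrite /symp /=; ring.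
Qed.

(** Positivity of [Bf] stays a hypothesis until [Bf] is recognized as a squared norm in
    [nn_wave]. *)
Theorem gf_bounds s : (forall s', 0 <= Bf s') ->
  2 * @bv R * Bf s <= rsum (fun n => gf s (Sl n)) <= 2 * @av R * Bf s.
Proof.
move=> B0; have [_ _ ->] := janssen s.
have ev := cf_even s; have ps t := cf_psd s t B0.
have := cert_lower ev ps; have := cert_upper ev ps; rewrite cf0 => h1 h2.
by apply/andP; split; rewrite -mulrA ler_pM2l.
Qed.

End Forms.

(** * Sharpness along boxes *)

Section Boxes.
Context {R : realType}.
Local Notation L := (int * int)%type.
Local Notation q := (@qz3 R (@kappa R)).

Lemma summ_q : summ q. Proof. exact: summ_qz3 kappa_gt0. Qed.

Lemma q_le1 m : q m <= 1.
Proof. by rewrite q_Sd expR_le1 oppr_le0 mulr_ge0 ?divr_ge0 ?pi_ge0 ?nsq_ge0. Qed.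

Lemma SdB m n : Sd (m - n) = Sd m - Sd n :> R * R.
Proof. by rewrite SdD SdN. Qed.

Definition boxsum (N : nat) (h : L -> R) : R :=
  \sum_(i < N) \sum_(j < N) \sum_(k < N) \sum_(l < N) h (Posz i - Posz k, Posz j - Posz l).

Lemma boxsumE N h : summ h ->
  boxsum N h = rsum (fun d : L => h d * (cnt N d.1 * cnt N d.2)).
Proof.
move=> sh.
have s2 : summ (fun d : L => h d * cnt N d.2).
  apply: summ_le (summZr N%:R (summ_abs sh)) => d; rewrite normrM ler_wpM2l//.
  by have /andP[c0 c1] := @cnt_le R N d.2; rewrite ger0_norm.
have s12 : summ (fun d : L => h d * (cnt N d.1 * cnt N d.2)).
  apply: summ_le (summZr N%:R (summ_abs s2)) => d.
  rewrite mulrCA mulrC normrM ler_wpM2l//.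
  by have /andP[c0 c1] := @cnt_le R N d.1; rewrite ger0_norm.
pose H (d1 : int) := rsum (fun d2 : int => h (d1, d2) * cnt N d2).
have sH : summ H by exact: (@summ_pair R _ _ (fun d : L => h d * cnt N d.2) s2).
rewrite /boxsum; under eq_bigr do rewrite exchange_big /=.
transitivity (\sum_(i < N) \sum_(k < N) H (Posz i - Posz k)).
  apply: eq_bigr => i _; apply: eq_bigr => k _.
  by rewrite (sum_cnt (h := fun d2 => h (Posz i - Posz k, d2)))//; exact: summ_pair1.
rewrite sum_cnt// (rsum_pair s12); apply: eq_rsum => d1 /=.
rewrite /H -rsumZr; last exact: (summ_pair1 d1 s2).
by apply: eq_rsum => d2; rewrite -mulrA [cnt N d2 * _]mulrC.
Qed.

Lemma boxsum_cvg h : summ h -> boxsum N h / N%:R ^+ 2 @[N --> \oo] --> rsum h.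
Proof.
move=> sh.
have e : (fun N => boxsum N h / N%:R ^+ 2) =
    (fun N => rsum (fun d : L => h d * (cnt N d.1 / N%:R * (cnt N d.2 / N%:R)))).
  apply/funext => N; rewrite boxsumE// -rsumZr.
    by apply: eq_rsum => d; rewrite expr2 invfM -mulrA mulrACA.
  apply: summ_le (summZr (N%:R * N%:R) (summ_abs sh)) => d; rewrite normrM ler_wpM2l//.
  have /andP[c0 c1] := @cnt_le R N d.1; have /andP[c2 c3] := @cnt_le R N d.2.
  by rewrite ger0_norm ?mulr_ge0// ler_pM.
rewrite e.
have c1 N (d : int) : 0 <= @cnt R N d / N%:R <= 1.
  have /andP[c0 c1] := @cnt_le R N d; rewrite divr_ge0//=.
  have [->|N0] := eqVneq N 0%N; first by rewrite invr0 mulr0.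
  by rewrite ler_pdivrMr ?ltr0n ?lt0n// mul1r.
apply: (rsum_dominated (summ_abs sh) _ _).2 => [N d|d].
  rewrite normrM ler_piMr// ger0_norm; have /andP[? ?] := c1 N d.1; have /andP[? ?] := c1 N d.2.
    by rewrite mulr_ile1.
  by rewrite mulr_ge0.
rewrite -[X in _ --> X]mulr1; apply: cvgM; first exact: cvg_cst.
by rewrite -[X in _ --> X]mulr1; apply: cvgM; exact: cnt_cvg.
Qed.

Lemma rsum_boxsum N (f : L -> L -> R) : (forall d, summ (f d)) ->
  rsum (fun m => boxsum N (fun d => f d m)) = boxsum N (fun d => rsum (f d)).
Proof.
move=> sf; rewrite rsum_sum => [|i]; last by do 3 apply: summ_sum => ?.
apply: eq_bigr => i _; rewrite rsum_sum => [|j]; last by do 2 apply: summ_sum => ?.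
apply: eq_bigr => j _; rewrite rsum_sum => [|k]; last by apply: summ_sum => ?.
by apply: eq_bigr => k _; rewrite rsum_sum.
Qed.

Variable u : R.
Let ph (n : L) : R := u * (n.1 - n.2)%:~R.

(** Shifts of the Gaussian by an [N] by [N] box of adjoint points, twisted by the character with
    phase [u * (n.1 - n.2)]: [u = 0] tests the upper bound, and [u = 2 * pi / 3], which belongs to
    [chi], tests the lower one. *)
Definition box (N : nat) : seq (@atom R) :=
  [seq (1, ph (Posz (i : 'I_N), Posz (j : 'I_N)), Sd (Posz i, Posz j)) |
     i <- index_enum 'I_N, j <- index_enum 'I_N].

Let S := rsum (fun x : L => q x * cos (ph x)).

Let s_qcos : summ (fun x : L => q x * cos (ph x)).
Proof.
apply: summ_le summ_q => x; rewrite normrM ger0_norm ?expR_ge0//.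
by rewrite ler_piMr ?expR_ge0 ?cos_max.
Qed.

Let s_qsin : summ (fun x : L => q x * sin (ph x)).
Proof.
apply: summ_le summ_q => x; rewrite normrM ger0_norm ?expR_ge0//.
by rewrite ler_piMr ?expR_ge0 ?sin_max.
Qed.

Lemma Bf_box N : Bf (box N) = boxsum N (fun x => q x * cos (ph x)).
Proof.
rewrite /Bf /box big_allpairs_dep /=; under eq_bigr do under eq_bigr do rewrite big_allpairs_dep /=.
apply: eq_bigr => i _; apply: eq_bigr => j _; apply: eq_bigr => k _; apply: eq_bigr => l _.
rewrite /Kf /= mulr1 mul1r -SdB symp_Sd q_Sd; congr (_ * _).
rewrite /ph /= mulrA [pi * 2]mulrC cosD2piz; congr cos.
by rewrite -mulrBr -intrB; congr (_ * _%:~R); ring.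
Qed.

Let H (d : L) := rsum (fun m => q m * (q (d + m) * cos (ph d))).

Lemma gf_box N : rsum (fun n => gf (box N) (Sl n)) = 2 * boxsum N H.
Proof.
have [_ _ ->] := janssen (box N); congr (_ * _).
have sm (d : L) : summ (fun m => q m * (q (d + m) * cos (ph d))).
  apply: summ_le summ_q => m; rewrite normrM ger0_norm ?expR_ge0// ler_piMr ?expR_ge0//.
  by rewrite normrM ger0_norm ?expR_ge0// mulr_ile1 ?expR_ge0 ?cos_max// q_le1.
have -> : rsum (fun m => q m * cf (box N) m) = rsum (fun m =>
    boxsum N (fun d => q m * (q (d + m) * cos (ph d)))).
  apply: eq_rsum => m.
  rewrite /cf /box big_allpairs_dep /=; under eq_bigr do under eq_bigr do rewrite big_allpairs_dep /=.
  rewrite mulr_sumr; apply: eq_bigr => i _; rewrite mulr_sumr; apply: eq_bigr => j _.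
  rewrite mulr_sumr; apply: eq_bigr => k _; rewrite mulr_sumr; apply: eq_bigr => l _.
  rewrite /cK /= mulr1 mul1r -!SdB -!SdD ?symp_Sd -q_Sd; congr (_ * (_ * _)).
  rewrite -mulrDr -intrD mulrA [pi * 2]mulrC cosD2piz; congr cos.
  by rewrite /ph /= -mulrBr -intrB; congr (_ * _%:~R); ring.
exact: rsum_boxsum sm.
Qed.

(** [H] is the autocorrelation of [q] times the character, so its total is the squared modulus of
    the transform of [q]; the sine part of that transform is 0 since [q] is even. *)
Lemma H_lim : summ H /\ rsum H = S ^+ 2.
Proof.
pose e (p : L * L) : L * L := (p.2, p.1 + p.2).
have be : bijective e.
  exists (fun p : L * L => (p.2 - p.1, p.1)) => -[a b]; rewrite /e /=; congr (_, _).
  - by rewrite addrK.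
  - by rewrite subrK.
pose F (p : L * L) := (q p.1 * cos (ph p.1)) * (q p.2 * cos (ph p.2)) +
   (q p.1 * sin (ph p.1)) * (q p.2 * sin (ph p.2)).
have sF : summ F by apply: summD; [exact: (summM s_qcos s_qcos)|exact: (summM s_qsin s_qsin)].
have eF p : F (e p) = q p.2 * (q (p.1 + p.2) * cos (ph p.1)).
  rewrite /F /e /=.
  have -> : ph p.1 = ph (p.1 + p.2) - ph p.2.
    by rewrite /ph /= -mulrBr -intrB; congr (_ * _%:~R); ring.
  by rewrite cosB; ring.
have sG : summ (fun p : L * L => q p.2 * (q (p.1 + p.2) * cos (ph p.1))).
  by apply: eq_summ (iffLR (summ_reindex F be) sF) => p; exact: eF.
split; first exact: (summ_pair sG).
rewrite -(rsum_pair sG) -(eq_rsum eF) -(rsum_reindex F be) rsumD; last 2 first.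
- exact: (summM s_qcos s_qcos).
- exact: (summM s_qsin s_qsin).
rewrite (rsumM s_qcos s_qcos) (rsumM s_qsin s_qsin) -/S -expr2.
suff -> : rsum (fun x => q x * sin (ph x)) = 0 by rewrite mulr0 addr0.
have bN : bijective (fun x : L => - x) by exists (fun x : L => - x) => x; rewrite opprK.
have := rsum_reindex (fun x => q x * sin (ph x)) bN.
have -> : rsum (fun i : L => q (- i) * sin (ph (- i))) = - rsum (fun x => q x * sin (ph x)).
  rewrite -rsumN; apply: eq_rsum => x.
  have -> : ph (- x) = - ph x by rewrite /ph /= -mulrN -intrN; congr (_ * _%:~R); ring.
  rewrite sinN mulrN; congr (- (_ * _)).
  by rewrite !q_Sd SdN /nsq /= !sqrrN.
by move=> h; lra.
Qed.

(** For positive [S] the quotients of frame sum and squared norm thus tend to [2 * S]. *)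
Lemma box_cvg : Bf (box N) / N%:R ^+ 2 @[N --> \oo] --> S /\
  rsum (fun n => gf (box N) (Sl n)) / N%:R ^+ 2 @[N --> \oo] --> 2 * S ^+ 2.
Proof.
split.
  by under eq_cvg do rewrite Bf_box; exact: boxsum_cvg.
under eq_cvg do rewrite gf_box -mulrA.
by have [sH <-] := H_lim; apply: cvgM; [exact: cvg_cst|exact: boxsum_cvg].
Qed.

End Boxes.

(** * Square integrable functions *)

Section RealL2.
Context {R : realType}.
Local Notation mu := (@lebesgue_measure R).
Local Notation IN u := (mu.-integrable [set: R] (EFin \o (u : R -> R))).

Definition sqint (u : R -> R) : Prop :=
  measurable_fun [set: R] u /\ IN (fun t => u t ^+ 2).

Definition dot (u v : R -> R) : R := \int[mu]_(t in [set: R]) (u t * v t).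

Lemma le_int (u v : R -> R) : measurable_fun [set: R] u -> (forall t, `|u t| <= v t) ->
  IN v -> IN u.
Proof.
move=> mu_ uv iv; apply: le_integrable iv => //; first exact/measurable_EFinP.
by move=> t _; rewrite /= lee_fin (le_trans (uv t))// ler_norm.
Qed.

Lemma sqint_prod u v : sqint u -> sqint v -> IN (fun t => u t * v t).
Proof.
move=> [m1 i1] [m2 i2]; apply: (@le_int _ (fun t => u t ^+ 2 + v t ^+ 2)).
- exact: measurable_funM.
- move=> t; rewrite normrM -[u t ^+ 2]ger0_norm ?sqr_ge0// -[v t ^+ 2]ger0_norm ?sqr_ge0// !normrX.
  by have := sqr_ge0 (`|u t| - `|v t|); nra.
- exact: integD.
Qed.

Lemma sqintD u v : sqint u -> sqint v -> sqint (fun t => u t + v t).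
Proof.
move=> h1 h2; have [m1 i1] := h1; have [m2 i2] := h2; split; first exact: measurable_funD.
rewrite (_ : (fun t => _) = fun t => (u t ^+ 2 + v t ^+ 2) + 2 * (u t * v t)).
  by apply: integD; [exact: integD|apply: integZ; exact: sqint_prod].
by apply/funext => t; ring.
Qed.

Lemma sqintZ c u : sqint u -> sqint (fun t => c * u t).
Proof.
move=> [m i]; split; first by apply: measurable_funM => //; exact: measurable_cst.
rewrite (_ : (fun t => _) = fun t => c ^+ 2 * (u t ^+ 2)); first exact: integZ.
by apply/funext => t; ring.
Qed.

Lemma sqintB u v : sqint u -> sqint v -> sqint (fun t => u t - v t).
Proof.
move=> h1 h2; rewrite (_ : (fun t => _) = fun t => u t + -1 * v t).
  by apply: sqintD => //; exact: sqintZ.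
by apply/funext => t; ring.
Qed.

Lemma dotC u v : dot u v = dot v u.
Proof. by rewrite /dot; congr (Rintegral _ _ _); apply/funext => t; rewrite mulrC. Qed.

Lemma dotDl u v w : sqint u -> sqint v -> sqint w ->
  dot (fun t => u t + v t) w = dot u w + dot v w.
Proof.
move=> h1 h2 h3; rewrite /dot -RintegralD//; try exact: sqint_prod.
by congr (Rintegral _ _ _); apply/funext => t; rewrite mulrDl.
Qed.

Lemma dotBl u v w : sqint u -> sqint v -> sqint w ->
  dot (fun t => u t - v t) w = dot u w - dot v w.
Proof.
move=> h1 h2 h3; rewrite /dot -RintegralB//; try exact: sqint_prod.
by congr (Rintegral _ _ _); apply/funext => t; rewrite mulrBl.
Qed.

Lemma dotZl c u w : sqint u -> sqint w -> dot (fun t => c * u t) w = c * dot u w.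
Proof.
move=> h1 h2; rewrite /dot -RintegralZl//; try exact: sqint_prod.
by congr (Rintegral _ _ _); apply/funext => t; rewrite mulrA.
Qed.

Lemma dot_ge0 u : 0 <= dot u u.
Proof. by apply: Rintegral_ge0 => t _; rewrite -expr2 sqr_ge0. Qed.

(* Complex functions are handled as pairs (real part, imaginary part) *)
Definition cfun := ((R -> R) * (R -> R))%type.
Implicit Types f h e : cfun.

Definition csq f : Prop := sqint f.1 /\ sqint f.2.
Definition ip f h : R := dot f.1 h.1 + dot f.2 h.2.
Definition nn f : R := ip f f.
Definition csub f h : cfun := (fun t => f.1 t - h.1 t, fun t => f.2 t - h.2 t).
Definition cscl (c : R) f : cfun := (fun t => c * f.1 t, fun t => c * f.2 t).

Lemma csq_sub f h : csq f -> csq h -> csq (csub f h).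
Proof. by move=> [? ?] [? ?]; split; exact: sqintB. Qed.

Lemma csq_scl c f : csq f -> csq (cscl c f).
Proof. by move=> [? ?]; split; exact: sqintZ. Qed.

Lemma ipC f h : ip f h = ip h f. Proof. by rewrite /ip dotC [X in _ + X]dotC. Qed.

Lemma ipBl f h e : csq f -> csq h -> csq e -> ip (csub f h) e = ip f e - ip h e.
Proof. by move=> [? ?] [? ?] [? ?]; rewrite /ip /= !dotBl//; ring. Qed.

Lemma ipZl c f e : csq f -> csq e -> ip (cscl c f) e = c * ip f e.
Proof. by move=> [? ?] [? ?]; rewrite /ip /= !dotZl//; ring. Qed.

Lemma nn_ge0 f : 0 <= nn f. Proof. by rewrite addr_ge0 ?dot_ge0. Qed.

Lemma nn_sub f h : csq f -> csq h -> nn (csub f h) = nn f - 2 * ip f h + nn h.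
Proof.
move=> qf qh; have qs := csq_sub qf qh.
by rewrite /nn ipBl// (ipC f) (ipC h) !ipBl// (ipC h); ring.
Qed.

Lemma cauchy_schwarz f e : csq f -> csq e -> ip f e ^+ 2 <= nn f * nn e.
Proof.
move=> qf qe.
have H c : 0 <= c ^+ 2 * nn f - 2 * c * ip f e + nn e.
  have := nn_ge0 (csub (cscl c f) e); rewrite nn_sub//; last exact: csq_scl.
  by rewrite /nn ipZl ?(ipC _ (cscl c f)) ?ipZl//; [nra|exact: csq_scl].
have f0 := nn_ge0 f; have [fe|fn] := eqVneq (nn f) 0.
  (* When [nn f = 0] the quadratic polynomial degenerates to a linear one; if [ip f e] were nonzero,
     its value here would be -1. *)
  have := H ((nn e + 1) / (2 * ip f e)); rewrite fe mul0r mulr0 sub0r.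
  have [->|n0] := eqVneq (ip f e) 0; first by rewrite expr0n.
  have -> : 2 * ((nn e + 1) / (2 * ip f e)) * ip f e = nn e + 1 by field.
  by lra.
have f1 : 0 < nn f by rewrite lt_def fn.
have := H (ip f e / nn f).
have -> : (ip f e / nn f) ^+ 2 * nn f - 2 * (ip f e / nn f) * ip f e + nn e =
  nn e - ip f e ^+ 2 / nn f by field.
by rewrite subr_ge0 ler_pdivrMr// mulrC.
Qed.

Lemma sqr_split (s x y : R) : 0 < s -> (x + y) ^+ 2 <= (1 + s) * x ^+ 2 + (1 + s^-1) * y ^+ 2.
Proof.
move=> s0; rewrite -subr_ge0.
have -> : (1 + s) * x ^+ 2 + (1 + s^-1) * y ^+ 2 - (x + y) ^+ 2 = s * (x - y / s) ^+ 2.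
  by field; rewrite gt_eqF.
by rewrite mulr_ge0 ?sqr_ge0// ltW.
Qed.

(** Expand [|s h - (f - h)|^2 >= 0] and divide by [s]. *)
Lemma nn_split (s : R) f h : csq f -> csq h -> 0 < s ->
  nn f <= (1 + s) * nn h + (1 + s^-1) * nn (csub f h).
Proof.
move=> qf qh s0; have qs := csq_sub qf qh.
have H := nn_ge0 (csub (cscl s h) (csub f h)).
rewrite nn_sub// in H; last exact: csq_scl.
have q1 : csq (cscl s h) by exact: csq_scl.
rewrite {1}/nn !ipZl// (ipC h) ipZl// (ipC h (csub f h)) ipBl// in H.
have e : nn (csub f h) = nn f - 2 * ip f h + nn h by exact: nn_sub.
rewrite -subr_ge0.
have -> : (1 + s) * nn h + (1 + s^-1) * nn (csub f h) - nn f =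
  s^-1 * (s * (s * nn h) - 2 * (s * (ip f h - ip h h)) + nn (csub f h)).
  by rewrite e /nn; move: (ip h h) (ip f f) (ip f h) => A B C; field; rewrite gt_eqF.
by rewrite mulr_ge0// invr_ge0 ltW.
Qed.

Lemma ler_addK (x y K : R) : 0 <= K -> (forall e : R, 0 < e -> e < 1 -> x <= y + K * e) -> x <= y.
Proof.
move=> K0 H; rewrite leNgt; apply/negP => xy.
have d0 : 0 < x - y by rewrite subr_gt0.
have D0 : 0 < K + (x - y) + 1 by lra.
have := H ((x - y) / (K + (x - y) + 1) / 2).
rewrite !divr_gt0// => /(_ isT).
rewrite ltr_pdivrMr// ltr_pdivrMr// => h.
have : K * ((x - y) / (K + (x - y) + 1) / 2) < x - y.
  rewrite mulrA ltr_pdivrMr// mulrA ltr_pdivrMr//; nra.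
by have := h ltac:(nra); lra.
Qed.

Lemma sqr_1Ds (s Y : R) : 0 <= Y -> 0 < s -> s < 1 -> (1 + s) ^+ 2 * Y <= Y + 3 * Y * s.
Proof.
move=> Y0 s0 s1; rewrite -subr_ge0.
have -> : Y + 3 * Y * s - (1 + s) ^+ 2 * Y = Y * (s * (1 - s)) by ring.
by rewrite !mulr_ge0// ?subr_ge0 ltW.
Qed.

(** * Extension of frame inequalities from a dense family *)

Section Extension.
Variables (I : choiceType) (T : Type) (E : I -> cfun) (W : T -> cfun) (A B : R).
Hypotheses (A0 : 0 <= A) (B0 : 0 <= B) (qE : forall i, csq (E i)) (qW : forall s, csq (W s)).
Hypothesis dense : forall f, csq f -> forall e : R, 0 < e -> exists s, nn (csub f (W s)) <= e.
Hypothesis fW : forall s, summ (fun i => ip (W s) (E i) ^+ 2) /\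
  A * nn (W s) <= rsum (fun i => ip (W s) (E i) ^+ 2) <= B * nn (W s).

(** Over a finite set of indices the sum is continuous in [f], so the bound passes to the limit
    there; it does not depend on the finite set. *)
Lemma bessel_extend f : csq f ->
  summ (fun i => ip f (E i) ^+ 2) /\ rsum (fun i => ip f (E i) ^+ 2) <= B * nn f.
Proof.
move=> qf.
have H (r : seq I) : uniq r -> \sum_(i <- r) `|ip f (E i) ^+ 2| <= B * nn f.
  move=> ur; have f0 := nn_ge0 f; apply: (@ler_addK _ _ (3 * (B * nn f))).
    by rewrite !mulr_ge0.
  move=> s s0 s1; apply: (@le_trans _ _ ((1 + s) ^+ 2 * (B * nn f))); last first.
    by apply: sqr_1Ds => //; exact: mulr_ge0.
  pose C := \sum_(i <- r) nn (E i).
  have C0 : 0 <= C by apply: sumr_ge0 => i _; exact: nn_ge0.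
  pose t := 1 + s^-1; have t0 : 0 <= t by rewrite addr_ge0// invr_ge0 ltW.
  apply: (@ler_addK _ _ ((1 + s) * B * t + t * C)).
    by rewrite addr_ge0// !mulr_ge0// addr_ge0// ltW.
  move=> e e0 _; have [w we] := dense qf e0; have [sw /andP[_ hw]] := fW w.
  apply: (@le_trans _ _ ((1 + s) * (\sum_(i <- r) ip (W w) (E i) ^+ 2) + t * (C * e))).
    rewrite mulr_suml !mulr_sumr -big_split /=; apply: ler_sum => i _.
    rewrite ger0_norm ?sqr_ge0//.
    have -> : ip f (E i) = ip (W w) (E i) + ip (csub f (W w)) (E i) by rewrite ipBl//; ring.
    apply: le_trans (sqr_split _ _ s0) _; rewrite lerD2l ler_wpM2l//.
    apply: le_trans (cauchy_schwarz (csq_sub qf (qW w)) (qE i)) _.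
    by rewrite mulrC ler_wpM2l ?nn_ge0.
  have h1 : \sum_(i <- r) ip (W w) (E i) ^+ 2 <= B * nn (W w).
    by apply: le_trans hw; apply: ler_sum_rsum => // i; exact: sqr_ge0.
  have h2 : nn (W w) <= (1 + s) * nn f + t * e.
    have := nn_split (qW w) qf s0 => h; apply: le_trans h _; rewrite lerD2l ler_wpM2l//.
    apply: le_trans we; rewrite !nn_sub// (ipC f); lra.
  have s10 : 0 <= 1 + s by rewrite addr_ge0// ltW.
  have h3 := ler_wpM2l s10 (le_trans h1 (ler_wpM2l B0 h2)).
  apply: le_trans (lerD h3 (lexx _)) _.
  by apply: le_of_eq; ring.
have [s1 s2] := summ_bound H; split=> //.
by apply: le_trans s2; apply: le_of_eq; apply: eq_rsum => i; rewrite ger0_norm// sqr_ge0.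
Qed.

(** A lower bound cannot be read off from finite partial sums. Instead the Bessel bound just
    obtained, applied to the difference [W w - f], controls the whole frame sum of the approximation
    error. *)
Lemma frame_extend f : csq f -> summ (fun i => ip f (E i) ^+ 2) /\
  A * nn f <= rsum (fun i => ip f (E i) ^+ 2) <= B * nn f.
Proof.
move=> qf; have [sf fB] := bessel_extend qf; split=> //; rewrite fB andbT.
set G := rsum _ in fB *; have G0 : 0 <= G by apply: rsum_ge0 => i; exact: sqr_ge0.
apply: (@ler_addK _ _ (3 * G)); first by rewrite mulr_ge0.
move=> s s0 s1; apply: (@le_trans _ _ ((1 + s) ^+ 2 * G)); last exact: sqr_1Ds.
pose t := 1 + s^-1; have t0 : 0 <= t by rewrite addr_ge0// invr_ge0 ltW.
have s10 : 0 <= 1 + s by rewrite addr_ge0// ltW.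
apply: (@ler_addK _ _ ((1 + s) * (t * B) + A * t)).
  by rewrite addr_ge0// !mulr_ge0.
move=> e e0 _; have [w we] := dense qf e0; have [sw /andP[hw _]] := fW w.
have qs : csq (csub (W w) f) by exact: csq_sub.
have we' : nn (csub (W w) f) <= e by apply: le_trans we; rewrite !nn_sub// (ipC f); lra.
have [sd dB] := bessel_extend qs.
have h1 : rsum (fun i => ip (W w) (E i) ^+ 2) <= (1 + s) * G + t * (B * e).
  apply: (@le_trans _ _ ((1 + s) * G + t * rsum (fun i => ip (csub (W w) f) (E i) ^+ 2))).
    rewrite /G -rsumZ// -[X in _ + X]rsumZ// -rsumD; [|exact: summZ|exact: summZ].
    apply: ler_rsum => //; first by apply: summD; exact: summZ.
    move=> i; have -> : ip (W w) (E i) = ip f (E i) + ip (csub (W w) f) (E i).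
      by rewrite ipBl//; ring.
    exact: sqr_split.
  by rewrite lerD2l ler_wpM2l// (le_trans dB)// ler_wpM2l.
have h2 : A * nn f <= A * ((1 + s) * nn (W w) + t * e).
  rewrite ler_wpM2l//; apply: le_trans (nn_split qf (qW w) s0) _.
  by rewrite lerD2l ler_wpM2l.
have h3 := ler_wpM2l s10 (le_trans hw h1).
apply: le_trans h2 _; apply: le_trans (_ : (1 + s) * (A * nn (W w)) + A * t * e <= _).
  by apply: le_of_eq; ring.
apply: le_trans (lerD h3 (lexx _)) _.
by apply: le_of_eq; ring.
Qed.

End Extension.
End RealL2.


(** * Finite combinations of Gaussian shifts as functions *)

Section Waves.
Context {R : realType}.
Local Notation mu := (@lebesgue_measure R).
Local Notation pt := (R * R)%type.
Local Notation IN u := (mu.-integrable [set: R] (EFin \o (u : R -> R))).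
Implicit Types (l : pt) (a b : @atom R) (s : seq (@atom R)).

Definition g0 (t : R) : R := 2 `^ 4^-1 * expR (- pi * t ^+ 2).

Lemma g0_gt0 t : 0 < g0 t.
Proof. by rewrite mulr_gt0 ?expR_gt0 ?powR_gt0. Qed.

Lemma derivable_g0 (t : R) : derivable g0 t 1.
Proof. by rewrite /g0; exact: ex_derive. Qed.

(** The product of the two Gaussians is a Gaussian of scale [sqrt 2] centred at the midpoint, times
    a factor that depends on [x - y] alone; the rest is [osc_integral]. *)
Lemma gauss_corr (p xi x y : R) :
  IN (fun t => g0 (t - x) * g0 (t - y) * cos (p + 2 * pi * xi * t)) /\
  \int[mu]_(t in [set: R]) (g0 (t - x) * g0 (t - y) * cos (p + 2 * pi * xi * t)) =
  expR (- (pi / 2 * ((x - y) ^+ 2 + xi ^+ 2))) * cos (p + pi * xi * (x + y)).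
Proof.
have s0 : 0 < Num.sqrt 2 :> R by rewrite sqrtr_gt0.
have s2 : Num.sqrt 2 ^+ 2 = 2 :> R by rewrite sqr_sqrtr.
have [h1 h2] := osc_integral ((x + y) / Num.sqrt 2) p xi s0.
have e : (fun t => g0 (t - x) * g0 (t - y) * cos (p + 2 * pi * xi * t)) =
    fun t => (Num.sqrt 2 * expR (- (pi / 2 * (x - y) ^+ 2))) *
      (gau (Num.sqrt 2) ((x + y) / Num.sqrt 2) t * cos (p + 2 * pi * xi * t)).
  apply/funext => t; rewrite [RHS]mulrA; congr (_ * _).
  have r2 : 2 `^ 4^-1 * 2 `^ 4^-1 = Num.sqrt 2 :> R.
    by rewrite -powRD ?pnatr_eq0 ?implybT// -powR12_sqrt//; congr (_ `^ _); field.
  rewrite /g0 /gau mulrACA r2 -[RHS]mulrA; congr (_ * _); rewrite -!expRD; congr expR.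
  move: (Num.sqrt 2) s2 (lt0r_neq0 s0) => S s2 S0.
  have -> : (S * t - (x + y) / S) ^+ 2 = S ^+ 2 * t ^+ 2 - 2 * t * (x + y) + (x + y) ^+ 2 / S ^+ 2.
    by field.
  by rewrite s2; move: (pi) => P; field.
rewrite e; split; first exact: integZ.
rewrite RintegralZl// h2.
have -> : (x + y) / Num.sqrt 2 / Num.sqrt 2 = (x + y) / 2 :> R by rewrite -mulrA -invfM -expr2 s2.
have -> : (xi / Num.sqrt 2) ^+ 2 = xi ^+ 2 / 2 by rewrite expr_div_n s2.
have -> : p + 2 * pi * xi * ((x + y) / 2) = p + pi * xi * (x + y) by field.
rewrite mulrA mulrA; congr (_ * _).
rewrite mulrACA mulfV ?gt_eqF// mul1r -expRD; congr expR.
by move: (pi) => P; field.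
Qed.

Definition phs a (t : R) : R := a.1.2 - pi * a.2.1 * a.2.2 + 2 * pi * a.2.2 * t.

Definition wave s : cfun :=
  (fun t => \sum_(a <- s) a.1.1 * (g0 (t - a.2.1) * cos (phs a t)),
   fun t => \sum_(a <- s) a.1.1 * (g0 (t - a.2.1) * sin (phs a t))).

Lemma sqint_wave1 a : sqint (fun t => g0 (t - a.2.1) * cos (phs a t)) /\
  sqint (fun t => g0 (t - a.2.1) * sin (phs a t)).
Proof.
(* The sine is a cosine with its phase moved by [- (pi / 2)], so a free angle [th] covers both
   parts. *)
have c (th : R) : sqint (fun t => g0 (t - a.2.1) * cos (th + phs a t)).
  split.
    apply: continuous_measurable_fun; apply: derivable_cont => t.
    by rewrite /g0 /phs; exact: ex_derive.
  have [i _] := gauss_corr 0 0 a.2.1 a.2.1; apply: le_int i.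
    apply: continuous_measurable_fun; apply: derivable_cont => t.
    by rewrite /g0 /phs; exact: ex_derive.
  move=> t; rewrite mulr0 mul0r addr0 cos0 mulr1 -expr2 exprMn normrM ger0_norm ?sqr_ge0//.
  by rewrite ler_piMr ?sqr_ge0// normrX expr_le1// cos_max.
split; first by have := c 0; congr sqint; apply/funext => t; rewrite add0r.
have := c (- (pi / 2)); congr sqint; apply/funext => t; congr (_ * _).
by rewrite addrC cosB cos_pihalf sin_pihalf mulr0 add0r mulr1.
Qed.

Lemma sqint_comb s (k : @atom R -> R -> R) : (forall a, sqint (k a)) ->
  sqint (fun t => \sum_(a <- s) a.1.1 * k a t).
Proof.
move=> sk; elim: s => [|a s IH].
  rewrite (_ : (fun t => _) = fun t => 0 * k (0, 0, (0, 0)) t); first exact: sqintZ.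
  by apply/funext => t; rewrite big_nil mul0r.
rewrite (_ : (fun t => _) = fun t => a.1.1 * k a t + \sum_(a <- s) a.1.1 * k a t).
  by apply: sqintD => //; exact: sqintZ.
by apply/funext => t; rewrite big_cons.
Qed.

Lemma csq_wave s : csq (wave s).
Proof.
by split; [apply: (sqint_comb s (fun a => (sqint_wave1 a).1))|apply: (sqint_comb s (fun a => (sqint_wave1 a).2))].
Qed.

Lemma ip_wave s s' : ip (wave s) (wave s') = \sum_(a <- s) \sum_(b <- s') Kf a b.
Proof.
have [q1 q2] := csq_wave s; have [q3 q4] := csq_wave s'.
rewrite /ip /dot -RintegralD//; try exact: sqint_prod.
pose F a b t := a.1.1 * b.1.1 * (g0 (t - a.2.1) * g0 (t - b.2.1) *
   cos ((a.1.2 - pi * a.2.1 * a.2.2 - (b.1.2 - pi * b.2.1 * b.2.2)) +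
     2 * pi * (a.2.2 - b.2.2) * t)).
have iF a b : IN (F a b).
  by apply: integZ; exact: (gauss_corr _ _ _ _).1.
have h a := @Rintegral_sum R setT _ s' (F a) measurableT (iF a).
have [_ h2] := @Rintegral_sum R setT _ s (fun a t => \sum_(b <- s') F a b t) measurableT (fun a => (h a).1).
transitivity (\int[mu]_(t in [set: R]) (\sum_(a <- s) \sum_(b <- s') F a b t)).
  congr (Rintegral _ _ _); apply/funext => t.
  rewrite /wave /= !mulr_suml -big_split; apply: eq_bigr => a _ /=.
  rewrite !mulr_sumr -big_split; apply: eq_bigr => b _ /=.
  rewrite /F.
  have -> : a.1.2 - pi * a.2.1 * a.2.2 - (b.1.2 - pi * b.2.1 * b.2.2) +
     2 * pi * (a.2.2 - b.2.2) * t = phs a t - phs b t by rewrite /phs; ring.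
  by rewrite cosB; ring.
rewrite h2; apply: eq_bigr => a _; rewrite (h a).2; apply: eq_bigr => b _.
rewrite /F RintegralZl//; last exact: (gauss_corr _ _ _ _).1.
rewrite (gauss_corr _ _ _ _).2 /Kf; congr (_ * (_ * cos _)).
by rewrite /symp /=; ring.
Qed.

Lemma nn_wave s : nn (wave s) = Bf s.
Proof. exact: ip_wave. Qed.

Lemma Bf_ge0 s : 0 <= Bf s.
Proof. by rewrite -nn_wave nn_ge0. Qed.

(* The phase undoes the symmetric normalization of [rho], so [shift l] is [pi l g]; the real and
   imaginary parts of [<f, pi l g>] are the pairings of [f] with [shift l] and [ishift l]. *)
Definition shift l : cfun := wave [:: (1, pi * l.1 * l.2, l)].
Definition ishift l : cfun := wave [:: (1, pi * l.1 * l.2 + pi / 2, l)].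

(** The two pairings are the sums of [A a] times the cosine and the sine of [psi a], and their
    squares add up to the double sum over [cos (psi a - psi b)]. *)
Lemma gf_ip s l : ip (wave s) (shift l) ^+ 2 + ip (wave s) (ishift l) ^+ 2 = gf s l.
Proof.
pose A a : R := a.1.1 * expR (- (pi / 2 * nsq (a.2 - l))).
pose psi a : R := a.1.2 - pi * l.1 * l.2 + pi * symp a.2 l.
have -> : ip (wave s) (shift l) = \sum_(a <- s) A a * cos (psi a).
  rewrite ip_wave; apply: eq_bigr => a _.
  by rewrite big_seq1 /Kf /= mulr1 mulrA.
have -> : ip (wave s) (ishift l) = \sum_(a <- s) A a * sin (psi a).
  rewrite ip_wave; apply: eq_bigr => a _.
  rewrite big_seq1 /Kf /= mulr1 mulrA; congr (_ * _).
  have -> : a.1.2 - (pi * l.1 * l.2 + pi / 2) + pi * symp a.2 l = psi a - pi / 2 by rewrite /psi; ring.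
  by rewrite cosB cos_pihalf sin_pihalf mulr0 add0r mulr1.
rewrite !expr2 !mulr_suml -big_split; apply: eq_bigr => a _ /=.
rewrite !mulr_sumr -big_split; apply: eq_bigr => b _ /=.
have -> : gK a b l = A a * A b * cos (psi a - psi b).
  rewrite /gK /A [in RHS]mulrACA -expRD -[RHS]mulrA; congr (_ * (expR _ * cos _)).
    by ring.
  by rewrite /psi /symp /=; ring.
by rewrite cosB; ring.
Qed.

Lemma gf_ge0 s l : 0 <= gf s l.
Proof. by rewrite -gf_ip addr_ge0 ?sqr_ge0. Qed.

Theorem gf_frame s : 2 * @bv R * nn (wave s) <= rsum (fun n => gf s (Sl n)) <= 2 * @av R * nn (wave s).
Proof. by rewrite nn_wave; apply: gf_bounds; exact: Bf_ge0. Qed.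

(** * Invariance under orthogonal maps of the phase plane *)

Section Rotation.
Variables c d e : R.
Hypotheses (cd : c ^+ 2 + d ^+ 2 = 1) (ee : e = 1 \/ e = -1).

(** The unit row [(c, d)] and the determinant [e] parametrize all orthogonal matrices. For [e = -1]
    the symplectic form changes sign, which corresponds to complex conjugation; hence the angle
    [e * a.1.2] in [rota]. *)
Definition rot (z : pt) : pt := (c * z.1 + d * z.2, e * (c * z.2 - d * z.1)).
Definition rota a : atom := (a.1.1, e * a.1.2, rot a.2).

Lemma rot_inv (z : pt) : rot (c * z.1 - e * d * z.2, d * z.1 + e * c * z.2) = z.
Proof.
have e2 : e ^+ 2 = 1 by case: ee => ->; ring.
case: z => x y; rewrite /rot /=; congr (_, _).
  rewrite -[RHS]mul1r -cd; ring.
rewrite -[RHS]mul1r -[X in _ = X * _]cd -[RHS]mul1r -e2; ring.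
Qed.

Lemma nsq_rot z : nsq (rot z) = nsq z.
Proof.
have e2 : e ^+ 2 = 1 by case: ee => ->; ring.
by rewrite /nsq /rot /= [(e * _) ^+ 2]exprMn e2 mul1r -[RHS]mul1r -cd; ring.
Qed.

Lemma rot_pt_inj z w : rot z = rot w -> z = w.
Proof.
have inv (v : pt) : (c * (rot v).1 - e * d * (rot v).2, d * (rot v).1 + e * c * (rot v).2) = v.
  have e2 : e ^+ 2 = 1 by case: ee => ->; ring.
  case: v => x y; rewrite /rot /=; congr (_, _).
    have -> : c * (c * x + d * y) - e * d * (e * (c * y - d * x)) =
      c * (c * x + d * y) - e ^+ 2 * (d * (c * y - d * x)) by ring.
    by rewrite e2 mul1r -[RHS]mul1r -cd; ring.
  have -> : d * (c * x + d * y) + e * c * (e * (c * y - d * x)) =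
    d * (c * x + d * y) + e ^+ 2 * (c * (c * y - d * x)) by ring.
  by rewrite e2 mul1r -[RHS]mul1r -cd; ring.
by move=> h; rewrite -(inv z) h inv.
Qed.

Lemma symp_rot z w : symp (rot z) (rot w) = e * symp z w.
Proof. by rewrite -[symp z w in RHS]mul1r -cd /symp /rot /=; ring. Qed.

Lemma rotB z w : rot (z - w) = rot z - rot w.
Proof. by rewrite /rot /=; congr (_, _) => /=; ring. Qed.

Lemma cos_e x : cos (e * x) = cos x.
Proof. by case: ee => ->; rewrite ?mul1r// mulN1r cosN. Qed.

Lemma Bf_rot s : Bf (map rota s) = Bf s.
Proof.
rewrite /Bf big_map; apply: eq_bigr => a _; rewrite big_map; apply: eq_bigr => b _.
rewrite /Kf /= -rotB nsq_rot symp_rot -[in RHS]cos_e; congr (_ * (_ * cos _)); ring.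
Qed.

Lemma gf_rot s l : gf (map rota s) (rot l) = gf s l.
Proof.
rewrite /gf big_map; apply: eq_bigr => a _; rewrite big_map; apply: eq_bigr => b _.
rewrite /gK /= -!rotB !nsq_rot symp_rot -[in RHS]cos_e; congr (_ * (_ * cos _)); ring.
Qed.

Lemma rota_surj s : exists s', s = map rota s'.
Proof.
have e2 : e ^+ 2 = 1 by case: ee => ->; ring.
exists [seq (a.1.1, e * a.1.2, (c * a.2.1 - e * d * a.2.2, d * a.2.1 + e * c * a.2.2)) | a <- s].
rewrite -map_comp -[LHS]map_id; apply: eq_map => -[[r th] z].
by rewrite /rota /= rot_inv mulrA -expr2 e2 mul1r.
Qed.

Lemma rot_frame s :
  2 * @bv R * nn (wave s) <= rsum (fun n => gf s (rot (Sl n))) <= 2 * @av R * nn (wave s).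
Proof.
have [s' ->] := rota_surj s; rewrite nn_wave Bf_rot -nn_wave.
by rewrite (eq_rsum (g := fun n => gf s' (Sl n)))//; [exact: gf_frame|move=> n; exact: gf_rot].
Qed.

Lemma rot_summ s : summ (fun n => gf s (rot (Sl n))).
Proof.
have [s' ->] := rota_surj s; have [h _ _] := janssen s'.
by apply: eq_summ h => n; rewrite gf_rot.
Qed.

Lemma rot_sharp (u : R) : let S := rsum (fun x => qz3 kappa x * cos (u * (x.1 - x.2)%:~R)) in
  exists W : nat -> seq (@atom R),
  nn (wave (W N)) / N%:R ^+ 2 @[N --> \oo] --> S /\
  rsum (fun n => gf (W N) (rot (Sl n))) / N%:R ^+ 2 @[N --> \oo] --> 2 * S ^+ 2.
Proof.
move=> S; have [h1 h2] := box_cvg u; exists (fun N => map rota (box u N)); split.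
  by under eq_cvg do rewrite nn_wave Bf_rot.
under eq_cvg do under eq_rsum do rewrite gf_rot.
exact: h2.
Qed.

End Rotation.
End Waves.

(** * Density of Gaussian wave packets *)

Import HBNNSimple.

Section Density.
Context {R : realType}.
Local Notation mu := (@lebesgue_measure R).
Local Notation IN u := (mu.-integrable [set: R] (EFin \o (u : R -> R))).
Local Notation g0 := (@g0 R).

(** Real trigonometric polynomials with arbitrary real frequencies. They form an algebra, so powers
    of a sine stay inside, and their products with the Gaussian are combinations of pure modulations
    of it. *)
Definition trig (h : R -> R) : Prop := exists s : seq (R * R * R),
  h = fun t => \sum_(x <- s) x.1.1 * cos (x.1.2 + 2 * pi * x.2 * t).

Lemma trig_cos r th w : trig (fun t => r * cos (th + 2 * pi * w * t)).
Proof. by exists [:: (r, th, w)]; apply/funext => t; rewrite big_seq1. Qed.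

Lemma trig_cst c : trig (fun=> c).
Proof.
have := trig_cos c 0 0; congr trig; apply/funext => t.
by rewrite mulr0 mul0r addr0 cos0 mulr1.
Qed.

Lemma trigD h k : trig h -> trig k -> trig (fun t => h t + k t).
Proof. by move=> [s ->] [s' ->]; exists (s ++ s'); apply/funext => t; rewrite big_cat. Qed.

Lemma trigM h k : trig h -> trig k -> trig (fun t => h t * k t).
Proof.
move=> [s ->] [s' ->].
exists ([seq (x.1.1 * y.1.1 / 2, x.1.2 + y.1.2, x.2 + y.2) | x <- s, y <- s'] ++
        [seq (x.1.1 * y.1.1 / 2, x.1.2 - y.1.2, x.2 - y.2) | x <- s, y <- s']).
apply/funext => t; rewrite big_cat !big_allpairs_dep /= mulr_suml -big_split.
apply: eq_bigr => x _; rewrite mulr_sumr -big_split; apply: eq_bigr => y _ /=.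
have -> : x.1.2 + y.1.2 + 2 * pi * (x.2 + y.2) * t =
  (x.1.2 + 2 * pi * x.2 * t) + (y.1.2 + 2 * pi * y.2 * t) by ring.
have -> : x.1.2 - y.1.2 + 2 * pi * (x.2 - y.2) * t =
  (x.1.2 + 2 * pi * x.2 * t) - (y.1.2 + 2 * pi * y.2 * t) by ring.
by move: (x.1.2 + _) (y.1.2 + _) => X Y; rewrite cosD cosB; field.
Qed.

Lemma trigZ c h : trig h -> trig (fun t => c * h t).
Proof. by apply: trigM; exact: trig_cst. Qed.

Lemma trigX h n : trig h -> trig (fun t => h t ^+ n).
Proof.
move=> th; elim: n => [|n IH]; first exact: trig_cst.
by have := trigM th IH; congr trig; apply/funext => t; rewrite exprS.
Qed.

Lemma trig_wave h : trig h ->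
  (exists s, wave s = (fun t => g0 t * h t, fun=> 0)) /\
  (exists s, wave s = (fun=> 0, fun t => g0 t * h t)).
Proof.
move=> [s ->].
(* Each cosine is split into two opposite frequencies with opposite phases, whose sum is real; the
   common phase [th] makes the result real for 0 and imaginary for [pi / 2]. *)
pose w (th : R) := flatten [seq [:: (x.1.1 / 2, x.1.2 + th, (0, x.2)); (x.1.1 / 2, - x.1.2 + th, (0, - x.2))] | x <- s] : seq (@atom R).
have e (th : R) : wave (w th) =
  (fun t => cos th * (g0 t * \sum_(x <- s) x.1.1 * cos (x.1.2 + 2 * pi * x.2 * t)),
   fun t => sin th * (g0 t * \sum_(x <- s) x.1.1 * cos (x.1.2 + 2 * pi * x.2 * t))).
  rewrite /wave /w; congr (_, _); apply/funext => t; rewrite big_flatten big_map !mulr_sumr;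
    apply: eq_bigr => x _; rewrite big_cons big_seq1 /phs /= !subr0 !mulr0 !mul0r !subr0;
    have [-> ->] : x.1.2 + th + 2 * pi * x.2 * t = th + (x.1.2 + 2 * pi * x.2 * t) /\
      - x.1.2 + th + 2 * pi * - x.2 * t = th - (x.1.2 + 2 * pi * x.2 * t) by split; ring.
    by rewrite cosD cosB; field.
  by rewrite sinD sinB; field.
split.
  exists (w 0); rewrite e; congr (_, _); apply/funext => t.
    by rewrite cos0 mul1r.
  by rewrite sin0 mul0r.
exists (w (pi / 2)); rewrite e; congr (_, _); apply/funext => t.
  by rewrite cos_pihalf mul0r.
by rewrite sin_pihalf mul1r.
Qed.

Lemma sqint_trig h : trig h -> sqint (fun t => g0 t * h t).
Proof. by move=> /trig_wave[[s e] _]; have [] := csq_wave s; rewrite e. Qed.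

Lemma sqint_g0 : sqint g0.
Proof. by have := sqint_trig (trig_cst 1); congr sqint; apply/funext => t; rewrite mulr1. Qed.

(** Approximability in norm by the Gaussian times trigonometric polynomials. The class is linear and
    closed under dominated pointwise limits, and these closure properties lead from rays to Borel
    sets, simple functions and all of L^2. *)
Definition appr (u : R -> R) : Prop := sqint u /\ forall e : R, 0 < e ->
  exists2 h, trig h & dot (fun t => u t - g0 t * h t) (fun t => u t - g0 t * h t) <= e.

Lemma dot_split (u v : R -> R) : sqint u -> sqint v ->
  dot (fun t => u t + v t) (fun t => u t + v t) <= 2 * dot u u + 2 * dot v v.
Proof.
move=> qu qv; have qd := sqintD qu qv; have qb := sqintB qu qv.
have := dot_ge0 (fun t => u t - v t).
have -> : dot (fun t => u t + v t) (fun t => u t + v t) = dot u u + 2 * dot u v + dot v v.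
  by rewrite (dotDl qu qv qd) !(dotC _ (fun t => u t + v t)) !dotDl// (dotC v u); ring.
have -> : dot (fun t => u t - v t) (fun t => u t - v t) = dot u u - 2 * dot u v + dot v v.
  by rewrite (dotBl qu qv qb) !(dotC _ (fun t => u t - v t)) !dotBl// (dotC v u); ring.
lra.
Qed.

Lemma dotZZ c (u : R -> R) : sqint u -> dot (fun t => c * u t) (fun t => c * u t) = c ^+ 2 * dot u u.
Proof.
by move=> qu; have qc := sqintZ c qu; rewrite dotZl// dotC dotZl// mulrA.
Qed.

Lemma appr_trig h : trig h -> appr (fun t => g0 t * h t).
Proof.
move=> th; split; first exact: sqint_trig.
move=> e e0; exists h => //.
rewrite (_ : (fun t => _) = fun t => 0 * g0 t); last by apply/funext => t; rewrite subrr mul0r.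
by rewrite (dotZZ _ sqint_g0)// expr0n mul0r ltW.
Qed.

Lemma apprD u v : appr u -> appr v -> appr (fun t => u t + v t).
Proof.
move=> [qu au] [qv av]; split; first exact: sqintD.
move=> e e0; have e4 : 0 < e / 4 by rewrite divr_gt0.
have [h th hu] := au _ e4; have [k tk kv] := av _ e4.
exists (fun t => h t + k t); first exact: trigD.
have := dot_split (sqintB qu (sqint_trig th)) (sqintB qv (sqint_trig tk)).
rewrite (_ : (fun t => u t - g0 t * h t + (v t - g0 t * k t)) = fun t => u t + v t - g0 t * (h t + k t)).
  by move=> H; apply: le_trans H _; lra.
by apply/funext => t; ring.
Qed.

Lemma apprZ c u : appr u -> appr (fun t => c * u t).
Proof.
move=> [qu au]; split; first exact: sqintZ.
move=> e e0; have c0 : 0 < c ^+ 2 + 1 by rewrite ltr_pwDr// sqr_ge0.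
have [h th hu] := au (e / (c ^+ 2 + 1)) (divr_gt0 e0 c0).
exists (fun t => c * h t); first exact: trigZ.
rewrite (_ : (fun t => _) = fun t => c * (u t - g0 t * h t)); last by apply/funext => t; ring.
rewrite dotZZ; last by apply: sqintB => //; exact: sqint_trig.
have h0 := dot_ge0 (fun t => u t - g0 t * h t).
apply: le_trans (_ : (c ^+ 2 + 1) * (e / (c ^+ 2 + 1)) <= _).
  by rewrite ler_pM ?sqr_ge0// lerDl.
by rewrite mulrC divfK// gt_eqF.
Qed.

Lemma appr_sum (n : nat) (u : nat -> R -> R) : (forall i, appr (u i)) -> appr (fun t => \sum_(i < n) u i t).
Proof.
move=> au; elim: n => [|n IH].
  have := apprZ 0 (au 0%N); congr appr; apply/funext => t; by rewrite big_ord0 mul0r.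
by have := apprD IH (au n); congr appr; apply/funext => t; rewrite big_ord_recr.
Qed.

Lemma Rintegral_cvg0 (f_ : nat -> R -> R) (G : R -> R) :
  (forall n, measurable_fun [set: R] (f_ n)) -> IN G -> (forall n t, `|f_ n t| <= G t) ->
  (forall t, f_ n t @[n --> \oo] --> 0) -> \int[mu]_(t in [set: R]) f_ n t @[n --> \oo] --> (0 : R).
Proof.
move=> mf iG fG f0.
have mF n : measurable_fun [set: R] (fun x => (f_ n x)%:E) by apply/measurable_EFinP; exact: mf.
pose z : R -> \bar R := EFin \o (fun=> 0 : R).
have [_ _] : [/\ mu.-integrable [set: R] z,
  [sequence \int[mu]_(x in [set: R]) `|(EFin \o f_ n) x - z x|]_n%E @ \oo --> 0%E &
  [sequence \int[mu]_(x in [set: R]) ((EFin \o f_ n) x)]_n%E @ \oo --> (\int[mu]_(x in [set: R]) (z x))%E].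
  apply: (@dominated_convergence _ _ _ mu setT measurableT (fun n => EFin \o f_ n) z (EFin \o G)) => //.
  - exact: measurable_cst.
  - by apply: aeW => x _; apply: cvg_EFin; [exact: nearW|exact: f0].
  - by apply: aeW => x n _; rewrite /= lee_fin.
by rewrite integral0 => /fine_cvg.
Qed.

Lemma appr_lim (u_ : nat -> R -> R) (u G : R -> R) : (forall n, appr (u_ n)) -> sqint G ->
  (forall n t, `|u_ n t| <= G t) -> (forall t, u_ n t @[n --> \oo] --> u t) -> appr u.
Proof.
move=> au [mG iG] uG cu.
have mu_ n : measurable_fun [set: R] (u_ n) by case: (au n) => -[].
have mu' : measurable_fun [set: R] u.
  apply/measurable_EFinP; apply: (@emeasurable_fun_cvg _ _ _ _ (fun n => EFin \o u_ n)).
    by move=> n; exact/measurable_EFinP.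
  by move=> t _; apply: cvg_EFin; [exact: nearW|exact: cu].
have uG' t : `|u t| <= G t.
  have c : `|u_ n t| @[n --> \oo] --> `|u t| by apply: cvg_norm; exact: cu.
  rewrite -(cvg_lim (@Rhausdorff R) c); apply: limr_le; first by apply/cvg_ex; exists `|u t|.
  by apply: nearW => n; exact: uG.
have su : sqint u.
  split=> //; apply: le_int iG; first exact: measurable_funX.
  by move=> t; rewrite normrX lerXn2r// ?nnegrE// (le_trans (normr_ge0 _) (uG' t)).
split=> // e e0.
have D n t : `|(u t - u_ n t) ^+ 2| <= 4 * G t ^+ 2.
  have := uG n t; have := uG' t; rewrite !ler_norml => /andP[? ?] /andP[? ?].
  by apply/andP; split; nra.
have c0 t : (u t - u_ n t) ^+ 2 @[n --> \oo] --> 0.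
  rewrite [X in _ --> X](_ : 0 = (u t - u t) ^+ 2); last by rewrite subrr expr0n.
  by under eq_cvg do rewrite expr2; rewrite expr2; apply: cvgM; apply: cvgB => //; exact: cvg_cst.
have m0 n : measurable_fun [set: R] (fun t => (u t - u_ n t) ^+ 2).
  by apply: measurable_funX; exact: measurable_funB.
have /cvgrPdist_lt/(_ (e / 4)) := Rintegral_cvg0 m0 (integZ 4 iG) D c0.
rewrite divr_gt0// => /(_ isT) [N _ /(_ N (leqnn N))].
rewrite sub0r normrN => /ltW /(le_trans (ler_norm _)) h1.
have [qN /(_ (e / 4))] := au N; rewrite divr_gt0// => /(_ isT)[h th hN].
exists h => //.
have := dot_split (sqintB su qN) (sqintB qN (sqint_trig th)).
rewrite (_ : (fun t => u t - u_ N t + (u_ N t - g0 t * h t)) = fun t => u t - g0 t * h t).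
  by move=> H; apply: le_trans H _; have : dot (fun t => u t - u_ N t) (fun t => u t - u_ N t) <= e / 4; [exact: h1|lra].
by apply/funext => t; ring.
Qed.

(** By the mean value theorem, with [cos c = 1 - 2 sin (c / 2)^2 >= 1/2] for [0 < c < 1]. *)
Lemma sin_ge_half (x : R) : 0 <= x <= 1 -> x / 2 <= sin x.
Proof.
move=> /andP[x0 x1].
have [->|xn] := eqVneq x 0; first by rewrite sin0 mul0r.
have xp : 0 < x by rewrite lt_def xn.
have [|c] := @MVT _ (@sin R) (@cos R) 0 x xp (fun y _ => is_derive_sin y).
  by apply: continuous_subspaceT; exact: continuous_sin.
rewrite in_itv /= => /andP[c0 cx]; rewrite sin0 !subr0 => ->; rewrite mulrC ler_wpM2r//.
have ch : 0 < c / 2 by rewrite divr_gt0.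
have h1 := sin_le ch.
have h2 : 0 <= sin (c / 2).
  by apply: sin_ge0_pi; rewrite ltW//=; have := @pi_ge3 R; lra.
have -> : cos c = 1 - 2 * sin (c / 2) ^+ 2.
  have -> : cos c = cos (c / 2 + c / 2) by congr cos; field.
  by rewrite cosD -!expr2 cos2sin2; ring.
by have : sin (c / 2) ^+ 2 <= (c / 2) ^+ 2 ; [rewrite lerXn2r// nnegrE ltW|nra].
Qed.

Lemma bernoulli_ineq (x : R) n : -1 <= x -> 1 + n%:R * x <= (1 + x) ^+ n.
Proof.
move=> x1; elim: n => [|n IH]; first by rewrite mul0r addr0.
have x0 : 0 <= 1 + x by lra.
rewrite exprS; apply: le_trans (ler_wpM2l x0 IH).
rewrite -natr1 -subr_ge0.
have -> : (1 + x) * (1 + n%:R * x) - (1 + (n%:R + 1) * x) = n%:R * x ^+ 2 by ring.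
by rewrite mulr_ge0 ?sqr_ge0.
Qed.

(** From [(1 - x)^n (1 + x)^n <= 1] and Bernoulli's inequality. *)
Lemma inv_bernoulli (x : R) n : 0 <= x <= 1 -> (1 - x) ^+ n <= (1 + n%:R * x)^-1.
Proof.
move=> /andP[x0 x1]; have d0 : 0 < 1 + n%:R * x by rewrite ltr_pwDl// mulr_ge0.
rewrite -[leRHS]mul1r ler_pdivlMr//.
have y0 : 0 <= 1 - x by rewrite subr_ge0.
apply: le_trans (_ : (1 - x) ^+ n * (1 + x) ^+ n <= _).
  by rewrite ler_wpM2l ?exprn_ge0// bernoulli_ineq// (le_trans _ x0)// lerN10.
by rewrite -exprMn exprn_ile1//; nra.
Qed.

(* [(1 - y ^ n) ^ (2 ^ n)] tends to 1 if [y < 1/2] and to 0 if [y > 1/2] *)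
Definition step (a : R) (m : nat) (t : R) : R :=
  (1 - ((1 - sin ((t - a) / m%:R + (m%:R ^+ 2)^-1)) / 2) ^+ (m ^ 3)) ^+ (2 ^ (m ^ 3)).

Lemma trig_step a m : trig (step a m).
Proof.
rewrite /step; apply: (@trigX (fun t => 1 - ((1 - sin ((t - a) / m%:R + (m%:R ^+ 2)^-1)) / 2) ^+ (m ^ 3))).
have t1 : trig (fun t : R => (1 - sin ((t - a) / m%:R + (m%:R ^+ 2)^-1)) / 2).
  have := trigZ 2^-1 (trigD (trig_cst 1) (trig_cos (-1) (- a / m%:R + (m%:R ^+ 2)^-1 - pi / 2) (m%:R^-1 / (2 * pi)))).
  congr trig; apply/funext => t; rewrite mulrC; congr (_ * _); rewrite mulN1r; congr (_ - _).
  have -> : - a / m%:R + (m%:R ^+ 2)^-1 - pi / 2 + 2 * pi * (m%:R^-1 / (2 * pi)) * t =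
    ((t - a) / m%:R + (m%:R ^+ 2)^-1) - pi / 2.
    have p0 : (2 * pi : R) != 0 by rewrite mulf_neq0// gt_eqF// pi_gt0.
    by rewrite [2 * pi * _]mulrCA mulfV// mulr1; ring.
  by rewrite cosB cos_pihalf sin_pihalf mulr0 add0r mulr1.
have := trigD (trig_cst 1) (trigZ (-1) (trigX (m ^ 3) t1)).
by congr trig; apply/funext => t; rewrite mulN1r.
Qed.

Lemma step_half (x : R) : 0 <= (1 - sin x) / 2 <= 1.
Proof. by have := sin_geN1 x; have := sin_le1 x; lra. Qed.

Lemma step_bound a m t : 0 <= step a m t <= 1.
Proof.
have /andP[h0 h1] := step_half ((t - a) / m%:R + (m%:R ^+ 2)^-1).
have e0 : 0 <= ((1 - sin ((t - a) / m%:R + (m%:R ^+ 2)^-1)) / 2) ^+ (m ^ 3) <= 1.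
  by rewrite exprn_ge0//= exprn_ile1.
rewrite /step; move: (_ ^+ (m ^ 3)) e0 => z /andP[z0 z1].
by rewrite exprn_ge0 ?subr_ge0//= exprn_ile1 ?subr_ge0// gerBl.
Qed.

(** Division by [m] brings the argument of the sine into [[-1, 1]]. The offset [m^-2] decides the
    point [t = a] in favour of 1, and it makes the sine at least [m^-2 / 2] in absolute value on
    either side for large [m]. The exponent [n = m^3] turns this into [n |sin x| >= m / 2], and
    Bernoulli's inequality then bounds the error by [1 / (1 + m / 2)] in both cases. *)
Lemma step_lim a t : step a m t @[m --> \oo] --> ((a <= t)%R%:R : R).
Proof.
apply/cvgrPdist_le => e e0; near=> m.
have m0 : (0 : R) < m%:R by rewrite ltr0n; near: m; exact: nbhs_infty_gt.
have m1 : (1 : R) <= m%:R by rewrite ler1n; near: m; exact: nbhs_infty_gt.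
have mt : `|t - a| + 2 < m%:R by near: m; exact: nbhs_infty_gtr.
have me : 2 / e < m%:R by near: m; exact: nbhs_infty_gtr.
have md : 2 / `|t - a| < m%:R by near: m; exact: nbhs_infty_gtr.
pose x := (t - a) / m%:R + (m%:R ^+ 2)^-1.
pose n := (m ^ 3)%N.
have nE : n%:R = m%:R ^+ 3 :> R by rewrite natrX.
have i2 : (0 : R) < (m%:R ^+ 2)^-1 by rewrite invr_gt0 exprn_gt0.
have small : (1 + m%:R / 2)^-1 <= e.
  rewrite -[leLHS]mul1r ler_pdivrMr; last by rewrite ltr_pwDl// divr_ge0.
  by move: me; rewrite ltr_pdivrMr//; nra.
suff : `|(a <= t)%R%:R - step a m t| <= (1 + m%:R / 2)^-1 by move=> h; exact: le_trans h small.
have /andP[b0 b1] := step_bound a m t.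
have nx (s : R) : (m%:R ^+ 2)^-1 / 2 <= s -> m%:R / 2 <= n%:R * s.
  move=> h; have n0 : (0 : R) <= n%:R by [].
  have := ler_wpM2l n0 h; rewrite nE => h'; apply: le_trans h'.
  by apply: le_of_eq; field; rewrite gt_eqF.
have xa : `|x| <= 1.
  rewrite (le_trans (ler_normD _ _))// normrM (gtr0_norm i2) normfV (gtr0_norm m0).
  rewrite -(ler_pM2r m0) mulrDl divfK ?gt_eqF// mul1r.
  have : (m%:R ^+ 2)^-1 * m%:R <= 1 :> R.
    by rewrite mulrC ler_pdivrMr ?exprn_gt0// mul1r expr2 ler_peMl// ltW.
  by move: mt => /ltW; lra.
have [at_|ta] := leP a t.
  have x0 : (m%:R ^+ 2)^-1 <= x by rewrite lerDr divr_ge0 ?subr_ge0// ltW.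
  have x01 : 0 <= x <= 1 by rewrite (le_trans (ltW i2) x0)/= (le_trans (ler_norm _) xa).
  have s1 := sin_ge_half x01.
  have s2 : (m%:R ^+ 2)^-1 / 2 <= sin x by apply: le_trans s1; rewrite ler_pM2r.
  have s0 : 0 <= sin x <= 1 by rewrite sin_le1 (le_trans _ s2)// divr_ge0// ltW.
  rewrite ger0_norm ?subr_ge0//.
  apply: le_trans (_ : (1 - sin x) ^+ n <= _).
    rewrite /step -/x -/n lerBlDr addrC -lerBlDr.
    apply: le_trans (bernoulli_ineq (2 ^ n) (x := - ((1 - sin x) / 2) ^+ n) _).
      by rewrite mulrN natrX expr_div_n mulrCA mulfV ?expf_neq0// mulr1.
    by rewrite lerN2; have /andP[? ?] := step_half x; rewrite exprn_ile1.
  apply: le_trans (inv_bernoulli n s0) _.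
  by rewrite lef_pV2 ?posrE ?lerD2l ?nx// ltr_pwDl// ?mulr_ge0// ?divr_ge0//; case/andP: s0.
have x0 : (m%:R ^+ 2)^-1 <= - x.
  have dt : 0 < `|t - a| by rewrite normr_gt0 subr_eq0 lt_eqF.
  move: md; rewrite ltr_pdivrMr// ltr0_norm ?subr_lt0// opprB => md.
  rewrite -(ler_pM2r (exprn_gt0 2 m0)) /x mulNr mulrDl mulVf ?gt_eqF ?exprn_gt0//.
  have -> : (t - a) / m%:R * m%:R ^+ 2 = (t - a) * m%:R by field; rewrite gt_eqF.
  by nra.
have x01 : 0 <= - x <= 1 by rewrite (le_trans (ltW i2) x0)/=; move: xa; rewrite ler_norml => /andP[? _]; lra.
have s1 := sin_ge_half x01; rewrite sinN in s1.
have s2 : (m%:R ^+ 2)^-1 / 2 <= - sin x by apply: le_trans s1; rewrite ler_pM2r.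
rewrite sub0r normrN ger0_norm// /step -/x -/n.
have /andP[h0 h1] := step_half x.
apply: le_trans (inv_bernoulli _ _) _; first by rewrite exprn_ge0//= exprn_ile1.
have e1 : (2 ^ n)%:R * ((1 - sin x) / 2) ^+ n = (1 - sin x) ^+ n.
  by rewrite natrX expr_div_n mulrCA mulfV ?expf_neq0// mulr1.
rewrite e1 lef_pV2 ?posrE ?lerD2l; last 2 first.
- by rewrite ltr_pwDl// exprn_ge0//; have := sin_le1 x; lra.
- by rewrite ltr_pwDl// divr_ge0.
apply: le_trans (nx _ s2) _; apply: le_trans (bernoulli_ineq n (x := - sin x) _).
  by rewrite lerDr.
by rewrite lerN2 sin_le1.
Unshelve. all: by end_near. Qed.

Lemma appr_ray a : appr (fun t => g0 t * \1_(`[a, +oo[%classic : set R) t).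
Proof.
apply: (@appr_lim (fun m t => g0 t * step a m t) _ g0 _ sqint_g0).
- by move=> m; apply: appr_trig; exact: trig_step.
- move=> m t; have /andP[h0 h1] := step_bound a m t.
  by rewrite normrM (ger0_norm h0) gtr0_norm ?g0_gt0// ler_piMr// ltW// g0_gt0.
move=> t; apply: cvgM; first exact: cvg_cst.
have -> : \1_(`[a, +oo[%classic : set R) t = (a <= t)%R%:R :> R.
  by rewrite indicE mem_setE in_itv /= andbT.
exact: step_lim.
Qed.

Lemma sum_indic (F : nat -> set R) (t : R) : trivIset [set: nat] F ->
  (forall n, \sum_(i < n) \1_(F i) t = 0 :> R) /\ ~ (\bigcup_k F k) t \/
  exists2 k, (\bigcup_k F k) t & forall n, \sum_(i < n) \1_(F i) t = (k < n)%N%:R :> R.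
Proof.
move=> tF; have [[k _ Fk]|nF] := pselect ((\bigcup_k F k) t).
  right; exists k; first by exists k.
  move=> n; have [kn|nk] := ltnP k n.
    rewrite (bigD1 (Ordinal kn))//= indicE mem_set// big1 ?addr0// => i ik.
    rewrite indicE memNset// => Fi; move/eqP: ik; apply; apply/val_inj => /=.
    by apply: tF => //; exists t.
  rewrite big1// => i _; rewrite indicE memNset// => Fi.
  have ik : (i : nat) = k by apply: tF => //; exists t.
  by move: (ltn_ord i); rewrite ik ltnNge nk.
left; split=> // n; rewrite big1// => i _; rewrite indicE memNset// => Fi.
by apply: nF; exists i.
Qed.

(** The rays [[a, +oo)] are stable under intersection and generate the Borel sets, so Dynkin's
    theorem applies: complements are differences from the whole line, and disjoint unions are limits
    dominated by [g0]. *)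
Lemma appr_indic (A : set R) : measurable A -> appr (fun t => g0 t * \1_A t).
Proof.
have E : @measurable _ (measurableTypeR R) = <<s @RGenCInfty.G R >>.
  exact: RGenCInfty.measurableE.
move=> mA; have {mA} : <<s @RGenCInfty.G R >> A by rewrite -E; exact: mA.
move: A.
apply: (@dynkin_induction _ (measurableTypeR R) _ (fun A : set R => appr (fun t => g0 t * \1_A t)) E).
- move=> _ _ [x ->] [y ->]; exists (Num.max x y).
  by rewrite predeqE => t /=; rewrite !in_itv /= !andbT ge_max; split=> [[-> ->]|/andP[]].
- have := appr_trig (trig_cst 1); congr appr; apply/funext => t.
  by rewrite indicE in_setT.
- by move=> _ [x ->]; exact: appr_ray.
- move=> A _ aA; have := apprD (appr_trig (trig_cst 1)) (apprZ (-1) aA).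
  congr appr; apply/funext => t; rewrite !indicE in_setC.
  by case: (t \in A) => /=; ring.
move=> F _ tF aF.
apply: (@appr_lim (fun n t => \sum_(i < n) g0 t * \1_(F i) t) _ g0 _ sqint_g0).
- by move=> n; exact: (@appr_sum n (fun i t => g0 t * \1_(F i) t)).
- move=> n t; rewrite -mulr_sumr normrM (gtr0_norm (g0_gt0 t)) ler_piMr ?(ltW (g0_gt0 t))//.
  by have [[->]|[k _ ->]] := sum_indic t tF; [|case: (k < n)%N]; rewrite ?normr1 ?normr0.
move=> t; under eq_cvg do rewrite -mulr_sumr.
apply: cvgM; first exact: cvg_cst.
have [[e nF]|[k Fk e]] := sum_indic t tF.
  by rewrite indicE memNset//; under eq_cvg do rewrite e; exact: cvg_cst.
rewrite indicE mem_set//; apply: cvg_near_cst; near=> n.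
by rewrite e; have -> : (k < n)%N by near: n; exact: nbhs_infty_gt.
Unshelve. all: by end_near. Qed.

(** Simple functions increase to [u / g0], where [g0] is positive everywhere; multiplied by [g0]
    they are dominated by [u] itself. *)
Lemma appr_nneg u : sqint u -> (forall t, 0 <= u t) -> appr u.
Proof.
move=> su u0; pose phi t := u t / g0 t.
have gp t : 0 < g0 t := g0_gt0 t.
have phi0 t : 0 <= phi t by rewrite divr_ge0// ltW.
have mphi : measurable_fun [set: R] (fun t => (phi t)%:E).
  apply/measurable_EFinP; apply: measurable_funM; first by case: su.
  apply: continuous_measurable_fun => t; apply: cvgV; first by rewrite gt_eqF.
  by apply: derivable_cont; exact: derivable_g0.
pose g := nnsfun_approx measurableT mphi.
have gcv t := @cvg_nnsfun_approx _ _ R _ measurableT _ mphi (fun t _ => phi0 t) t I.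
have gc t : g n t @[n --> \oo] --> phi t by have /fine_cvg := gcv t.
have gle n t : g n t <= phi t.
  rewrite -(cvg_lim (@Rhausdorff R) (gc t)); apply: (@nondecreasing_cvgn_le R (fun n => g n t)).
    by move=> i j ij; have /lefP := nd_nnsfun_approx measurableT mphi ij; exact.
  by apply/cvg_ex; exists (phi t).
apply: (@appr_lim (fun n t => g0 t * g n t) u u _ su).
- move=> n; pose s := fset_set (range (g n)).
  have := @appr_sum #|` s| (fun i t => s`_i * (g0 t * \1_(g n @^-1` [set s`_i]) t)).
  rewrite (_ : (fun t => \sum_(i < _) _) = fun t => g0 t * g n t).
    by apply => i; apply: apprZ; apply: appr_indic; exact: measurable_funPTI.
  apply/funext => t; rewrite [in RHS](fimfunEord (g n)) mulr_sumr; apply: eq_bigr => i _.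
  by rewrite mulrCA.
- move=> n t; rewrite ger0_norm ?mulr_ge0 ?(ltW (gp t))//.
  by rewrite mulrC -ler_pdivlMr// gle.
move=> t; have -> : u t = g0 t * phi t by rewrite /phi mulrC divfK// gt_eqF.
by apply: cvgM; [exact: cvg_cst|exact: gc].
Qed.

Lemma appr_sqint u : sqint u -> appr u.
Proof.
move=> su; have [mu_ iu] := su.
have sn : sqint (fun t => `|u t|).
  split; first by apply: measurableT_comp => //; exact: measurable_normr.
  by rewrite (_ : (fun t => _) = fun t => u t ^+ 2)//; apply/funext => t; rewrite real_normK ?num_real.
have := apprZ 2^-1 (apprD (appr_nneg (sqintD sn su) _) (apprZ (-1) (appr_nneg (sqintB sn su) _))).
rewrite (_ : (fun t => 2^-1 * _) = u).
  apply => t; first by have := ler_norm (- u t); rewrite normrN; lra.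
  by rewrite subr_ge0 ler_norm.
by apply/funext => t; field.
Qed.

Theorem wave_dense (f : cfun) : csq f -> forall e : R, 0 < e ->
  exists s, nn (csub f (wave s)) <= e.
Proof.
move=> [q1 q2] e e0; have e2 : 0 < e / 2 by rewrite divr_gt0.
have [_ /(_ _ e2)[h th h1]] := appr_sqint q1; have [_ /(_ _ e2)[k tk h2]] := appr_sqint q2.
have [[s es] _] := trig_wave th; have [_ [s' es']] := trig_wave tk.
exists (s ++ s').
have -> : wave (s ++ s') = (fun t => g0 t * h t, fun t => g0 t * k t).
  have -> : wave (s ++ s') = (fun t => (wave s).1 t + (wave s').1 t, fun t => (wave s).2 t + (wave s').2 t).
    by rewrite /wave /=; congr (_, _); apply/funext => t; rewrite big_cat.
  by rewrite es es'; congr (_, _); apply/funext => t /=; rewrite ?addr0 ?add0r.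
by rewrite /nn /ip /=; lra.
Qed.

End Density.

(** * Frame bounds *)

Section Frames.
Context {R : realType}.
Local Notation mu := (@lebesgue_measure R).
Local Notation IN u := (mu.-integrable [set: R] (EFin \o (u : R -> R))).
Implicit Types (f : R -> R[i]) (h : @cfun R).

Definition reim f : @cfun R := (fun t => complex.Re (f t), fun t => complex.Im (f t)).
Definition ofpair h (t : R) : R[i] := Complex (h.1 t) (h.2 t).

Lemma reimK h : reim (ofpair h) = h. Proof. by case: h. Qed.

Lemma normc_sqr (z : R[i]) : Normc.normc z ^+ 2 = complex.Re z ^+ 2 + complex.Im z ^+ 2.
Proof. by case: z => a b /=; rewrite sqr_sqrtr// addr_ge0// sqr_ge0. Qed.

Lemma L2norm_int f : L2norm f =
  ((\int[mu]_t (complex.Re (f t) ^+ 2 + complex.Im (f t) ^+ 2)%:E) `^ 2^-1)%E.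
Proof.
rewrite /L2norm unlock; congr (poweR _ _); apply: eq_integral => t _.
have n0 : 0 <= Normc.normc (f t) by case: (f t) => a b; exact: sqrtr_ge0.
by rewrite gee0_abs ?lee_fin// poweR_EFin -normc_sqr -powR_mulrn.
Qed.

Lemma int_nn f : csq (reim f) ->
  (\int[mu]_t (complex.Re (f t) ^+ 2 + complex.Im (f t) ^+ 2)%:E)%E = (nn (reim f))%:E.
Proof.
move=> [q1 q2]; rewrite /nn /ip /dot -RintegralD//; try exact: sqint_prod.
rewrite /Rintegral fineK.
  by apply: eq_integral => t _ /=; rewrite !expr2.
have := integD (sqint_prod q1 q1) (sqint_prod q2 q2).
by move=> /(integrable_fin_num measurableT).
Qed.

Lemma L2norm_nn f : csq (reim f) -> L2norm f = (Num.sqrt (nn (reim f)))%:E.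
Proof.
by move=> q; rewrite L2norm_int int_nn// poweR_EFin powR12_sqrt// nn_ge0.
Qed.

Lemma L2norm_sqr f : csq (reim f) -> (L2norm f ^+ 2)%E = (nn (reim f))%:E.
Proof. by move=> q; rewrite L2norm_nn// -EFin_expe sqr_sqrtr// nn_ge0. Qed.

Lemma csq_L2 h : csq h -> L2 (ofpair h).
Proof.
move=> q; have q' : csq (reim (ofpair h)) by rewrite reimK.
split; last by rewrite L2norm_nn// ltry.
by case: q => -[m1 _] [m2 _].
Qed.

Lemma L2_csq f : L2 f -> csq (reim f).
Proof.
move=> [[m1 m2] foo].
have i : (\int[mu]_t (complex.Re (f t) ^+ 2 + complex.Im (f t) ^+ 2)%:E < +oo)%E.
  rewrite ltey; apply/eqP => e; move: foo.
  by rewrite L2norm_int e poweRyr ?invr_neq0.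
have iN : IN (fun t => complex.Re (f t) ^+ 2 + complex.Im (f t) ^+ 2).
  apply/integrableP; split.
    apply/measurable_EFinP; apply: measurable_funD; exact: measurable_funX.
  apply: le_lt_trans i; apply: le_of_eq.
  by apply: eq_integral => t _ /=; rewrite ger0_norm// addr_ge0 ?sqr_ge0.
split; split => //; apply: le_int iN; try exact: measurable_funX.
  by move=> t; rewrite ger0_norm ?sqr_ge0// lerDl sqr_ge0.
by move=> t; rewrite ger0_norm ?sqr_ge0// lerDr sqr_ge0.
Qed.

Definition topt (l : 'cV[R]_2) : R * R := (l 0 0, l 1 0).

Lemma tfshiftE (l : 'cV[R]_2) t : tfshift l (@gaussian R) t =
  Complex ((shift (topt l)).1 t) ((shift (topt l)).2 t).
Proof.
rewrite /tfshift /gaussian /cis /shift /wave /topt /= !big_seq1 /phs /= !mul1r.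
rewrite subrr add0r -/(g0 _).
by apply/eqP; rewrite eq_complex /= !(mulr0, mul0r, subr0, add0r, addr0) ![_ * g0 _]mulrC !eqxx.
Qed.

(** Adding [pi / 2] to the angle multiplies by the imaginary unit. *)
Lemma ishiftE (l : R * R) : ishift l = (fun t => - (shift l).2 t, (shift l).1).
Proof.
rewrite /ishift /shift /wave; congr (_, _); apply/funext => t; rewrite /= !big_seq1 /phs /= !mul1r;
  rewrite (_ : pi * l.1 * l.2 + pi / 2 - pi * l.1 * l.2 + 2 * pi * l.2 * t =
    (pi * l.1 * l.2 - pi * l.1 * l.2 + 2 * pi * l.2 * t) + pi / 2); try by ring.
  by rewrite cosD cos_pihalf sin_pihalf mulr0 mulr1 sub0r mulrN.
by rewrite sinD cos_pihalf sin_pihalf mulr0 mulr1 add0r.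
Qed.

Lemma inner_sqr f (l : 'cV[R]_2) : csq (reim f) ->
  Normc.normc (inner f (tfshift l (@gaussian R))) ^+ 2 =
  ip (reim f) (shift (topt l)) ^+ 2 + ip (reim f) (ishift (topt l)) ^+ 2.
Proof.
move=> [q1 q2]; have [s1 s2] := csq_wave [:: (1, pi * (topt l).1 * (topt l).2, topt l)].
rewrite normc_sqr /inner /cintegral /=; congr (_ ^+ 2 + _ ^+ 2).
  rewrite /ip /dot -RintegralD//; try exact: sqint_prod.
  congr (Rintegral _ _ _); apply/funext => t; rewrite tfshiftE.
  by rewrite /reim /=; case: (f t) => a b /=; rewrite mulrN opprK.
rewrite ishiftE /ip /dot.
have e : (fun t => (reim f).1 t * - (shift (topt l)).2 t) =
    fun t => (-1) * ((reim f).1 t * (shift (topt l)).2 t).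
  by apply/funext => t; ring.
have i1 := sqint_prod q1 s2; have i2 := sqint_prod q2 s1.
rewrite /= e RintegralZl// mulN1r addrC -RintegralB//.
congr (Rintegral _ _ _); apply/funext => t.
rewrite tfshiftE -[\sum_(a <- _) _]/((shift (topt l)).1 t) -[(reim f).1 t]/(complex.Re (f t)).
move: ((shift (topt l)).1 t) ((shift (topt l)).2 t) => A B.
by case: (f t) => a b /=; ring.
Qed.

(** * Hexagonal lattices in arbitrary position *)

Section Hex.
Variable Q : 'M[R]_2.
Hypothesis QQ : Q *m Q^T = 1%:M.
Let c := Q 0 0.
Let d := Q 0 1.
Let e := Q 0 0 * Q 1 1 - Q 0 1 * Q 1 0.
Local Notation P n := (rot c d e (Sl n)).

Lemma orth_entries : [/\ c ^+ 2 + d ^+ 2 = 1, e = 1 \/ e = -1, Q 1 0 = - (e * d) & Q 1 1 = e * c].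
Proof.
have E i j : \sum_(k < 2) Q i k * Q j k = (i == j)%:R.
  have := congr1 (fun M : 'M[R]_2 => M i j) QQ; rewrite !mxE => <-.
  by apply: eq_bigr => k _; rewrite !mxE.
have := E 0 0; have := E 0 1; have := E 1 1.
rewrite !big_ord_recl !big_ord0 /= !addr0.
have -> : lift ord0 ord0 = 1 :> 'I_2 by apply/val_inj.
rewrite -/c -/d /e -/c -/d; move: (Q 1 0) (Q 1 1) => x y h11 h01 h00.
have h : c ^+ 2 + d ^+ 2 = 1 by rewrite !expr2.
have o : c * x + d * y = 0 by [].
have u : x ^+ 2 + y ^+ 2 = 1 by rewrite !expr2.
split=> //.
- have : (c * y - d * x) ^+ 2 = 1.
    have -> : (c * y - d * x) ^+ 2 = (c ^+ 2 + d ^+ 2) * (x ^+ 2 + y ^+ 2) - (c * x + d * y) ^+ 2 by ring.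
    by rewrite h u o; ring.
  by move/eqP; rewrite sqrf_eq1 => /orP[]/eqP; [left|right].
- have -> : - ((c * y - d * x) * d) = (c ^+ 2 + d ^+ 2) * x - c * (c * x + d * y) by ring.
  by rewrite h o; ring.
- have -> : (c * y - d * x) * c = (c ^+ 2 + d ^+ 2) * y - d * (c * x + d * y) by ring.
  by rewrite h o; ring.
Qed.

Lemma cd1 : c ^+ 2 + d ^+ 2 = 1. Proof. by case: orth_entries. Qed.
Lemma ee1 : e = 1 \/ e = -1. Proof. by case: orth_entries. Qed.

Definition latt (n : int * int) : 'cV[R]_2 :=
  Q *m @hex_matrix2 R *m map_mx intr (\col_(i < 2) (if i == 0 then n.1 else n.2)).

Lemma topt_latt n : topt (latt n) = P n.
Proof.
have [_ _ x y] := orth_entries.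
have r0 := @fr3_gt0 R; have s0 : Num.sqrt 2 != 0 :> R by rewrite gt_eqF// sqrtr_gt0.
have h : @hex_matrix2 R *m map_mx intr (\col_(i < 2) (if i == 0 then n.1 else n.2)) =
   \col_(i < 2) (if i == 0 then (Sl n).1 else (Sl n).2).
  apply/colP => i; rewrite !mxE !big_ord_recl big_ord0 !mxE /=.
  case: i => -[|[|//]] j /=; rewrite -/fr3.
    rewrite mulr0 mul0r !addr0; congr (_ * _).
    by rewrite mulrCA -invfM -expr2 sqr_sqrtr.
  by move: (n.1%:~R) (n.2%:~R) => k m; field; rewrite s0 gt_eqF.
rewrite /latt -mulmxA h /topt /rot !mxE !big_ord_recl !big_ord0 !mxE /=.
have -> : lift ord0 ord0 = 1 :> 'I_2 by apply/val_inj.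
rewrite x y -/c -/d; congr (_, _) => /=; ring.
Qed.

(** The frame sum ranges over the lattice as a set, so indexing it by pairs of integers must not
    count a point twice. *)
Lemma latt_inj : injective latt.
Proof.
move=> m n /(congr1 topt); rewrite !topt_latt => h.
have {}h : Sl m = Sl n :> R * R by exact: (rot_pt_inj cd1 ee1 h).
have r0 := @fr3_gt0 R; case: h.
move=> /(mulfI (lt0r_neq0 (divr_gt0 r0 (ltr0n _ 2)))) /intr_inj e1.
rewrite e1 => /(mulfI (invr_neq0 (lt0r_neq0 r0))) /addIr /intr_inj e2.
by case: m n e1 e2 => [? ?] [? ?] /= -> ->.
Qed.

Lemma latt_range : lattice (Q *m @hex_matrix2 R) = range latt.
Proof.
rewrite /lattice; apply/seteqP; split=> _ [k _ <-]; last by eexists.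
exists (k 0 0, k 1 0) => //; rewrite /latt; congr (_ *m map_mx _ _).
apply/colP => i; rewrite mxE /=; case: i => -[|[|//]] j /=; congr (k _ _); exact/val_inj.
Qed.

Local Notation Lh := (lattice (Q *m @hex_matrix2 R)).
Local Notation coef h n := (ip h (shift (P n)) ^+ 2 + ip h (ishift (P n)) ^+ 2).

Lemma gabor_esum f : csq (reim f) -> gabor_sum (@gaussian R) Lh f =
  (\esum_(n in [set: int * int]) (coef (reim f) n)%:E)%E.
Proof.
move=> q; rewrite /gabor_sum latt_range esum_image; last by move=> x y _ _; exact: latt_inj.
by apply: eq_esum => n _; rewrite inner_sqr// topt_latt.
Qed.

(** Each lattice point carries a real and an imaginary coefficient; indexing them separately puts
    the Gabor system into the real setting of [frame_extend]. *)
Let I := ((int * int) * bool)%type.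
Let E (i : I) : @cfun R := if i.2 then shift (P i.1) else ishift (P i.1).

Lemma rsum_bool (T : choiceType) (F : T * bool -> R) : summ F ->
  summ (fun n => F (n, true) + F (n, false)) /\
  rsum F = rsum (fun n => F (n, true) + F (n, false)).
Proof.
move=> sF.
have h n : rsum (fun b => F (n, b)) = F (n, true) + F (n, false).
  rewrite (@rsum_finite R _ [:: true; false] (fun b => F (n, b)) _ _).2//.
    by rewrite !big_cons big_nil addr0.
  by case.
split; first exact: eq_summ h (summ_pair sF).
by rewrite (rsum_pair sF); exact: eq_rsum.
Qed.

Lemma frame_waves s : summ (fun i => ip (wave s) (E i) ^+ 2) /\
  2 * @bv R * nn (wave s) <= rsum (fun i => ip (wave s) (E i) ^+ 2) <= 2 * @av R * nn (wave s).
Proof.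
have sg := rot_summ cd1 ee1 s.
have sb : summ (fun _ : bool => 1 : R).
  by apply: (@rsum_finite R _ [:: true; false] _ _ _).1 => //; case.
have sE : summ (fun i => ip (wave s) (E i) ^+ 2).
  apply: summ_le (summM sg sb) => -[n b] /=; rewrite mulr1 -gf_ip ger0_norm ?sqr_ge0//.
  by rewrite /E; case: b => /=; rewrite ?lerDl ?lerDr sqr_ge0.
split=> //; have [_ ->] := rsum_bool sE.
by rewrite (eq_rsum (g := fun n => gf s (P n))); [exact: (rot_frame cd1 ee1)|move=> n; rewrite -gf_ip].
Qed.

Lemma gabor_bounds f : csq (reim f) ->
  exists2 G : R, gabor_sum (@gaussian R) Lh f = G%:E &
    2 * @bv R * nn (reim f) <= G <= 2 * @av R * nn (reim f).
Proof.
move=> q; have a0 : 0 <= 2 * @av R by rewrite mulr_ge0// ltW// av_gt0.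
have b0 : 0 <= 2 * @bv R by rewrite mulr_ge0// ltW// bv_gt0.
have qE i : csq (E i) by rewrite /E; case: i.2; exact: csq_wave.
have [sf bnd] := frame_extend b0 a0 qE (@csq_wave R) (@wave_dense R) frame_waves q.
have [s1 e1] := rsum_bool sf.
exists (rsum (fun i => ip (reim f) (E i) ^+ 2)) => //.
rewrite gabor_esum// e1 rsum_ge0E//.
by move=> n; rewrite addr_ge0 ?sqr_ge0.
Qed.

Lemma gabor_wave s : gabor_sum (@gaussian R) Lh (ofpair (wave s)) = (rsum (fun n => gf s (P n)))%:E.
Proof.
have q : csq (reim (ofpair (wave s))) by rewrite reimK; exact: csq_wave.
rewrite gabor_esum// reimK -rsum_ge0E; [|by move=> n; exact: gf_ge0|exact: rot_summ cd1 ee1 s].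
by apply: eq_esum => n _; rewrite gf_ip.
Qed.

(** An admissible constant is tested on the box combinations, with both sides divided by [N^2]; in
    the limit one factor [S] cancels. *)
Lemma sharp_ratio (u x : R) : let S := rsum (fun x => qz3 kappa x * cos (u * (x.1 - x.2)%:~R)) in
  0 < S ->
  ((forall s, x * nn (wave s) <= rsum (fun n => gf s (P n))) -> x <= 2 * S) /\
  ((forall s, rsum (fun n => gf s (P n)) <= x * nn (wave s)) -> 2 * S <= x).
Proof.
move=> S S0; have [W [h1 h2]] := rot_sharp cd1 ee1 u; rewrite -/S in h1 h2.
have h3 : x * (nn (wave (W N)) / N%:R ^+ 2) @[N --> \oo] --> x * S by apply: cvgM; [exact: cvg_cst|].
split=> H.
  have := ler_cvg_to h3 h2 (nearW _ _) => h.
  have {}h : x * S <= 2 * S ^+ 2.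
    by apply: h => N; rewrite mulrA ler_wpM2r// invr_ge0 exprn_ge0.
  by rewrite -(ler_pM2r S0) -mulrA -expr2.
have := ler_cvg_to h2 h3 (nearW _ _) => h.
have {}h : 2 * S ^+ 2 <= x * S.
  by apply: h => N; rewrite mulrA ler_wpM2r// invr_ge0 exprn_ge0.
by rewrite -(ler_pM2r S0) -mulrA -expr2.
Qed.

Lemma sum_av : rsum (fun x => qz3 kappa x * cos (0 * (x.1 - x.2)%:~R)) = @av R.
Proof. by apply: eq_rsum => x; rewrite mul0r cos0 mulr1. Qed.

Lemma sum_bv : rsum (fun x => qz3 kappa x * cos (2 * pi / 3 * (x.1 - x.2)%:~R)) = @bv R.
Proof. by rewrite -bvE; apply: eq_rsum => x; rewrite mulrC /chi mulrAC -!mulrA. Qed.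

Lemma lower_boundE : lower_frame_bound (@gaussian R) Lh = (2 * @bv R)%:E.
Proof.
apply/eqP; rewrite eq_le; apply/andP; split.
  apply: ge_ereal_sup => _ [a ha <-]; rewrite lee_fin.
  have [] := @sharp_ratio (2 * pi / 3) a; rewrite sum_bv; first exact: bv_gt0.
  move=> + _; apply => s; have := ha _ (csq_L2 (csq_wave s)).
  by rewrite gabor_wave L2norm_sqr reimK ?lee_fin//; exact: csq_wave.
apply: ereal_sup_ubound; exists (2 * @bv R) => // f /L2_csq q.
by have [G -> /andP[h _]] := gabor_bounds q; rewrite L2norm_sqr// lee_fin.
Qed.

Lemma upper_boundE : upper_frame_bound (@gaussian R) Lh = (2 * @av R)%:E.
Proof.
apply/eqP; rewrite eq_le; apply/andP; split.
  apply: ereal_inf_lbound; exists (2 * @av R) => // f /L2_csq q.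
  by have [G -> /andP[_ h]] := gabor_bounds q; rewrite L2norm_sqr// lee_fin.
apply: le_ereal_inf_tmp => _ [a ha <-]; rewrite lee_fin.
have [] := @sharp_ratio 0 a; rewrite sum_av; first exact: av_gt0.
move=> _; apply => s; have := ha _ (csq_L2 (csq_wave s)).
by rewrite gabor_wave L2norm_sqr reimK ?lee_fin//; exact: csq_wave.
Qed.

End Hex.
End Frames.

Theorem proposition5p1 (R : realType) (Lh : set 'cV[R]_2)
    (hLh : hexagonal_lattice2 Lh) :
  gabor_frame (@gaussian R) Lh /\
  fine (upper_frame_bound (@gaussian R) Lh)
    / fine (lower_frame_bound (@gaussian R) Lh) = 2 `^ 3^-1.
Proof.
have [Q [QQ ->]] := hLh.
rewrite /gabor_frame (lower_boundE QQ) (upper_boundE QQ) /=.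
have b0 := @bv_gt0 R; have a0 := @av_gt0 R; have ab := @av_over_bv R.
split; last by rewrite -ab invfM mulrACA mulfV// mul1r.
rewrite !lte_fin lee_fin ltry mulr_gt0//; split=> //; split=> //.
(* The order of the two bounds follows from their ratio, since the cube root of 2 is at least 1. *)
rewrite ler_pM2l// -[leLHS]mul1r -ler_pdivlMr// ab.
by rewrite -[X in X <= _](powRr0 2) ler_powR ?ler1n// invr_ge0.
Qed.
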